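(* Let $0<q<1$, let $z\in\mathbb{C}$ with $\Re z>0$, and put $\delta=\frac{2\pi i}{\log q}$. Then $$\zeta(s,z:q)=-\frac{(q-q^2)^s}{s\log q}F(s,s,s+1:q^z)+\frac12\Big(\frac{q-q^2}{1-q^z}\Big)^s+\frac{s(q-q^2)^s}{2\pi i}\sum_{l\ne0}\frac{1}{l(s+\delta l)}F(s+1,s+\delta l,s+1+\delta l:q^z),$$ where $l$ runs over the nonzero integers. The infinite series on the right-hand side converges absolutely for $s\ne -r+\delta l$ ($r\in\mathbb{Z}_{\ge0}$, $l\in\mathbb{Z}$, $l\neq 0$), and hence is holomorphic in this region.
   Context: $[x]_q=\frac{1-q^x}{1-q}$, and $\zeta(s,z:q)$ denotes the meromorphic continuation to the whole $s$-plane of $\sum_{k=0}^{\infty}q^{s(k+1)}/[k+z]_q^{\,s}$ (convergent for $\Re s>0$), with complex powers taken using the principal branch. $F(\alpha,\beta,\gamma:x)$ is the Gauss hypergeometric function ${}_2F_1(\alpha,\beta;\gamma;x)$. *)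

(* Defs.v *)
From Stdlib Require Import Reals ZArith.
From Coquelicot Require Import Coquelicot.
Open Scope R_scope.

Definition Cexp (z : C) : C :=
  (exp (Re z) * cos (Im z), exp (Re z) * sin (Im z)).

(* Principal argument, with values in (-PI, PI]. *)
Definition Carg (z : C) : R :=
  let x := Re z in let y := Im z in
  if Rlt_dec 0 x then atan (y / x)
  else if Rlt_dec x 0 then
         (if Rle_dec 0 y then atan (y / x) + PI else atan (y / x) - PI)
  else if Rlt_dec 0 y then PI / 2
  else if Rlt_dec y 0 then - (PI / 2)
  else 0.

Definition Clog (z : C) : C := (ln (Cmod z), Carg z).

Definition Cpow (w s : C) : C := Cexp (Cmult s (Clog w)).

Fixpoint Cpown (x : C) (n : nat) : C :=
  match n with O => RtoC 1 | S m => Cmult (Cpown x m) x end.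

Fixpoint poch (a : C) (n : nat) : C :=
  match n with O => RtoC 1 | S m => Cmult (poch a m) (Cplus a (RtoC (INR m))) end.

(* Sum of a complex series (meaningful when the series converges). *)
Definition CSeries (u : nat -> C) : C :=
  (Series (fun n => Re (u n)), Series (fun n => Im (u n))).

Definition hyp2F1_term (a b c x : C) (n : nat) : C :=
  Cdiv (Cmult (Cmult (poch a n) (poch b n)) (Cpown x n))
       (Cmult (poch c n) (RtoC (INR (fact n)))).

Definition hyp2F1 (a b c x : C) : C := CSeries (hyp2F1_term a b c x).

Definition qpow (q : R) (x : C) : C := Cexp (Cmult x (RtoC (ln q))).
Definition qnum (q : R) (x : C) : C :=
  Cdiv (Cminus (RtoC 1) (qpow q x)) (RtoC (1 - q)).

Definition qzeta_term (q : R) (s z : C) (k : nat) : C :=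
  Cdiv (qpow q (Cmult s (RtoC (INR (S k)))))
       (Cpow (qnum q (Cplus (RtoC (INR k)) z)) s).

Definition qdelta (q : R) : C := Cdiv (0%R, (2 * PI)%R) (RtoC (ln q)).

Definition exceptional (q : R) (s : C) : Prop :=
  exists (r : nat) (l : Z),
    s = Cplus (RtoC (- INR r)) (Cmult (qdelta q) (RtoC (IZR l))).

Definition exceptional_nz (q : R) (s : C) : Prop :=
  exists (r : nat) (l : Z), l <> 0%Z /\
    s = Cplus (RtoC (- INR r)) (Cmult (qdelta q) (RtoC (IZR l))).

Definition lterm (q : R) (s z : C) (l : Z) : C :=
  let sdl := Cplus s (Cmult (qdelta q) (RtoC (IZR l))) in
  Cmult (Cinv (Cmult (RtoC (IZR l)) sdl))
        (hyp2F1 (Cplus s (RtoC 1)) sdl (Cplus sdl (RtoC 1)) (qpow q z)).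

Definition lpair (q : R) (s z : C) (n : nat) : C :=
  Cplus (lterm q s z (Z.of_nat (S n))) (lterm q s z (- Z.of_nat (S n))).

Definition lsum (q : R) (s z : C) : C := CSeries (lpair q s z).

Definition qzeta_rhs (q : R) (s z : C) : C :=
  let c := Cpow (RtoC (q - q ^ 2)) s in
  Cplus (Cplus
    (Copp (Cmult (Cdiv c (Cmult s (RtoC (ln q))))
                 (hyp2F1 s s (Cplus s (RtoC 1)) (qpow q z))))
    (Cmult (RtoC (1/2)) (Cpow (Cdiv (RtoC (q - q ^ 2)) (Cminus (RtoC 1) (qpow q z))) s)))
    (Cmult (Cdiv (Cmult s c) (0%R, (2 * PI)%R)) (lsum q s z)).

Definition discrete_closed (P : C -> Prop) : Prop :=
  forall w : C, exists eps : R, 0 < eps /\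
    forall p : C, P p -> p <> w -> eps <= Cmod (Cminus p w).

(* Z is a meromorphic continuation to C of zeta(.,z:q): Z is holomorphic
   off a discrete closed set P and coincides with the defining series on Re s > 0. *)
Definition is_qzeta_continuation (q : R) (z : C) (P : C -> Prop) (Zf : C -> C) : Prop :=
  discrete_closed P /\
  (forall s : C, ~ P s -> @ex_derive C_AbsRing C_NormedModule Zf s) /\
  (forall s : C, 0 < Re s -> is_series (K := C_AbsRing) (V := C_NormedModule) (qzeta_term q s z) (Zf s)).

(* Main.v *)
Require Import Defs.
From Stdlib Require Import Reals ZArith Lra Lia Psatz ClassicalEpsilon Classical List.
From Coquelicot Require Import Coquelicot.
Open Scope R_scope.

(* For Re s > 0, expand each (1 - q^(k+z))^(-s) binomially and sum over k first:
   zeta(s,z:q) = (q - q^2)^s sum_m (s)_m/m! q^(mz) / (1 - q^(s+m)).  The partial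
   fraction expansion of 1/(1 - q^w), with the poles paired as +-l, splits this into the
   three terms of the formula: the sums over l and m may be interchanged because the
   paired terms are O(l^-2), and s (s+1)_m = (s)_m (s+m) accounts for the shifted first
   parameter s+1 of F.

   In general, sum_m (s+1)_m/m! q^(mz) / (l (s+m+delta l)) is O(l^-2) because
   |s+m+delta l| >= kappa |l|, and the same bounds on a disc around s make the right-hand
   side holomorphic off the exceptional set.  The formula then propagates from Re s > 0
   to the complement of the discrete closed set of singularities: by Goursat's lemma and
   a Cauchy estimate for f(z)/(z-a)^n, a holomorphic function vanishing near a vanishes on
   the largest disc, and any regular point is joined to the half-plane by a segment that
   stays away from the singularities. *)

(** The term with factor 1/2 and the pairing of the poles have one source: 1/(1 - e^u) = (1 +
    K(u))/2 with K(u) = (1 + e^u)/(1 - e^u) odd. The expansion of K comes from iterating its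
    duplication formula over N nodes, N a power of 2, and letting N grow under a summable bound; no
    contour integral enters it. A pair of poles n1, n2 contributes 2(s+m)/(n1 n2), whose numerator
    grows with m. Absorbing s+m into (s)_m yields a majorant of product form A_m B_l, the form on
    which the interchange of the sums rests. Contour integration serves uniqueness only. [Zf] is
    known to be complex differentiable off [P] and to sum the series for Re s > 0, so neither a
    Taylor expansion nor continuity of the derivative is at hand. For the explicit series,
    differentiability is carried by the quantitative bound [maj] in place of uniform convergence.
    Principal powers split freely because every base is a positive number, or 1 - x with |x| < 1 up
    to positive factors and inversion, and so lies in the right half-plane. *)

Notation Cser u l := (@is_series C_AbsRing C_NormedModule u l).

(** * Series of complex numbers *)

Lemma C_ext (a b : C) : Re a = Re b -> Im a = Im b -> a = b.
Proof. destruct a, b; simpl; congruence. Qed.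

Lemma im_le_Cmod (c : C) : Rabs (Im c) <= Cmod c.
Proof. eapply Rle_trans; [apply Rmax_r | apply Rmax_Cmod]. Qed.

Lemma Cmod_le_Re_Im (c : C) : Cmod c <= Rabs (Re c) + Rabs (Im c).
Proof.
  rewrite <- (Rabs_pos_eq (Rabs (Re c) + Rabs (Im c)))
    by (generalize (Rabs_pos (Re c)) (Rabs_pos (Im c)); lra).
  unfold Cmod. rewrite <- sqrt_Rsqr_abs. apply sqrt_le_1_alt.
  unfold Rsqr. fold (Re c) (Im c).
  generalize (Rabs_pos (Re c)) (Rabs_pos (Im c)) (pow2_abs (Re c)) (pow2_abs (Im c)).
  nra.
Qed.

Lemma Cmod_triangle_minus (a b : C) : Cmod (a - b) <= Cmod a + Cmod b.
Proof.
  unfold Cminus. eapply Rle_trans; [apply Cmod_triangle|].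
  rewrite Cmod_opp. lra.
Qed.

Lemma Cmod_triangle_rev (a b : C) : Cmod a - Cmod b <= Cmod (a + b).
Proof.
  generalize (Cmod_triangle_minus (a + b) b).
  replace (a + b - b)%C with a by ring. lra.
Qed.

Lemma Cmod_minus_sym (a b : C) : Cmod (a - b) = Cmod (b - a).
Proof. rewrite <- Cmod_opp. f_equal. ring. Qed.

Definition Csum (u : nat -> C) (n : nat) : C := @sum_n C_AbelianMonoid u n.

Lemma Csum_O (u : nat -> C) : Csum u 0 = u 0%nat.
Proof. apply (sum_O (G := C_AbelianMonoid)). Qed.

Lemma Csum_S (u : nat -> C) (n : nat) : Csum u (S n) = (Csum u n + u (S n))%C.
Proof. apply (sum_Sn (G := C_AbelianMonoid)). Qed.

Lemma Re_Csum (u : nat -> C) (n : nat) : Re (Csum u n) = sum_n (fun k => Re (u k)) n.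
Proof.
  induction n.
  - now rewrite Csum_O, sum_O.
  - now rewrite Csum_S, sum_Sn, <- IHn.
Qed.

Lemma Im_Csum (u : nat -> C) (n : nat) : Im (Csum u n) = sum_n (fun k => Im (u k)) n.
Proof.
  induction n.
  - now rewrite Csum_O, sum_O.
  - now rewrite Csum_S, sum_Sn, <- IHn.
Qed.

Lemma Cser_iff (u : nat -> C) (l : C) :
  Cser u l <-> is_series (fun n => Re (u n)) (Re l) /\ is_series (fun n => Im (u n)) (Im l).
Proof.
  split.
  - intros H; split.
    + intros P [e He]. specialize (H (fun z => P (Re z))).
      destruct H as [N HN].
      * exists e. intros y [Hy _]. apply He. exact Hy.
      * exists N. intros n Hn. specialize (HN n Hn). simpl in HN.
        rewrite <- Re_Csum. exact HN.
    + intros P [e He]. specialize (H (fun z => P (Im z))).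
      destruct H as [N HN].
      * exists e. intros y [_ Hy]. apply He. exact Hy.
      * exists N. intros n Hn. specialize (HN n Hn). simpl in HN.
        rewrite <- Im_Csum. exact HN.
  - intros [H1 H2] P [e He].
    destruct (H1 (fun x => ball (Re l) e x)) as [N1 HN1]; [now exists e|].
    destruct (H2 (fun x => ball (Im l) e x)) as [N2 HN2]; [now exists e|].
    exists (max N1 N2). intros n Hn. apply He. split.
    + change (ball (Re l) e (Re (Csum u n))).
      rewrite Re_Csum. apply HN1. lia.
    + change (ball (Im l) e (Im (Csum u n))).
      rewrite Im_Csum. apply HN2. lia.
Qed.

Lemma CSeries_unique (u : nat -> C) (l : C) : Cser u l -> CSeries u = l.
Proof.
  intros H. apply Cser_iff in H. destruct H as [H1 H2].
  apply C_ext; simpl; now apply is_series_unique.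
Qed.

Lemma CSeries_ext (u v : nat -> C) : (forall n, u n = v n) -> CSeries u = CSeries v.
Proof.
  intros H. unfold CSeries. f_equal; apply Series_ext; intros n; now rewrite H.
Qed.

Lemma Cser_dominated (u : nat -> C) (b : nat -> R) :
  (forall n, Cmod (u n) <= b n) -> ex_series b -> Cser u (CSeries u).
Proof.
  intros H Hb. apply Cser_iff. split; apply Series_correct.
  - apply (ex_series_le (V := R_CompleteNormedModule) _ b); [|exact Hb].
    intros n. eapply Rle_trans; [apply re_le_Cmod|apply H].
  - apply (ex_series_le (V := R_CompleteNormedModule) _ b); [|exact Hb].
    intros n. eapply Rle_trans; [apply im_le_Cmod|apply H].
Qed.

Lemma Cser_ext (u v : nat -> C) (l : C) : (forall n, u n = v n) -> Cser u l -> Cser v l.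
Proof. intros H. now apply is_series_ext. Qed.

Lemma Cser_plus (u v : nat -> C) (l m : C) :
  Cser u l -> Cser v m -> Cser (fun n => (u n + v n)%C) (l + m)%C.
Proof. exact (is_series_plus (V := C_NormedModule) u v l m). Qed.

Lemma Cser_scal (c : C) (u : nat -> C) (l : C) :
  Cser u l -> Cser (fun n => (c * u n)%C) (c * l)%C.
Proof. exact (is_series_scal (V := C_NormedModule) c u l). Qed.

Lemma Cser_opp (u : nat -> C) (l : C) : Cser u l -> Cser (fun n => (- u n)%C) (- l)%C.
Proof. exact (is_series_opp (V := C_NormedModule) u l). Qed.

Lemma Cser_unique (u : nat -> C) (l m : C) : Cser u l -> Cser u m -> l = m.
Proof. intros H1 H2. now rewrite <- (CSeries_unique _ _ H1), <- (CSeries_unique _ _ H2). Qed.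

(** The uniform structure behind [is_series] on C is that of a product, with boxes as balls; this
    passes to the modulus. The [e / 2] shares the error between two coordinates in one direction and
    restores strictness in the other. *)
Lemma Cser_eps (u : nat -> C) (l : C) :
  Cser u l <->
  (forall e, 0 < e -> exists N, forall n, (N <= n)%nat ->
     Cmod (Csum u n - l) <= e).
Proof.
  split.
  - intros H e He. apply Cser_iff in H. destruct H as [H1 H2].
    destruct (H1 (fun x => Rabs (x - Re l) < e / 2)) as [N1 HN1].
    { exists (mkposreal (e / 2) ltac:(lra)). intros y Hy. exact Hy. }
    destruct (H2 (fun x => Rabs (x - Im l) < e / 2)) as [N2 HN2].
    { exists (mkposreal (e / 2) ltac:(lra)). intros y Hy. exact Hy. }
    exists (max N1 N2). intros n Hn.
    specialize (HN1 n ltac:(lia)). specialize (HN2 n ltac:(lia)).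
    rewrite <- Re_Csum in HN1. rewrite <- Im_Csum in HN2.
    eapply Rle_trans; [apply Cmod_le_Re_Im|].
    unfold Cminus. rewrite re_plus, im_plus, re_opp, im_opp.
    unfold Rminus in HN1, HN2. lra.
  - intros H. apply Cser_iff. split.
    + intros P [e He]. destruct (H (e / 2)) as [N HN]; [generalize (cond_pos e); lra|].
      exists N. intros n Hn. apply He. rewrite <- Re_Csum.
      change (Rabs (Re (Csum u n) - Re l) < e).
      specialize (HN n Hn). generalize (re_le_Cmod (Csum u n - l)%C).
      unfold Cminus at 1. rewrite re_plus, re_opp. generalize (cond_pos e).
      unfold Rminus. lra.
    + intros P [e He]. destruct (H (e / 2)) as [N HN]; [generalize (cond_pos e); lra|].
      exists N. intros n Hn. apply He. rewrite <- Im_Csum.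
      change (Rabs (Im (Csum u n) - Im l) < e).
      specialize (HN n Hn). generalize (im_le_Cmod (Csum u n - l)%C).
      unfold Cminus at 1. rewrite im_plus, im_opp. generalize (cond_pos e).
      unfold Rminus. lra.
Qed.

Lemma Cmod_sum_n (u : nat -> C) (b : nat -> R) (n : nat) :
  (forall k, Cmod (u k) <= b k) ->
  Cmod (Csum u n) <= sum_n b n.
Proof.
  intros H. induction n.
  - rewrite Csum_O, sum_O. apply H.
  - rewrite Csum_S, sum_Sn. eapply Rle_trans; [apply Cmod_triangle|].
    apply Rplus_le_compat; [exact IHn|apply H].
Qed.

Lemma sum_n_le_Series (b : nat -> R) (n : nat) :
  (forall k, 0 <= b k) -> ex_series b -> sum_n b n <= Series b.
Proof.
  intros H Hb. apply Series_correct in Hb.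
  apply (is_lim_seq_incr_compare (sum_n b) (Series b)).
  - exact Hb.
  - intros k. rewrite sum_Sn. unfold plus; simpl. generalize (H (S k)). lra.
Qed.

Lemma Cmod_limit_le (u : nat -> C) (l : C) (B : R) :
  Cser u l -> (forall n, Cmod (Csum u n) <= B) -> Cmod l <= B.
Proof.
  intros H HB. apply Rnot_lt_le. intros Hlt.
  destruct (proj1 (Cser_eps u l) H ((Cmod l - B) / 2)) as [N HN]; [lra|].
  specialize (HN N (le_n _)). specialize (HB N).
  generalize (Cmod_triangle_rev l (Csum u N - l)%C).
  replace (l + (Csum u N - l))%C with (Csum u N) by ring.
  lra.
Qed.

Lemma Cmod_CSeries_le (u : nat -> C) (b : nat -> R) :
  (forall n, Cmod (u n) <= b n) -> ex_series b -> Cmod (CSeries u) <= Series b.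
Proof.
  intros H Hb. apply (Cmod_limit_le u); [now apply Cser_dominated with b|].
  intros n. eapply Rle_trans; [apply Cmod_sum_n, H|].
  apply sum_n_le_Series; [|exact Hb].
  intros k. eapply Rle_trans; [apply Cmod_ge_0|apply H].
Qed.

Lemma Cser_Cmod_le (u : nat -> C) (l : C) (b : nat -> R) :
  Cser u l -> (forall n, Cmod (u n) <= b n) -> ex_series b -> Cmod l <= Series b.
Proof. intros Hl H Hb. rewrite <- (CSeries_unique _ _ Hl). now apply Cmod_CSeries_le. Qed.

Lemma Cser_Csum (u : nat -> nat -> C) (f : nat -> C) (M : nat) :
  (forall m, Cser (u m) (f m)) ->
  Cser (fun l => Csum (fun m => u m l) M) (Csum f M).
Proof.
  intros H. induction M.
  - rewrite Csum_O. apply Cser_ext with (u 0%nat); [|apply H].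
    intros n. now rewrite Csum_O.
  - rewrite Csum_S.
    apply Cser_ext with (fun l => (Csum (fun m => u m l) M + u (S M) l)%C).
    + intros n. now rewrite Csum_S.
    + now apply Cser_plus.
Qed.

Lemma Series_tail_small (A : nat -> R) (e : R) :
  ex_series A -> 0 < e ->
  exists N, forall n, (N <= n)%nat -> Rabs (sum_n A n - Series A) <= e.
Proof.
  intros HA He. apply Series_correct in HA.
  destruct (HA (fun x => Rabs (x - Series A) < e)) as [N HN].
  { exists (mkposreal e He). intros y Hy. exact Hy. }
  exists N. intros n Hn. left. now apply HN.
Qed.

Lemma Cmod_tail_le (u : nat -> C) (l : C) (A : nat -> R) (n : nat) :
  Cser u l -> (forall k, Cmod (u k) <= A k) -> ex_series A ->
  Cmod (Csum u n - l) <= Series A - sum_n A n.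
Proof.
  intros Hl H HA. apply Rnot_lt_le. intros Hlt.
  set (d := Cmod (Csum u n - l) - (Series A - sum_n A n)).
  assert (Hd : 0 < d) by (unfold d; lra).
  destruct (proj1 (Cser_eps u l) Hl (d / 2)) as [N HN]; [lra|].
  assert (Hk : forall k, Cmod (Csum u (n + k) - Csum u n)
                 <= sum_n A (n + k) - sum_n A n).
  { induction k.
    - rewrite Nat.add_0_r. unfold Cminus. rewrite Cplus_opp_r, Cmod_0. lra.
    - rewrite Nat.add_succ_r, Csum_S, sum_Sn. unfold plus; simpl.
      replace (Csum u (n + k) + u (S (n + k)) - Csum u n)%C
        with ((Csum u (n + k) - Csum u n) + u (S (n + k)%nat))%C by ring.
      eapply Rle_trans; [apply Cmod_triangle|]. generalize (H (S (n + k))). lra. }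
  specialize (HN (n + N)%nat ltac:(lia)). specialize (Hk N).
  assert (Hle : sum_n A (n + N) <= Series A).
  { apply sum_n_le_Series; [|exact HA]. intros k.
    eapply Rle_trans; [apply Cmod_ge_0|apply H]. }
  generalize (Cmod_triangle_minus (Csum u (n + N) - l)
    (Csum u (n + N) - Csum u n)).
  replace (Csum u (n + N) - l
    - (Csum u (n + N) - Csum u n))%C
    with (Csum u n - l)%C by ring.
  unfold d in *. lra.
Qed.

(** The product bound makes truncation uniform: cutting the sum over m at N changes every partial
    sum over l by at most the tail of [A] past N times a partial sum of [B], itself at most
    [Series B]. What remains is a finite sum of convergent series. *)
Lemma Cser_Fubini (u : nat -> nat -> C) (A B : nat -> R) (f g : nat -> C) (L : C) :
  (forall m l, Cmod (u m l) <= A m * B l) ->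
  (forall m, 0 <= A m) -> (forall l, 0 <= B l) -> ex_series A -> ex_series B ->
  (forall m, Cser (u m) (f m)) -> (forall l, Cser (fun m => u m l) (g l)) ->
  Cser f L -> Cser g L.
Proof.
  intros Hu HA0 HB0 HA HB Hf Hg HL.
  assert (HSB : 0 <= Series B).
  { eapply Rle_trans; [apply HB0|]. rewrite <- (sum_O B).
    now apply sum_n_le_Series. }
  assert (Hgt : forall N n, Cmod (Csum g n - Csum (fun l => Csum (fun m => u m l) N) n)
      <= (Series A - sum_n A N) * sum_n B n).
  { assert (Hone : forall N l, Cmod (g l - Csum (fun m => u m l) N) <= (Series A - sum_n A N) * B l).
    { intros N l. rewrite Cmod_minus_sym.
      replace ((Series A - sum_n A N) * B l)
        with (Series (fun m => A m * B l) - sum_n (fun m => A m * B l) N).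
      - apply Cmod_tail_le; [apply Hg|intros; apply Hu|now apply ex_series_scal_r].
      - rewrite Series_scal_r.
        assert (E : sum_n (fun m => A m * B l) N = sum_n A N * B l) by apply (sum_n_mult_r (K := R_Ring)).
        rewrite E. ring. }
    intros N n. induction n.
    - rewrite !Csum_O, sum_O. apply Hone.
    - rewrite !(Csum_S _ n), sum_Sn.
      match goal with |- Cmod (?a + ?b - (?c + ?d)) <= _ =>
        replace (a + b - (c + d))%C with ((a - c) + (b - d))%C by ring end.
      eapply Rle_trans; [apply Cmod_triangle|]. unfold plus; simpl.
      rewrite Rmult_plus_distr_l.
      apply Rplus_le_compat; [exact IHn|apply Hone]. }
  apply Cser_eps. intros e He.
  (* The [+ 1] keeps the denominator positive when [B] sums to 0. *)
  destruct (Series_tail_small A (e / 3 / (Series B + 1)) HA) as [N1 HN1].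
  { apply Rdiv_lt_0_compat; lra. }
  destruct (proj1 (Cser_eps f L) HL (e / 3)) as [N2 HN2]; [lra|].
  set (N := max N1 N2).
  specialize (HN1 N ltac:(lia)). specialize (HN2 N ltac:(lia)).
  destruct (proj1 (Cser_eps _ _) (Cser_Csum u f N Hf) (e / 3)) as [n0 Hn0]; [lra|].
  exists n0. intros n Hn. specialize (Hn0 n Hn). specialize (Hgt N n).
  assert (H1 : (Series A - sum_n A N) * sum_n B n <= e / 3).
  { assert (Hs : 0 <= sum_n B n <= Series B).
    { split; [|now apply sum_n_le_Series].
      clear -HB0. induction n; [rewrite sum_O; apply HB0|].
      rewrite sum_Sn. unfold plus; simpl. generalize (HB0 (S n)). lra. }
    apply Rle_trans with (e / 3 / (Series B + 1) * (Series B + 1)); [|right; field; lra].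
    apply Rabs_le_between in HN1.
    assert (0 < e / 3 / (Series B + 1)) by (apply Rdiv_lt_0_compat; lra).
    assert (sum_n A N <= Series A) by now apply sum_n_le_Series.
    apply Rmult_le_compat; lra. }
  replace (Csum g n - L)%C with
    ((Csum g n - Csum (fun l => Csum (fun m => u m l) N) n)
     + (Csum (fun l => Csum (fun m => u m l) N) n - Csum f N) + (Csum f N - L))%C by ring.
  eapply Rle_trans; [apply Cmod_triangle|].
  eapply Rle_trans; [apply Rplus_le_compat_r, Cmod_triangle|]. lra.
Qed.

(** * The complex exponential *)

Lemma Cexp_plus (a b : C) : Cexp (a + b) = (Cexp a * Cexp b)%C.
Proof.
  unfold Cexp. rewrite re_plus, im_plus, exp_plus, cos_plus, sin_plus.
  apply C_ext; simpl; ring.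
Qed.

Lemma Cexp_0 : Cexp 0 = 1.
Proof. unfold Cexp; simpl. rewrite exp_0, cos_0, sin_0. apply C_ext; simpl; ring. Qed.

Lemma Cmod_Cexp (a : C) : Cmod (Cexp a) = exp (Re a).
Proof.
  unfold Cexp, Cmod; simpl.
  replace (exp (Re a) * cos (Im a) * (exp (Re a) * cos (Im a) * 1)
    + exp (Re a) * sin (Im a) * (exp (Re a) * sin (Im a) * 1))
    with (Rsqr (exp (Re a)) * (Rsqr (sin (Im a)) + Rsqr (cos (Im a)))) by (unfold Rsqr; ring).
  rewrite sin2_cos2, Rmult_1_r. apply sqrt_Rsqr. left; apply exp_pos.
Qed.

Lemma Cexp_neq_0 (a : C) : Cexp a <> 0.
Proof. apply Cmod_gt_0. rewrite Cmod_Cexp. apply exp_pos. Qed.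

Lemma Cexp_opp (a : C) : Cexp (- a) = (/ Cexp a)%C.
Proof.
  assert (H : (Cexp (- a) * Cexp a = 1)%C).
  { rewrite <- Cexp_plus. replace (- a + a)%C with (RtoC 0) by ring. apply Cexp_0. }
  rewrite <- (Cmult_1_l (/ Cexp a)), <- H. field. apply Cexp_neq_0.
Qed.

Lemma Cexp_nat (a : C) (n : nat) : Cexp (a * INR n) = (Cexp a ^ n)%C.
Proof.
  induction n.
  - simpl. rewrite Cmult_0_r. apply Cexp_0.
  - rewrite S_INR, RtoC_plus. simpl. rewrite <- IHn, <- Cexp_plus. f_equal. ring.
Qed.

(** Both bounds rest on 1 + x <= e^x. Applied to -x it gives (1 - x) e^x <= 1, hence e^x - 1 - x <=
    x^2/(1 - x) <= 2 x^2. *)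
Lemma exp_taylor1 (x : R) : Rabs x <= 1 / 2 -> 0 <= exp x - 1 - x <= 2 * x ^ 2.
Proof.
  intros H. apply Rabs_le_between in H. split.
  - generalize (exp_ineq1_le x). lra.
  - generalize (exp_ineq1_le (- x)). rewrite exp_Ropp. intros H1.
    generalize (exp_pos x). intros H2.
    assert (H3 : (1 - x) * exp x <= 1).
    { apply Rle_trans with (/ exp x * exp x); [|right; field; lra].
      apply Rmult_le_compat_r; lra. }
    nra.
Qed.

(** cos x - 1 = -2 sin^2(x/2), and |sin y| <= |y|. *)
Lemma cos_taylor0 (x : R) : Rabs (cos x - 1) <= x ^ 2.
Proof.
  replace (cos x) with (cos (2 * (x / 2))) by (f_equal; field).
  rewrite cos_2a_sin.
  assert (H : Rabs (sin (x / 2)) <= Rabs (x / 2)).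
  { destruct (Rle_dec 0 (x / 2)) as [Hx|Hx].
    - rewrite (Rabs_pos_eq (x / 2)) by exact Hx. apply Rabs_le.
      destruct Hx as [Hx|Hx].
      + split; [|left; now apply sin_lt_x].
        destruct (Rle_dec (x / 2) PI) as [Hp|Hp].
        * generalize (sin_ge_0 (x / 2)). lra.
        * generalize (SIN_bound (x / 2)) (PI2_1). lra.
      + rewrite <- Hx, sin_0. lra.
    - rewrite <- Rabs_Ropp, <- (Rabs_Ropp (x / 2)), <- sin_neg.
      rewrite (Rabs_pos_eq (- (x / 2))) by lra. apply Rabs_le.
      split; [|left; apply sin_lt_x; lra].
      destruct (Rle_dec (- (x / 2)) PI) as [Hp|Hp].
      + generalize (sin_ge_0 (- (x / 2))). lra.
      + generalize (SIN_bound (- (x / 2))) (PI2_1). lra. }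
  apply Rsqr_le_abs_1 in H. unfold Rsqr in H.
  rewrite Rabs_left1; nra.
Qed.

(** Mean value theorem for sin t - t, whose derivative cos t - 1 is controlled by [cos_taylor0];
    negative x follows by oddness. *)
Lemma sin_taylor1 (x : R) : Rabs x <= 1 -> Rabs (sin x - x) <= x ^ 2.
Proof.
  assert (Hpos : forall y, 0 <= y <= 1 -> Rabs (sin y - y) <= y ^ 2).
  { intros y [[Hy|Hy] Hy1]; [|rewrite <- Hy, sin_0, Rabs_pos_eq; lra].
    destruct (MVT_gen (fun t => sin t - t) 0 y (fun t => cos t - 1)) as [c [Hc E]].
    - intros t _. auto_derive; [easy|ring].
    - intros t _. apply continuity_pt_minus; [apply continuity_sin|].
      apply derivable_continuous_pt, derivable_pt_id.
    - rewrite Rmin_left, Rmax_right in Hc by lra.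
      rewrite sin_0 in E. replace (sin y - y) with ((cos c - 1) * (y - 0)) by lra.
      rewrite Rabs_mult, (Rabs_pos_eq (y - 0)) by lra.
      generalize (cos_taylor0 c). nra. }
  intros H. destruct (Rle_dec 0 x) as [Hx|Hx].
  - apply Hpos. rewrite Rabs_pos_eq in H; lra.
  - rewrite Rabs_left in H by lra.
    generalize (Hpos (- x) ltac:(lra)). rewrite sin_neg.
    replace (- sin x - - x) with (- (sin x - x)) by ring. rewrite Rabs_Ropp. nra.
Qed.

(** The real part of the remainder costs 2|h|^2 and the imaginary part (5/2)|h|^2; 8 is a rounded-up
    total. *)
Lemma Cexp_taylor1 (h : C) : Cmod h <= 1 / 2 -> Cmod (Cexp h - 1 - h) <= 8 * Cmod h ^ 2.
Proof.
  intros H. destruct h as [x y].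
  assert (Hx := re_le_Cmod (x, y)). assert (Hy := im_le_Cmod (x, y)).
  simpl in Hx, Hy.
  assert (E2 : Cmod (x, y) ^ 2 = x ^ 2 + y ^ 2) by apply Cmod2_alt.
  set (r := Cmod (x, y)) in *.
  eapply Rle_trans; [apply Cmod_le_Re_Im|].
  unfold Cexp, Cminus. rewrite !re_plus, !im_plus, !re_opp, !im_opp. simpl Re; simpl Im.
  destruct (exp_taylor1 x ltac:(lra)) as [E3 E4].
  generalize (cos_taylor0 y) (sin_taylor1 y ltac:(lra)). intros C1 S1.
  apply Rabs_le_between in C1. apply Rabs_le_between in S1.
  assert (Hxx : Rabs x <= 1 / 2) by lra. assert (Hyy : Rabs y <= 1 / 2) by lra.
  apply Rabs_le_between in Hxx. apply Rabs_le_between in Hyy.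
  assert (0 <= exp x <= 2) by nra.
  assert (Hxy : Rabs (x * y) <= (x ^ 2 + y ^ 2) / 2).
  { apply Rabs_le. generalize (pow2_ge_0 (x - y)) (pow2_ge_0 (x + y)). intros; split; lra. }
  apply Rabs_le_between in Hxy.
  assert (H1 : Rabs (exp x * cos y + - (1) + - x) <= 2 * x ^ 2 + 2 * y ^ 2).
  { replace (exp x * cos y + - (1) + - x) with ((exp x - 1 - x) + exp x * (cos y - 1)) by ring.
    apply Rabs_le. split; nra. }
  assert (H2 : Rabs (exp x * sin y + - 0 + - y) <= 2 * y ^ 2 + 2 * x ^ 2 + (x ^ 2 + y ^ 2) / 2).
  { replace (exp x * sin y + - 0 + - y) with (exp x * (sin y - y) + (exp x - 1 - x) * y + x * y) by ring.
    assert (Rabs (exp x * (sin y - y)) <= 2 * y ^ 2).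
    { rewrite Rabs_mult, (Rabs_pos_eq (exp x)) by lra.
      apply Rmult_le_compat; try lra; [apply Rabs_pos|]. apply Rabs_le. lra. }
    assert (Rabs ((exp x - 1 - x) * y) <= 2 * x ^ 2) by (apply Rabs_le; split; nra).
    eapply Rle_trans; [apply Rabs_triang|].
    eapply Rle_trans; [apply Rplus_le_compat_r, Rabs_triang|].
    assert (Rabs (x * y) <= (x ^ 2 + y ^ 2) / 2) by (apply Rabs_le; lra). lra. }
  rewrite E2. nra.
Qed.

(** * Complex differentiability *)

(** Written without a quotient, so that h = 0 is not excluded, and with the derivative named, so
    that it matches [maj]. *)
Definition cdiff (f : C -> C) (s d : C) : Prop :=
  forall e, 0 < e -> exists r, 0 < r /\
    forall h, Cmod h < r -> Cmod (f (s + h)%C - f s - h * d) <= e * Cmod h.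

Lemma locally_Cmod (s : C) (Q : C -> Prop) :
  (exists r, 0 < r /\ forall h, Cmod h < r -> Q (s + h)%C) <->
  @locally (AbsRing_UniformSpace C_AbsRing) s Q.
Proof.
  split.
  - intros [r [Hr H]]. exists (mkposreal r Hr). intros y Hy.
    replace y with (s + (y - s))%C by ring. now apply H.
  - intros [[r Hr] H]. exists r; split; [exact Hr|]. intros h Hh. apply H.
    change (Cmod ((s + h) - s) < r). now replace (s + h - s)%C with h by ring.
Qed.

Lemma cdiff_is_derive (f : C -> C) (s d : C) :
  cdiff f s d <-> @is_derive C_AbsRing C_NormedModule f s d.
Proof.
  split.
  - intros H. split; [apply (is_linear_scal_l (K := C_AbsRing) (V := C_NormedModule))|].
    intros x Hx. apply (is_filter_lim_locally_unique (V := AbsRing_NormedModule C_AbsRing)) in Hx. subst x.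
    intros [e He]. apply (locally_Cmod s). destruct (H e He) as [r [Hr H1]].
    exists r; split; [exact Hr|]. intros h Hh. specialize (H1 h Hh).
    change (Cmod (f (s + h)%C - f s - (s + h - s) * d) <= e * Cmod (s + h - s)).
    replace (s + h - s)%C with h by ring. exact H1.
  - intros [_ H] e He.
    specialize (H s (fun P HP => HP) (mkposreal e He)).
    apply (locally_Cmod s) in H. destruct H as [r [Hr H]].
    exists r; split; [exact Hr|]. intros h Hh. specialize (H h Hh).
    change (Cmod (f (s + h)%C - f s - (s + h - s) * d) <= e * Cmod (s + h - s)) in H.
    replace (s + h - s)%C with h in H by ring. exact H.
Qed.

Lemma Rlt_Rmin (a b c : R) : a < Rmin b c -> a < b /\ a < c.
Proof. intros H. now apply Rmin_Rgt_l in H. Qed.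

Lemma cdiff_ext (f g : C -> C) (s d : C) (r : R) :
  0 < r -> (forall h, Cmod h < r -> f (s + h)%C = g (s + h)%C) -> cdiff f s d -> cdiff g s d.
Proof.
  intros Hr E H e He. destruct (H e He) as [r1 [Hr1 H1]].
  exists (Rmin r r1). split; [now apply Rmin_pos|]. intros h Hh.
  assert (Hh1 : Cmod h < r) by (eapply Rlt_le_trans; [exact Hh|apply Rmin_l]).
  assert (Hh2 : Cmod h < r1) by (eapply Rlt_le_trans; [exact Hh|apply Rmin_r]).
  rewrite <- E by exact Hh1.
  assert (E0 : f s = g s).
  { specialize (E 0). rewrite Cmod_0, Cplus_0_r in E. now apply E. }
  rewrite <- E0. now apply H1.
Qed.

Lemma cdiff_lipschitz (f : C -> C) (s d : C) :
  cdiff f s d -> exists r, 0 < r /\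
    forall h, Cmod h < r -> Cmod (f (s + h)%C - f s) <= (Cmod d + 1) * Cmod h.
Proof.
  intros H. destruct (H 1 ltac:(lra)) as [r [Hr H1]]. exists r; split; [exact Hr|].
  intros h Hh. specialize (H1 h Hh).
  replace (f (s + h) - f s)%C with ((f (s + h) - f s - h * d) + h * d)%C by ring.
  eapply Rle_trans; [apply Cmod_triangle|]. rewrite Cmod_mult. lra.
Qed.

Lemma cdiff_const (c s : C) : cdiff (fun _ => c) s 0.
Proof.
  intros e He. exists 1; split; [lra|]. intros h _.
  replace (c - c - h * 0)%C with (RtoC 0) by ring.
  rewrite Cmod_0. generalize (Cmod_ge_0 h). nra.
Qed.

Lemma cdiff_id (s : C) : cdiff (fun t => t) s 1.
Proof.
  intros e He. exists 1; split; [lra|]. intros h _.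
  replace (s + h - s - h * 1)%C with (RtoC 0) by ring.
  rewrite Cmod_0. generalize (Cmod_ge_0 h). nra.
Qed.

Lemma cdiff_plus (f g : C -> C) (s d1 d2 : C) :
  cdiff f s d1 -> cdiff g s d2 -> cdiff (fun t => (f t + g t)%C) s (d1 + d2)%C.
Proof.
  rewrite !cdiff_is_derive. exact (is_derive_plus (V := C_NormedModule) f g s d1 d2).
Qed.

Lemma cdiff_mult (f g : C -> C) (s d1 d2 : C) :
  cdiff f s d1 -> cdiff g s d2 -> cdiff (fun t => (f t * g t)%C) s (d1 * g s + f s * d2)%C.
Proof.
  intros H1 H2 e He.
  destruct (cdiff_lipschitz f s d1 H1) as [ra [Hra La]].
  (* [K] gathers the coefficients of (e/K)|h| in the three error terms below, plus 1 for positivity.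
     The third term is quadratic in h, which is why |h| < e/K is imposed as well. *)
  set (K := Cmod (f s) + Cmod (g s) + (Cmod d1 + 1) * (Cmod d2 + 1) + 1).
  assert (HK : 0 < K).
  { unfold K. generalize (Cmod_ge_0 (f s)) (Cmod_ge_0 (g s)) (Cmod_ge_0 d1) (Cmod_ge_0 d2). nra. }
  destruct (cdiff_lipschitz g s d2 H2) as [rb [Hrb Lb]].
  destruct (H1 (e / K)) as [rc [Hrc Lc]]; [now apply Rdiv_lt_0_compat|].
  destruct (H2 (e / K)) as [rd [Hrd Ld]]; [now apply Rdiv_lt_0_compat|].
  assert (HeK : 0 < e / K) by now apply Rdiv_lt_0_compat.
  exists (Rmin (e / K) (Rmin (Rmin ra rb) (Rmin rc rd))).
  split; [repeat apply Rmin_pos; assumption|].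
  intros h Hh.
  assert (Hall : Cmod h < e / K /\ Cmod h < ra /\ Cmod h < rb /\ Cmod h < rc /\ Cmod h < rd).
  { repeat match goal with H : _ < Rmin _ _ |- _ => apply Rlt_Rmin in H; destruct H end.
    tauto. }
  destruct Hall as [h0 [h1 [h2 [h3 h4]]]].
  specialize (La h h1). specialize (Lb h h2). specialize (Lc h h3). specialize (Ld h h4).
  replace (f (s + h) * g (s + h) - f s * g s - h * (d1 * g s + f s * d2))%C with
    ((f (s + h) - f s - h * d1) * g s + f s * (g (s + h) - g s - h * d2)
     + (f (s + h) - f s) * (g (s + h) - g s))%C by ring.
  eapply Rle_trans; [apply Cmod_triangle|].
  eapply Rle_trans; [apply Rplus_le_compat_r, Cmod_triangle|].
  rewrite !Cmod_mult.
  assert (A1 : Cmod (f (s + h)%C - f s - h * d1) * Cmod (g s) <= e / K * Cmod h * Cmod (g s)).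
  { apply Rmult_le_compat_r; [apply Cmod_ge_0|exact Lc]. }
  assert (A2 : Cmod (f s) * Cmod (g (s + h)%C - g s - h * d2) <= Cmod (f s) * (e / K * Cmod h)).
  { apply Rmult_le_compat_l; [apply Cmod_ge_0|exact Ld]. }
  assert (A3 : Cmod (f (s + h)%C - f s) * Cmod (g (s + h)%C - g s)
     <= (Cmod d1 + 1) * (Cmod d2 + 1) * (e / K * Cmod h)).
  { apply Rle_trans with (((Cmod d1 + 1) * Cmod h) * ((Cmod d2 + 1) * Cmod h)).
    - apply Rmult_le_compat; try apply Cmod_ge_0; assumption.
    - generalize (Cmod_ge_0 d1) (Cmod_ge_0 d2) (Cmod_ge_0 h). intros B1 B2 B3.
      replace ((Cmod d1 + 1) * Cmod h * ((Cmod d2 + 1) * Cmod h))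
        with ((Cmod d1 + 1) * (Cmod d2 + 1) * (Cmod h * Cmod h)) by ring.
      apply Rmult_le_compat_l; [nra|]. apply Rmult_le_compat_r; lra. }
  apply Rle_trans with (e / K * Cmod h * (K - 1)).
  - replace (K - 1) with (Cmod (f s) + Cmod (g s) + (Cmod d1 + 1) * (Cmod d2 + 1)) by (unfold K; ring).
    nra.
  - apply Rle_trans with (e / K * Cmod h * K).
    + apply Rmult_le_compat_l; [|lra]. generalize (Cmod_ge_0 h). nra.
    + right. field. lra.
Qed.

Lemma cdiff_Cexp (c s : C) : cdiff (fun t => Cexp (t * c)) s (Cexp (s * c) * c).
Proof.
  intros e He. set (K := 8 * Cmod (Cexp (s * c)) * (Cmod c + 1) ^ 2 + 1).
  assert (Hc := Cmod_ge_0 c). assert (Hx := Cmod_ge_0 (Cexp (s * c))).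
  assert (HK : 0 < K) by (unfold K; nra).
  (* The second radius forces |h c| <= 1/2, the range of [Cexp_taylor1]. *)
  exists (Rmin (e / K) (/ (2 * (Cmod c + 1)))). split.
  { apply Rmin_pos; [now apply Rdiv_lt_0_compat|apply Rinv_0_lt_compat; lra]. }
  intros h Hh. apply Rlt_Rmin in Hh. destruct Hh as [h1 h2].
  assert (Hhc : Cmod (h * c) <= Cmod h * (Cmod c + 1)).
  { rewrite Cmod_mult. generalize (Cmod_ge_0 h). nra. }
  assert (Hhc2 : Cmod (h * c) <= 1 / 2).
  { eapply Rle_trans; [exact Hhc|].
    apply Rle_trans with (/ (2 * (Cmod c + 1)) * (Cmod c + 1)).
    - apply Rmult_le_compat_r; lra.
    - right; field; lra. }
  replace ((s + h) * c)%C with (s * c + h * c)%C by ring. rewrite Cexp_plus.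
  replace (Cexp (s * c) * Cexp (h * c) - Cexp (s * c) - h * (Cexp (s * c) * c))%C
    with (Cexp (s * c) * (Cexp (h * c) - 1 - h * c))%C by ring.
  rewrite Cmod_mult.
  apply Rle_trans with (Cmod (Cexp (s * c)) * (8 * (Cmod h * (Cmod c + 1)) ^ 2)).
  - apply Rmult_le_compat_l; [exact Hx|].
    eapply Rle_trans; [now apply Cexp_taylor1|].
    apply Rmult_le_compat_l; [lra|]. apply pow_incr. split; [apply Cmod_ge_0|exact Hhc].
  - apply Rle_trans with (Cmod h * (e / K) * (K - 1)).
    + replace (Cmod (Cexp (s * c)) * (8 * (Cmod h * (Cmod c + 1)) ^ 2))
        with (Cmod h * Cmod h * (K - 1)) by (unfold K; ring).
      apply Rmult_le_compat_r; [unfold K; nra|].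
      apply Rmult_le_compat_l; [apply Cmod_ge_0|lra].
    + apply Rle_trans with (Cmod h * (e / K) * K); [|right; field; lra].
      assert (0 < e / K) by now apply Rdiv_lt_0_compat.
      apply Rmult_le_compat_l; [|lra]. generalize (Cmod_ge_0 h). nra.
Qed.

(* A quantitative form of complex differentiability at [s]: if f(s+h) = sum c_k h^k
   with sum |c_k| rho^k <= M then [maj s rho f c_1 M].  Like that condition, it is
   stable under sums, products (bounds multiply) and dominated series. *)
Definition maj (s : C) (rho : R) (f : C -> C) (d : C) (M : R) : Prop :=
  Cmod (f s) + rho * Cmod d <= M /\
  forall h, Cmod h <= rho ->
    Cmod (f (s + h)%C - f s - h * d) <= (M - Cmod (f s) - rho * Cmod d) * (Cmod h / rho) ^ 2.

Lemma ratio_le_1 (h : C) (rho : R) : 0 < rho -> Cmod h <= rho -> 0 <= Cmod h / rho <= 1.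
Proof.
  intros Hr Hh. split.
  - apply Rmult_le_pos; [apply Cmod_ge_0|left; now apply Rinv_0_lt_compat].
  - apply Rmult_le_reg_r with rho; [exact Hr|]. unfold Rdiv.
    rewrite Rmult_assoc, Rinv_l by lra. lra.
Qed.

(** As |h|/rho <= 1, the value, the linear part and the remainder are at most the three nonnegative
    parts into which [M] is divided. *)
Lemma maj_bound (s : C) (rho : R) (f : C -> C) (d : C) (M : R) (h : C) :
  0 < rho -> maj s rho f d M -> Cmod h <= rho -> Cmod (f (s + h)%C) <= M.
Proof.
  intros Hr [H1 H2] Hh. specialize (H2 h Hh).
  destruct (ratio_le_1 h rho Hr Hh) as [T0 T1].
  replace (f (s + h)%C) with ((f (s + h) - f s - h * d) + f s + h * d)%C by ring.
  eapply Rle_trans; [apply Cmod_triangle|].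
  eapply Rle_trans; [apply Rplus_le_compat_r, Cmod_triangle|]. rewrite Cmod_mult.
  assert (Cmod h * Cmod d <= rho * Cmod d) by (apply Rmult_le_compat_r; [apply Cmod_ge_0|lra]).
  assert ((M - Cmod (f s) - rho * Cmod d) * (Cmod h / rho) ^ 2 <= (M - Cmod (f s) - rho * Cmod d) * 1).
  { apply Rmult_le_compat_l; [lra|]. rewrite <- (pow1 2). now apply pow_incr. }
  lra.
Qed.

Lemma maj_bound0 (s : C) (rho : R) (f : C -> C) (d : C) (M : R) :
  0 < rho -> maj s rho f d M -> Cmod (f s) <= M.
Proof.
  intros Hr [H _]. generalize (Cmod_ge_0 d). nra.
Qed.

Lemma maj_cdiff (s : C) (rho : R) (f : C -> C) (d : C) (M : R) :
  0 < rho -> maj s rho f d M -> cdiff f s d.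
Proof.
  intros Hr [H1 H2] e He. set (a := M - Cmod (f s) - rho * Cmod d) in *.
  assert (Ha : 0 <= a) by (unfold a; lra).
  (* The remainder a(|h|/rho)^2 falls below e|h| once |h| <= e rho^2/(a + 1); the [+ 1] is there
     because a may vanish. *)
  exists (Rmin rho (e * rho ^ 2 / (a + 1))). split.
  { apply Rmin_pos; [exact Hr|]. apply Rdiv_lt_0_compat; [|lra].
    apply Rmult_lt_0_compat; [lra|now apply pow_lt]. }
  intros h Hh. apply Rlt_Rmin in Hh. destruct Hh as [h1 h2].
  eapply Rle_trans; [apply H2; lra|].
  apply Rle_trans with ((a + 1) / rho ^ 2 * Cmod h * Cmod h).
  - replace (a * (Cmod h / rho) ^ 2) with (a * ((Cmod h / rho) ^ 2)) by ring.
    replace ((a + 1) / rho ^ 2 * Cmod h * Cmod h) with ((a + 1) * (Cmod h / rho) ^ 2) by (field; lra).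
    apply Rmult_le_compat_r; [apply pow2_ge_0|lra].
  - apply Rmult_le_compat_r; [apply Cmod_ge_0|].
    apply Rle_trans with ((a + 1) / rho ^ 2 * (e * rho ^ 2 / (a + 1))); [|right; field; lra].
    apply Rmult_le_compat_l; [|lra].
    apply Rmult_le_pos; [lra|]. left. now apply Rinv_0_lt_compat, pow_lt.
Qed.

Lemma maj_weaken (s : C) (rho : R) (f : C -> C) (d : C) (M N : R) :
  M <= N -> maj s rho f d M -> maj s rho f d N.
Proof.
  intros HMN [H1 H2]. split; [lra|]. intros h Hh. eapply Rle_trans; [now apply H2|].
  apply Rmult_le_compat_r; [apply pow2_ge_0|lra].
Qed.

Lemma maj_ext (s : C) (rho : R) (f g : C -> C) (d : C) (M : R) :
  0 < rho -> (forall h, Cmod h <= rho -> f (s + h)%C = g (s + h)%C) ->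
  maj s rho f d M -> maj s rho g d M.
Proof.
  intros Hr E [H1 H2].
  assert (E0 : f s = g s).
  { specialize (E 0). rewrite Cmod_0, Cplus_0_r in E. apply E. lra. }
  split; [now rewrite <- E0|]. intros h Hh. rewrite <- E0, <- E by exact Hh. now apply H2.
Qed.

Lemma maj_const (s : C) (rho : R) (c : C) : maj s rho (fun _ => c) 0 (Cmod c).
Proof.
  split; [rewrite Cmod_0; lra|]. intros h _.
  replace (c - c - h * 0)%C with (RtoC 0) by ring. rewrite Cmod_0. right; ring.
Qed.

Lemma maj_shift (s : C) (rho : R) (c : C) :
  maj s rho (fun t => (t + c)%C) 1 (Cmod (s + c) + rho).
Proof.
  split; [rewrite Cmod_1; lra|]. intros h _.
  replace (s + h + c - (s + c) - h * 1)%C with (RtoC 0) by ring.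
  rewrite Cmod_0, Cmod_1. right; ring.
Qed.

Lemma maj_plus (s : C) (rho : R) (f g : C -> C) (d1 d2 : C) (M N : R) :
  0 < rho -> maj s rho f d1 M -> maj s rho g d2 N ->
  maj s rho (fun t => (f t + g t)%C) (d1 + d2)%C (M + N).
Proof.
  intros Hr [F1 F2] [G1 G2].
  assert (T1 := Cmod_triangle (f s) (g s)). assert (T2 := Cmod_triangle d1 d2).
  assert (T3 : rho * Cmod (d1 + d2) <= rho * Cmod d1 + rho * Cmod d2) by nra.
  split; [lra|]. intros h Hh. specialize (F2 h Hh). specialize (G2 h Hh).
  replace (f (s + h) + g (s + h) - (f s + g s) - h * (d1 + d2))%C
    with ((f (s + h) - f s - h * d1) + (g (s + h) - g s - h * d2))%C by ring.
  eapply Rle_trans; [apply Cmod_triangle|].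
  eapply Rle_trans; [apply Rplus_le_compat; eassumption|].
  rewrite <- Rmult_plus_distr_r. apply Rmult_le_compat_r; [apply pow2_ge_0|lra].
Qed.

(** Write M = a0 + a1 + a2 and N = b0 + b1 + b2 for value, linear part and remainder. Of the nine
    products in M N, a0 b0 is the value, a1 b0 + a0 b1 bounds the linear part, and the other six
    bound the remainder. *)
Lemma maj_mult (s : C) (rho : R) (f g : C -> C) (d1 d2 : C) (M N : R) :
  0 < rho -> maj s rho f d1 M -> maj s rho g d2 N ->
  maj s rho (fun t => (f t * g t)%C) (d1 * g s + f s * d2)%C (M * N).
Proof.
  intros Hr [F1 F2] [G1 G2].
  set (a0 := Cmod (f s)) in *. set (b0 := Cmod (g s)) in *.
  set (a1 := rho * Cmod d1) in *. set (b1 := rho * Cmod d2) in *.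
  assert (Ha0 : 0 <= a0) by apply Cmod_ge_0. assert (Hb0 : 0 <= b0) by apply Cmod_ge_0.
  assert (Ha1 : 0 <= a1) by (unfold a1; generalize (Cmod_ge_0 d1); nra).
  assert (Hb1 : 0 <= b1) by (unfold b1; generalize (Cmod_ge_0 d2); nra).
  set (a2 := M - a0 - a1) in *. set (b2 := N - b0 - b1) in *.
  assert (Ha2 : 0 <= a2) by (unfold a2; lra). assert (Hb2 : 0 <= b2) by (unfold b2; lra).
  assert (Hd : rho * Cmod (d1 * g s + f s * d2) <= a1 * b0 + a0 * b1).
  { apply Rle_trans with (rho * (Cmod d1 * Cmod (g s) + Cmod (f s) * Cmod d2)).
    - apply Rmult_le_compat_l; [lra|].
      eapply Rle_trans; [apply Cmod_triangle|]. rewrite !Cmod_mult. lra.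
    - unfold a1, b1, a0, b0. right; ring. }
  assert (EM : M = a0 + a1 + a2) by (unfold a2; ring).
  assert (EN : N = b0 + b1 + b2) by (unfold b2; ring).
  split.
  - rewrite Cmod_mult. fold a0 b0. rewrite EM, EN. nra.
  - intros h Hh. specialize (F2 h Hh). specialize (G2 h Hh).
    destruct (ratio_le_1 h rho Hr Hh) as [T0 T1].
    set (t := Cmod h / rho) in *.
    assert (Eh : Cmod h = rho * t) by (unfold t; field; lra).
    assert (LF : Cmod (f (s + h)%C - f s) <= (a1 + a2) * t).
    { replace (f (s + h) - f s)%C with ((f (s + h) - f s - h * d1) + h * d1)%C by ring.
      eapply Rle_trans; [apply Cmod_triangle|]. rewrite Cmod_mult, Eh.
      replace (rho * t * Cmod d1) with (a1 * t) by (unfold a1; ring).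
      assert (a2 * t ^ 2 <= a2 * t) by (apply Rmult_le_compat_l; [lra|nra]). lra. }
    assert (LG : Cmod (g (s + h)%C - g s) <= (b1 + b2) * t).
    { replace (g (s + h) - g s)%C with ((g (s + h) - g s - h * d2) + h * d2)%C by ring.
      eapply Rle_trans; [apply Cmod_triangle|]. rewrite Cmod_mult, Eh.
      replace (rho * t * Cmod d2) with (b1 * t) by (unfold b1; ring).
      assert (b2 * t ^ 2 <= b2 * t) by (apply Rmult_le_compat_l; [lra|nra]). lra. }
    replace (f (s + h) * g (s + h) - f s * g s - h * (d1 * g s + f s * d2))%C with
      ((f (s + h) - f s - h * d1) * g s + f s * (g (s + h) - g s - h * d2)
       + (f (s + h) - f s) * (g (s + h) - g s))%C by ring.
    eapply Rle_trans; [apply Cmod_triangle|].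
    eapply Rle_trans; [apply Rplus_le_compat_r, Cmod_triangle|].
    rewrite !Cmod_mult. fold a0 b0.
    assert (A1 : Cmod (f (s + h)%C - f s - h * d1) * b0 <= a2 * t ^ 2 * b0)
      by (apply Rmult_le_compat_r; assumption).
    assert (A2 : a0 * Cmod (g (s + h)%C - g s - h * d2) <= a0 * (b2 * t ^ 2))
      by (apply Rmult_le_compat_l; assumption).
    assert (A3 : Cmod (f (s + h)%C - f s) * Cmod (g (s + h)%C - g s) <= (a1 + a2) * t * ((b1 + b2) * t))
      by (apply Rmult_le_compat; try apply Cmod_ge_0; assumption).
    apply Rle_trans with ((a2 * b0 + a0 * b2 + (a1 + a2) * (b1 + b2)) * t ^ 2); [nra|].
    apply Rmult_le_compat_r; [apply pow2_ge_0|].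
    rewrite EM, EN. nra.
Qed.

(** With w = s + c, the geometric series gives the sum of rho^k/|w|^(k+1) as at most 2/|w| when rho
    <= |w|/2. The remainder is exactly h^2/(w^2 (w + h)), and |w + h| >= |w|/2. *)
Lemma maj_inv (s : C) (rho : R) (c : C) :
  0 < rho -> 2 * rho <= Cmod (s + c) ->
  maj s rho (fun t => (/ (t + c))%C) (- / ((s + c) * (s + c)))%C (2 / Cmod (s + c)).
Proof.
  intros Hr Hw. set (w := (s + c)%C) in *.
  assert (Hw0 : 0 < Cmod w) by lra.
  assert (Hwn : w <> 0) by now apply Cmod_gt_0.
  set (v := Cmod w) in *.
  assert (E1 : Cmod (/ w) = / v) by now apply Cmod_inv.
  assert (E2 : Cmod (- / (w * w)) = / v * / v).
  { rewrite Cmod_opp, Cmod_inv by now apply Cmult_neq_0.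
    rewrite Cmod_mult. fold v. now rewrite Rinv_mult. }
  assert (Hv : 0 < / v) by now apply Rinv_0_lt_compat.
  assert (Hv1 : rho * / v <= 1 / 2).
  { apply Rmult_le_reg_r with v; [exact Hw0|]. rewrite Rmult_assoc, Rinv_l by lra. lra. }
  unfold maj. fold w. rewrite E1, E2. split.
  - unfold Rdiv. nra.
  - intros h Hh.
    assert (Hwh : v / 2 <= Cmod (w + h)).
    { generalize (Cmod_triangle_rev w h). fold v. lra. }
    assert (Hwhn : (w + h)%C <> 0) by (apply Cmod_gt_0; lra).
    replace (s + h + c)%C with (w + h)%C by (unfold w; ring).
    replace (/ (w + h) - / w - h * - / (w * w))%C with (h * h * (/ w * / w * / (w + h)))%C
      by (field; split; assumption).
    rewrite !Cmod_mult, E1, Cmod_inv by exact Hwhn.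
    set (k := Cmod h) in *.
    assert (Hk : 0 <= k) by apply Cmod_ge_0.
    assert (Hi : / Cmod (w + h) <= 2 * / v).
    { replace (2 * / v) with (/ (v / 2)) by (field; lra).
      apply Rinv_le_contravar; lra. }
    apply Rle_trans with (k * k * (/ v * / v * (2 * / v))).
    + apply Rmult_le_compat_l; [nra|]. apply Rmult_le_compat_l; [nra|exact Hi].
    + replace ((2 / v - / v - rho * (/ v * / v)) * (k / rho) ^ 2)
        with (k * k * ((/ v - rho * (/ v * / v)) * / (rho * rho))) by (field; lra).
      apply Rmult_le_compat_l; [nra|].
      apply Rmult_le_reg_r with (rho * rho); [nra|].
      rewrite (Rmult_assoc (/ v - _)), Rinv_l by nra.
      replace (/ v * / v * (2 * / v) * (rho * rho)) with (2 * / v * (rho * / v) * (rho * / v)) by ring.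
      replace (/ v - rho * (/ v * / v)) with (/ v * (1 - rho * / v)) by ring.
      assert (0 <= rho * / v) by nra.
      rewrite Rmult_1_r.
      replace (2 * / v * (rho * / v) * (rho * / v)) with (/ v * (2 * (rho * / v) * (rho * / v))) by ring.
      apply Rmult_le_compat_l; nra.
Qed.

(** Values, linear parts and remainders are each dominated by [M], so all three series converge. By
    the triangle inequality the value and linear part of the sum use up no more of [Series M] than
    [Series a] and [Series b], so the allowance for the remainder can only grow. *)
Lemma maj_series (s : C) (rho : R) (f : nat -> C -> C) (d : nat -> C) (M : nat -> R) :
  0 < rho -> (forall n, maj s rho (f n) (d n) (M n)) -> ex_series M ->
  maj s rho (fun t => CSeries (fun n => f n t)) (CSeries d) (Series M).
Proof.
  intros Hr H HM.
  set (a := fun n => Cmod (f n s)). set (b := fun n => rho * Cmod (d n)).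
  assert (Ha0 : forall n, 0 <= a n) by (intros; apply Cmod_ge_0).
  assert (Hb0 : forall n, 0 <= b n) by (intros; unfold b; generalize (Cmod_ge_0 (d n)); nra).
  assert (Hab : forall n, a n + b n <= M n) by (intros n; apply (H n)).
  assert (Ha : ex_series a).
  { apply (ex_series_le (V := R_CompleteNormedModule) a M); [|exact HM].
    intros n. change (Rabs (a n) <= M n). rewrite Rabs_pos_eq by apply Ha0.
    generalize (Hab n) (Hb0 n). lra. }
  assert (Hb : ex_series b).
  { apply (ex_series_le (V := R_CompleteNormedModule) b M); [|exact HM].
    intros n. change (Rabs (b n) <= M n). rewrite Rabs_pos_eq by apply Hb0.
    generalize (Hab n) (Ha0 n). lra. }
  assert (Hd : ex_series (fun n => Cmod (d n))).
  { apply (ex_series_ext (fun n => / rho * b n)); [intros n; unfold b; change (/ rho * (rho * Cmod (d n)) = Cmod (d n)); field; lra|].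
    now apply ex_series_scal_l with (c := / rho) (a := b). }
  assert (Hc : ex_series (fun n => M n - a n - b n)).
  { apply (ex_series_minus (V := R_NormedModule) (fun n => M n - a n) b); [|exact Hb].
    now apply (ex_series_minus (V := R_NormedModule)). }
  assert (Ec : Series (fun n => M n - a n - b n) = Series M - Series a - Series b).
  { rewrite Series_minus by (try exact Hb; now apply (ex_series_minus (V := R_NormedModule))).
    now rewrite Series_minus. }
  assert (Sf : forall h, Cmod h <= rho -> Cser (fun n => f n (s + h)%C) (CSeries (fun n => f n (s + h)%C))).
  { intros h Hh. apply Cser_dominated with M; [|exact HM]. intros n.
    now apply (maj_bound s rho (f n) (d n)). }
  assert (Sf0 : Cser (fun n => f n s) (CSeries (fun n => f n s))).
  { apply Cser_dominated with a; [intros n; apply Rle_refl|exact Ha]. }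
  assert (Sd : Cser d (CSeries d)).
  { apply Cser_dominated with (fun n => Cmod (d n)); [intros n; apply Rle_refl|exact Hd]. }
  assert (La : Cmod (CSeries (fun n => f n s)) <= Series a).
  { apply Cmod_CSeries_le; [intros n; apply Rle_refl|exact Ha]. }
  assert (Lb : rho * Cmod (CSeries d) <= Series b).
  { unfold b. rewrite Series_scal_l. apply Rmult_le_compat_l; [lra|].
    apply Cmod_CSeries_le; [intros n; apply Rle_refl|exact Hd]. }
  assert (Lab : 0 <= Series M - Series a - Series b).
  { rewrite <- Ec.
    apply Rle_trans with (sum_n (fun n => M n - a n - b n) 0).
    - rewrite sum_O. generalize (Hab 0%nat). lra.
    - apply sum_n_le_Series; [|exact Hc]. intros n. generalize (Hab n). lra. }
  split; [lra|]. intros h Hh.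
  assert (S : Cser (fun n => (f n (s + h) - f n s - h * d n)%C)
     (CSeries (fun n => f n (s + h)%C) - CSeries (fun n => f n s) - h * CSeries d)%C).
  { unfold Cminus. apply Cser_plus; [apply Cser_plus; [now apply Sf|now apply Cser_opp]|].
    apply Cser_opp, Cser_scal, Sd. }
  eapply Rle_trans.
  { apply (Cser_Cmod_le _ _ (fun n => (M n - a n - b n) * (Cmod h / rho) ^ 2) S).
    - intros n. now apply (H n).
    - now apply ex_series_scal_r. }
  rewrite Series_scal_r, Ec. apply Rmult_le_compat_r; [apply pow2_ge_0|lra].
Qed.

(** * Pochhammer symbols and their majorants *)

Fixpoint rpoch (A : R) (n : nat) : R :=
  match n with O => 1 | S m => rpoch A m * (A + INR m) end.

(** The derivative of [poch] by the product rule, with the factor [1] kept so that it has literally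
    the shape produced by [maj_mult]. *)
Fixpoint dpoch (a : C) (n : nat) : C :=
  match n with O => RtoC 0 | S m => (dpoch a m * (a + RtoC (INR m)) + poch a m * 1)%C end.

Lemma rpoch_pos (A : R) (n : nat) : 0 < A -> 0 < rpoch A n.
Proof.
  intros HA. induction n; simpl; [lra|]. generalize (pos_INR n).
  intros. apply Rmult_lt_0_compat; lra.
Qed.

Lemma Cmod_poch_le (a : C) (A : R) (n : nat) :
  0 < A -> Cmod a <= A -> Cmod (poch a n) <= rpoch A n.
Proof.
  intros HA Ha. induction n; simpl; [rewrite Cmod_1; lra|].
  rewrite Cmod_mult. apply Rmult_le_compat; try apply Cmod_ge_0; [exact IHn|].
  eapply Rle_trans; [apply Cmod_triangle|].
  rewrite Cmod_R, Rabs_pos_eq by apply pos_INR. lra.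
Qed.

Lemma maj_poch (s a : C) (rho : R) (n : nat) :
  0 < rho -> maj s rho (fun t => poch (t + a) n) (dpoch (s + a) n) (rpoch (Cmod (s + a) + rho) n).
Proof.
  intros Hr. induction n.
  - simpl. eapply maj_weaken; [|apply maj_const]. rewrite Cmod_1. lra.
  - simpl. apply (maj_mult s rho (fun t => poch (t + a) n) (fun t => (t + a + INR n)%C)); [exact Hr|exact IHn|].
    apply maj_weaken with (Cmod (s + (a + INR n)) + rho).
    + rewrite Cplus_assoc. eapply Rle_trans; [apply Rplus_le_compat_r, Cmod_triangle|].
      rewrite Cmod_R, Rabs_pos_eq by apply pos_INR. lra.
    + apply maj_ext with (fun t => (t + (a + INR n))%C); [exact Hr| |apply maj_shift].
      intros h _. ring.
Qed.

Lemma ex_series_rpoch (A r : R) :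
  0 < A -> 0 <= r < 1 -> ex_series (fun n => rpoch A n / INR (fact n) * r ^ n).
Proof.
  intros HA [Hr0 Hr1].
  assert (Hpos : forall t n, 0 < t -> 0 < rpoch A n / INR (fact n) * t ^ n).
  { intros t n Ht. apply Rmult_lt_0_compat; [|now apply pow_lt].
    apply Rdiv_lt_0_compat; [now apply rpoch_pos|apply INR_fact_lt_0]. }
  (* The ratio test needs nonzero terms and r may be 0, so it is run at a t strictly between r and
     1. The ratio is t (A + n)/(n + 1), with limit t. *)
  set (t := (r + 1) / 2).
  assert (Ht : 0 < t < 1) by (unfold t; lra).
  apply (ex_series_le (V := R_CompleteNormedModule) _ (fun n => Rabs (rpoch A n / INR (fact n) * t ^ n))).
  - intros n. change (Rabs (rpoch A n / INR (fact n) * r ^ n) <= Rabs (rpoch A n / INR (fact n) * t ^ n)).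
    rewrite !Rabs_mult. apply Rmult_le_compat_l; [apply Rabs_pos|].
    rewrite !Rabs_pos_eq by (apply pow_le; lra). apply pow_incr. unfold t; lra.
  - apply ex_series_DAlembert with t; [lra| |].
    + intros n. apply Rgt_not_eq. now apply Hpos.
    + apply is_lim_seq_ext with (fun n => t * (1 + (A - 1) * / INR (S n))).
      * intros n. rewrite Rabs_pos_eq.
        2:{ left. apply Rdiv_lt_0_compat; now apply Hpos. }
        rewrite fact_simpl, mult_INR.
        change (rpoch A (S n)) with (rpoch A n * (A + INR n)).
        change (t ^ S n) with (t * t ^ n).
        rewrite S_INR.
        assert (H1 := rpoch_pos A n HA). assert (H2 := INR_fact_neq_0 n).
        assert (H3 := pos_INR n). assert (H4 : t ^ n <> 0) by (apply pow_nonzero; lra).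
        field. repeat split; lra.
      * evar_last.
        { apply (is_lim_seq_scal_l _ t 1).
          evar_last; [apply is_lim_seq_plus'; [apply is_lim_seq_const|]|].
          - apply (is_lim_seq_scal_l (fun n => / INR (S n)) (A - 1) 0).
            apply (is_lim_seq_incr_1 (fun n => / INR n)).
            evar_last; [apply is_lim_seq_inv; [apply is_lim_seq_INR|easy]|reflexivity].
          - simpl. apply f_equal. ring. }
        simpl. apply f_equal. ring.
Qed.

(** * Closure properties of pointwise complex differentiability *)

Definition cdiffable (f : C -> C) (z : C) : Prop := exists d, cdiff f z d.

Lemma cdiffable_plus (f g : C -> C) (z : C) :
  cdiffable f z -> cdiffable g z -> cdiffable (fun t => (f t + g t)%C) z.
Proof. intros [d1 H1] [d2 H2]. eexists. apply cdiff_plus; eassumption. Qed.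

Lemma cdiffable_mult (f g : C -> C) (z : C) :
  cdiffable f z -> cdiffable g z -> cdiffable (fun t => (f t * g t)%C) z.
Proof. intros [d1 H1] [d2 H2]. eexists. apply cdiff_mult; eassumption. Qed.

Lemma cdiffable_const (c z : C) : cdiffable (fun _ => c) z.
Proof. eexists; apply cdiff_const. Qed.

Lemma cdiffable_id (z : C) : cdiffable (fun t => t) z.
Proof. eexists; apply cdiff_id. Qed.

Lemma cdiffable_inv_shift (c z : C) : (z + c)%C <> 0 -> cdiffable (fun t => (/ (t + c))%C) z.
Proof.
  intros H. eexists. eapply (maj_cdiff z (Cmod (z + c) / 2)).
  - apply Cmod_gt_0 in H. lra.
  - apply maj_inv; apply Cmod_gt_0 in H; lra.
Qed.

Lemma cdiffable_ext (f g : C -> C) (z : C) (r : R) :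
  0 < r -> (forall h, Cmod h < r -> f (z + h)%C = g (z + h)%C) -> cdiffable f z -> cdiffable g z.
Proof. intros Hr E [d H]. exists d. now apply (cdiff_ext f g z d r). Qed.

Lemma cdiffable_pow (f : C -> C) (z : C) (n : nat) :
  cdiffable f z -> cdiffable (fun t => (f t ^ n)%C) z.
Proof.
  intros H. induction n; simpl.
  - apply cdiffable_const.
  - now apply cdiffable_mult.
Qed.

(** * Integrals over the boundary of a rectangle *)

Definition path_continuous (p : R -> C) (a b : R) : Prop :=
  forall t, a <= t <= b ->
    continuous (fun u => Re (p u)) t /\ continuous (fun u => Im (p u)) t.

Lemma cdiffable_continuous (f : C -> C) (z : C) :
  cdiffable f z -> forall e, 0 < e -> exists r, 0 < r /\
    forall h, Cmod h < r -> Cmod (f (z + h)%C - f z) < e.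
Proof.
  intros [d H] e He. destruct (cdiff_lipschitz f z d H) as [r [Hr L]].
  assert (Hd := Cmod_ge_0 d).
  exists (Rmin r (e / (Cmod d + 1))). split.
  - apply Rmin_pos; [exact Hr|]. apply Rdiv_lt_0_compat; lra.
  - intros h Hh. apply Rlt_Rmin in Hh. destruct Hh as [h1 h2].
    eapply Rle_lt_trans; [now apply L|].
    apply Rlt_le_trans with ((Cmod d + 1) * (e / (Cmod d + 1))).
    + apply Rmult_lt_compat_l; lra.
    + right; field; lra.
Qed.

Lemma continuous_comp_affine (f : C -> C) (z v : C) (t : R) :
  Cmod v = 1 -> cdiffable f (z + t * v)%C ->
  continuous (fun u : R => Re (f (z + u * v)%C)) t /\ continuous (fun u : R => Im (f (z + u * v)%C)) t.
Proof.
  intros Hv H.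
  assert (K : forall e : posreal, locally t (fun u : R => Cmod (f (z + u * v)%C - f (z + t * v)%C) < e)).
  { intros [e He]. destruct (cdiffable_continuous f _ H e He) as [r [Hr Hc]].
    exists (mkposreal r Hr). intros u Hu. simpl.
    replace (z + u * v)%C with (z + t * v + (RtoC (u - t) * v))%C by (rewrite RtoC_minus; ring).
    apply Hc. rewrite Cmod_mult, Hv, Cmod_R, Rmult_1_r. exact Hu. }
  split; apply continuity_pt_filterlim, continuity_pt_locally; intros e;
    destruct (K e) as [d Hd]; exists d; intros u Hu; specialize (Hd u Hu);
    eapply Rle_lt_trans; [|exact Hd| |exact Hd].
  - eapply Rle_trans; [|apply re_le_Cmod].
    unfold Cminus. rewrite re_plus, re_opp. apply Rle_refl.
  - eapply Rle_trans; [|apply im_le_Cmod].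
    unfold Cminus. rewrite im_plus, im_opp. apply Rle_refl.
Qed.

Lemma path_continuous_h (f : C -> C) (y a b : R) :
  (forall t, a <= t <= b -> cdiffable f (t, y)) -> path_continuous (fun t => f (t, y)) a b.
Proof.
  intros H t Ht.
  assert (E : forall u : R, (u, y) = (((0, y) : C) + u * 1)%C).
  { intros u. apply C_ext; simpl; ring. }
  destruct (continuous_comp_affine f (0, y) 1 t) as [H1 H2].
  - apply Cmod_1.
  - rewrite <- E. now apply H.
  - split; [eapply continuous_ext; [|apply H1]|eapply continuous_ext; [|apply H2]];
      intros u; simpl; now rewrite (E u).
Qed.

Lemma path_continuous_v (f : C -> C) (x a b : R) :
  (forall t, a <= t <= b -> cdiffable f (x, t)) -> path_continuous (fun t => f (x, t)) a b.
Proof.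
  intros H t Ht.
  assert (E : forall u : R, (x, u) = (((x, 0) : C) + u * Ci)%C).
  { intros u. apply C_ext; simpl; ring. }
  destruct (continuous_comp_affine f (x, 0) Ci t) as [H1 H2].
  - apply Cmod_Ci.
  - rewrite <- E. now apply H.
  - split; [eapply continuous_ext; [|apply H1]|eapply continuous_ext; [|apply H2]];
      intros u; simpl; now rewrite (E u).
Qed.

Definition cRInt (p : R -> C) (a b : R) : C :=
  (RInt (fun t => Re (p t)) a b, RInt (fun t => Im (p t)) a b).

Lemma path_ex_RInt (p : R -> C) (a b : R) :
  a <= b -> path_continuous p a b ->
  ex_RInt (fun t => Re (p t)) a b /\ ex_RInt (fun t => Im (p t)) a b.
Proof.
  intros Hab H. split; apply (ex_RInt_continuous (V := R_CompleteNormedModule));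
    rewrite Rmin_left, Rmax_right by exact Hab; intros t Ht; destruct (H t Ht); assumption.
Qed.

Lemma path_continuous_sub (p : R -> C) (a b c d : R) :
  a <= c -> d <= b -> path_continuous p a b -> path_continuous p c d.
Proof. intros H1 H2 H t Ht. apply H. lra. Qed.

Lemma cRInt_Chasles (p : R -> C) (a b c : R) :
  a <= b <= c -> path_continuous p a c -> (cRInt p a b + cRInt p b c)%C = cRInt p a c.
Proof.
  intros [Hab Hbc] H.
  destruct (path_ex_RInt p a b Hab) as [A1 A2]; [apply (path_continuous_sub p a c); lra || exact H|].
  destruct (path_ex_RInt p b c Hbc) as [B1 B2]; [apply (path_continuous_sub p a c); lra || exact H|].
  apply C_ext; simpl.
  - exact (RInt_Chasles (V := R_CompleteNormedModule) _ a b c A1 B1).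
  - exact (RInt_Chasles (V := R_CompleteNormedModule) _ a b c A2 B2).
Qed.

Lemma cRInt_ext (p r : R -> C) (a b : R) :
  a <= b -> (forall t, a <= t <= b -> p t = r t) -> cRInt p a b = cRInt r a b.
Proof.
  intros Hab H. unfold cRInt. f_equal; apply RInt_ext; intros t;
    rewrite Rmin_left, Rmax_right by exact Hab; intros Ht; rewrite H by lra; reflexivity.
Qed.

Lemma cRInt_plus (p r : R -> C) (a b : R) :
  a <= b -> path_continuous p a b -> path_continuous r a b ->
  cRInt (fun t => (p t + r t)%C) a b = (cRInt p a b + cRInt r a b)%C.
Proof.
  intros Hab Hp Hr.
  destruct (path_ex_RInt p a b Hab Hp) as [A1 A2].
  destruct (path_ex_RInt r a b Hab Hr) as [B1 B2].
  apply C_ext; simpl.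
  - exact (RInt_plus (V := R_CompleteNormedModule) _ _ a b A1 B1).
  - exact (RInt_plus (V := R_CompleteNormedModule) _ _ a b A2 B2).
Qed.

Lemma cRInt_scal (c : C) (p : R -> C) (a b : R) :
  a <= b -> path_continuous p a b ->
  cRInt (fun t => (c * p t)%C) a b = (c * cRInt p a b)%C.
Proof.
  intros Hab Hp. destruct (path_ex_RInt p a b Hab Hp) as [A1 A2].
  assert (S : forall k (u : R -> R), ex_RInt u a b -> ex_RInt (fun t => k * u t) a b).
  { intros k u Hu. exact (ex_RInt_scal (V := R_NormedModule) u a b k Hu). }
  assert (T : forall k (u : R -> R), ex_RInt u a b -> RInt (fun t => k * u t) a b = k * RInt u a b).
  { intros k u Hu. exact (RInt_scal (V := R_CompleteNormedModule) u a b k Hu). }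
  apply C_ext; simpl.
  - rewrite <- !T by assumption.
    exact (RInt_minus (V := R_CompleteNormedModule) _ _ a b (S (Re c) _ A1) (S (Im c) _ A2)).
  - rewrite <- !T by assumption.
    exact (RInt_plus (V := R_CompleteNormedModule) _ _ a b (S (Re c) _ A2) (S (Im c) _ A1)).
Qed.

(** The factor 2 comes from bounding the two components separately. *)
Lemma Cmod_cRInt_le (p : R -> C) (a b M : R) :
  a <= b -> path_continuous p a b -> (forall t, a <= t <= b -> Cmod (p t) <= M) ->
  Cmod (cRInt p a b) <= 2 * M * (b - a).
Proof.
  intros Hab Hp HM. destruct (path_ex_RInt p a b Hab Hp) as [A1 A2].
  eapply Rle_trans; [apply Cmod_le_Re_Im|]. simpl.
  assert (B1 : Rabs (RInt (fun t => Re (p t)) a b) <= (b - a) * M).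
  { apply (norm_RInt_le_const (V := R_NormedModule) (fun t => Re (p t)) a b _ M Hab).
    - intros t Ht. eapply Rle_trans; [apply re_le_Cmod|now apply HM].
    - now apply (RInt_correct (V := R_CompleteNormedModule)). }
  assert (B2 : Rabs (RInt (fun t => Im (p t)) a b) <= (b - a) * M).
  { apply (norm_RInt_le_const (V := R_NormedModule) (fun t => Im (p t)) a b _ M Hab).
    - intros t Ht. eapply Rle_trans; [apply im_le_Cmod|now apply HM].
    - now apply (RInt_correct (V := R_CompleteNormedModule)). }
  lra.
Qed.

Lemma path_bounded (p : R -> C) (a b : R) :
  path_continuous p a b -> exists M, forall t, a <= t <= b -> Cmod (p t) <= M.
Proof.
  intros H.
  destruct (bounded_continuity (V := R_NormedModule) (fun t => Re (p t)) a b) as [M1 H1].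
  { intros t Ht. destruct (H t Ht). assumption. }
  destruct (bounded_continuity (V := R_NormedModule) (fun t => Im (p t)) a b) as [M2 H2].
  { intros t Ht. destruct (H t Ht). assumption. }
  exists (M1 + M2). intros t Ht. eapply Rle_trans; [apply Cmod_le_Re_Im|].
  specialize (H1 t Ht). specialize (H2 t Ht).
  change (Rabs (Re (p t)) < M1) in H1. change (Rabs (Im (p t)) < M2) in H2. lra.
Qed.

(* The counterclockwise contour integral along the boundary of the rectangle. *)
Definition rect_int (f : C -> C) (x0 x1 y0 y1 : R) : C :=
  (cRInt (fun t => f (t, y0)) x0 x1 - cRInt (fun t => f (t, y1)) x0 x1
   + Ci * (cRInt (fun t => f (x1, t)) y0 y1 - cRInt (fun t => f (x0, t)) y0 y1))%C.

Definition on_frame (x0 x1 y0 y1 : R) (z : C) : Prop :=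
  x0 <= Re z <= x1 /\ y0 <= Im z <= y1 /\
  (Re z = x0 \/ Re z = x1 \/ Im z = y0 \/ Im z = y1).

Lemma frame_paths (x0 x1 y0 y1 : R) (f : C -> C) :
  x0 <= x1 -> y0 <= y1 ->
  (forall z, on_frame x0 x1 y0 y1 z -> cdiffable f z) ->
  path_continuous (fun t => f (t, y0)) x0 x1 /\ path_continuous (fun t => f (t, y1)) x0 x1 /\
  path_continuous (fun t => f (x0, t)) y0 y1 /\ path_continuous (fun t => f (x1, t)) y0 y1.
Proof.
  intros Hx Hy H. split; [|split; [|split]].
  - apply path_continuous_h. intros t Ht. apply H. unfold on_frame; simpl; lra.
  - apply path_continuous_h. intros t Ht. apply H. unfold on_frame; simpl; lra.
  - apply path_continuous_v. intros t Ht. apply H. unfold on_frame; simpl; lra.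
  - apply path_continuous_v. intros t Ht. apply H. unfold on_frame; simpl; lra.
Qed.

Lemma rect_int_plus (x0 x1 y0 y1 : R) (f g : C -> C) :
  x0 <= x1 -> y0 <= y1 ->
  (forall z, on_frame x0 x1 y0 y1 z -> cdiffable f z) ->
  (forall z, on_frame x0 x1 y0 y1 z -> cdiffable g z) ->
  rect_int (fun z => (f z + g z)%C) x0 x1 y0 y1
  = (rect_int f x0 x1 y0 y1 + rect_int g x0 x1 y0 y1)%C.
Proof.
  intros Hx Hy Hf Hg. apply frame_paths in Hf, Hg; try assumption. unfold rect_int.
  rewrite !cRInt_plus by tauto. ring.
Qed.

Lemma rect_int_scal (x0 x1 y0 y1 : R) (c : C) (f : C -> C) :
  x0 <= x1 -> y0 <= y1 ->
  (forall z, on_frame x0 x1 y0 y1 z -> cdiffable f z) ->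
  rect_int (fun z => (c * f z)%C) x0 x1 y0 y1 = (c * rect_int f x0 x1 y0 y1)%C.
Proof.
  intros Hx Hy Hf. apply frame_paths in Hf; try assumption. unfold rect_int.
  rewrite !cRInt_scal by tauto. ring.
Qed.

Lemma rect_int_ext (x0 x1 y0 y1 : R) (f g : C -> C) :
  x0 <= x1 -> y0 <= y1 ->
  (forall z, on_frame x0 x1 y0 y1 z -> f z = g z) ->
  rect_int f x0 x1 y0 y1 = rect_int g x0 x1 y0 y1.
Proof.
  intros Hx Hy H. unfold rect_int.
  rewrite (cRInt_ext (fun t => f (t, y0)) (fun t => g (t, y0)) x0 x1),
    (cRInt_ext (fun t => f (t, y1)) (fun t => g (t, y1)) x0 x1),
    (cRInt_ext (fun t => f (x1, t)) (fun t => g (x1, t)) y0 y1),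
    (cRInt_ext (fun t => f (x0, t)) (fun t => g (x0, t)) y0 y1); try assumption; try reflexivity;
    intros; apply H; unfold on_frame; simpl; lra.
Qed.

Lemma Cmod_rect_int_le (x0 x1 y0 y1 : R) (f : C -> C) (M : R) :
  x0 <= x1 -> y0 <= y1 ->
  (forall z, on_frame x0 x1 y0 y1 z -> cdiffable f z) ->
  (forall z, on_frame x0 x1 y0 y1 z -> Cmod (f z) <= M) ->
  Cmod (rect_int f x0 x1 y0 y1) <= 4 * M * ((x1 - x0) + (y1 - y0)).
Proof.
  intros Hx Hy Hf HM. apply frame_paths in Hf; try assumption. destruct Hf as [P1 [P2 [P3 P4]]].
  unfold rect_int.
  assert (B1 := Cmod_cRInt_le _ _ _ M Hx P1). assert (B2 := Cmod_cRInt_le _ _ _ M Hx P2).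
  assert (B3 := Cmod_cRInt_le _ _ _ M Hy P3). assert (B4 := Cmod_cRInt_le _ _ _ M Hy P4).
  eapply Rle_trans; [apply Cmod_triangle|]. rewrite Cmod_mult, Cmod_Ci, Rmult_1_l.
  eapply Rle_trans; [apply Rplus_le_compat; apply Cmod_triangle_minus|].
  cut (Cmod (cRInt (fun t : R => f (t, y0)) x0 x1) <= 2 * M * (x1 - x0) /\
       Cmod (cRInt (fun t : R => f (t, y1)) x0 x1) <= 2 * M * (x1 - x0) /\
       Cmod (cRInt (fun t : R => f (x0, t)) y0 y1) <= 2 * M * (y1 - y0) /\
       Cmod (cRInt (fun t : R => f (x1, t)) y0 y1) <= 2 * M * (y1 - y0)); [intros; lra|].
  repeat split; [apply B1|apply B2|apply B3|apply B4]; intros; apply HM;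
    unfold on_frame; simpl; lra.
Qed.

Lemma frame_bounded (x0 x1 y0 y1 : R) (f : C -> C) :
  x0 <= x1 -> y0 <= y1 ->
  (forall z, on_frame x0 x1 y0 y1 z -> cdiffable f z) ->
  exists M, 0 <= M /\ forall z, on_frame x0 x1 y0 y1 z -> Cmod (f z) <= M.
Proof.
  intros Hx Hy Hf. apply frame_paths in Hf; try assumption. destruct Hf as [P1 [P2 [P3 P4]]].
  destruct (path_bounded _ _ _ P1) as [M1 H1]. destruct (path_bounded _ _ _ P2) as [M2 H2].
  destruct (path_bounded _ _ _ P3) as [M3 H3]. destruct (path_bounded _ _ _ P4) as [M4 H4].
  exists (Rmax 0 (Rmax (Rmax M1 M2) (Rmax M3 M4))). split; [apply Rmax_l|].
  generalize (Rmax_r 0 (Rmax (Rmax M1 M2) (Rmax M3 M4))) (Rmax_l (Rmax M1 M2) (Rmax M3 M4))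
    (Rmax_r (Rmax M1 M2) (Rmax M3 M4)) (Rmax_l M1 M2) (Rmax_r M1 M2) (Rmax_l M3 M4) (Rmax_r M3 M4).
  intros K1 K2 K3 K4 K5 K6 K7 [x y] [Zx [Zy Z]]. simpl in Zx, Zy, Z.
  destruct Z as [Z|[Z|[Z|Z]]]; subst.
  - specialize (H3 y Zy). simpl in H3. lra.
  - specialize (H4 y Zy). simpl in H4. lra.
  - specialize (H1 x Zx). simpl in H1. lra.
  - specialize (H2 x Zx). simpl in H2. lra.
Qed.

Lemma rect_int_split_v (x0 x1 y0 y1 : R) (f : C -> C) (x : R) :
  x0 <= x1 -> y0 <= y1 ->
  (forall z, on_frame x0 x1 y0 y1 z -> cdiffable f z) -> x0 <= x <= x1 ->
  rect_int f x0 x1 y0 y1 = (rect_int f x0 x y0 y1 + rect_int f x x1 y0 y1)%C.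
Proof.
  intros Hx Hy Hf Hxx. apply frame_paths in Hf; try assumption. destruct Hf as [P1 [P2 [P3 P4]]].
  unfold rect_int. rewrite <- (cRInt_Chasles _ x0 x x1 Hxx P1), <- (cRInt_Chasles _ x0 x x1 Hxx P2).
  ring.
Qed.

Lemma rect_int_split_h (x0 x1 y0 y1 : R) (f : C -> C) (y : R) :
  x0 <= x1 -> y0 <= y1 ->
  (forall z, on_frame x0 x1 y0 y1 z -> cdiffable f z) -> y0 <= y <= y1 ->
  rect_int f x0 x1 y0 y1 = (rect_int f x0 x1 y0 y + rect_int f x0 x1 y y1)%C.
Proof.
  intros Hx Hy Hf Hyy. apply frame_paths in Hf; try assumption. destruct Hf as [P1 [P2 [P3 P4]]].
  unfold rect_int. rewrite <- (cRInt_Chasles _ y0 y y1 Hyy P3), <- (cRInt_Chasles _ y0 y y1 Hyy P4).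
  ring.
Qed.

Lemma RInt_affine (u v a b : R) : RInt (fun t => u + v * t) a b = u * (b - a) + v * (b ^ 2 - a ^ 2) / 2.
Proof.
  apply is_RInt_unique.
  replace (u * (b - a) + v * (b ^ 2 - a ^ 2) / 2)
    with (minus (u * b + v * b ^ 2 / 2) (u * a + v * a ^ 2 / 2)).
  - apply (is_RInt_derive (V := R_CompleteNormedModule) (fun t => u * t + v * t ^ 2 / 2)).
    + intros t _. auto_derive; [easy|field].
    + intros t _. apply continuity_pt_filterlim. apply continuity_pt_plus.
      * apply continuity_pt_const. intros ? ?; reflexivity.
      * apply continuity_pt_mult; [apply continuity_pt_const; intros ? ?; reflexivity|].
        apply derivable_continuous_pt, derivable_pt_id.
  - unfold minus, plus, opp; simpl. field.
Qed.

(** The four sides are integrated explicitly. This is the closed form to which the subdivision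
    argument reduces, a differentiable function being affine up to o(|h|). *)
Lemma rect_int_affine (A B : C) (x0 x1 y0 y1 : R) :
  rect_int (fun z => (A + B * z)%C) x0 x1 y0 y1 = 0.
Proof.
  destruct A as [a1 a2], B as [b1 b2]. unfold rect_int, cRInt.
  assert (H : forall y, RInt (fun t => Re ((a1, a2) + (b1, b2) * (t, y))%C) x0 x1
     = (a1 - b2 * y) * (x1 - x0) + b1 * (x1 ^ 2 - x0 ^ 2) / 2).
  { intros y. rewrite <- RInt_affine. apply RInt_ext. intros t _. simpl. ring. }
  assert (H' : forall y, RInt (fun t => Im ((a1, a2) + (b1, b2) * (t, y))%C) x0 x1
     = (a2 + b1 * y) * (x1 - x0) + b2 * (x1 ^ 2 - x0 ^ 2) / 2).
  { intros y. rewrite <- RInt_affine. apply RInt_ext. intros t _. simpl. ring. }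
  assert (V : forall x, RInt (fun t => Re ((a1, a2) + (b1, b2) * (x, t))%C) y0 y1
     = (a1 + b1 * x) * (y1 - y0) + (- b2) * (y1 ^ 2 - y0 ^ 2) / 2).
  { intros x. rewrite <- RInt_affine. apply RInt_ext. intros t _. simpl. ring. }
  assert (V' : forall x, RInt (fun t => Im ((a1, a2) + (b1, b2) * (x, t))%C) y0 y1
     = (a2 + b2 * x) * (y1 - y0) + b1 * (y1 ^ 2 - y0 ^ 2) / 2).
  { intros x. rewrite <- RInt_affine. apply RInt_ext. intros t _. simpl. ring. }
  rewrite !H, !H', !V, !V'. apply C_ext; simpl; field.
Qed.

(** * Goursat's lemma and local uniqueness *)

(** Invariant and step relation depend on the stage n, so that a sequence of nested rectangles can
    be stored as corners alone, the side lengths W/2^n and H/2^n being read off from n. *)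
Lemma dependent_choice_nat {T : Type} (P : nat -> T -> Prop) (S' : nat -> T -> T -> Prop) (x0 : T) :
  P 0%nat x0 -> (forall n x, P n x -> exists y, P (S n) y /\ S' n x y) ->
  exists u : nat -> T, u 0%nat = x0 /\ forall n, P n (u n) /\ S' n (u n) (u (S n)).
Proof.
  intros H0 H.
  set (next := fun n (x : {x : T | P n x}) =>
    constructive_indefinite_description _ (H n (proj1_sig x) (proj2_sig x))).
  set (v := fix v n : {x : T | P n x} := match n with
    | O => exist _ x0 H0
    | S m => exist _ (proj1_sig (next m (v m))) (proj1 (proj2_sig (next m (v m)))) end).
  exists (fun n => proj1_sig (v n)). split; [reflexivity|]. intros n. split.
  - exact (proj2_sig (v n)).
  - exact (proj2 (proj2_sig (next n (v n)))).
Qed.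

(** The left ends increase and the right ends u n + w/2^n decrease, so the supremum of the left ends
    lies in every interval. *)
Lemma nested_halving (u : nat -> R) (w : R) :
  0 <= w -> (forall n, u n <= u (S n) <= u n + w / 2 ^ S n) ->
  exists l, forall n, u n <= l <= u n + w / 2 ^ n.
Proof.
  intros Hw H.
  assert (Hp : forall n, 0 < 2 ^ n) by (intros; apply pow_lt; lra).
  assert (Hup : forall n k, u (n + k)%nat + w / 2 ^ (n + k) <= u n + w / 2 ^ n).
  { intros n k. induction k; [rewrite Nat.add_0_r; lra|].
    rewrite Nat.add_succ_r. eapply Rle_trans; [|exact IHk].
    generalize (H (n + k)%nat). intros [_ H1]. eapply Rle_trans; [apply Rplus_le_compat_r, H1|].
    simpl. right. field. apply Rgt_not_eq, Hp. }
  assert (Hinc : forall n k, u n <= u (n + k)%nat).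
  { intros n k. induction k; [rewrite Nat.add_0_r; lra|].
    rewrite Nat.add_succ_r. generalize (H (n + k)%nat). lra. }
  assert (Hpos : forall n, 0 <= w / 2 ^ n).
  { intros n. apply Rmult_le_pos; [exact Hw|]. left. now apply Rinv_0_lt_compat. }
  assert (Hall : forall n k, u k <= u n + w / 2 ^ n).
  { intros n k. destruct (Nat.le_ge_cases n k) as [Hnk|Hnk].
    - replace k with (n + (k - n))%nat by lia. generalize (Hup n (k - n)%nat) (Hpos (n + (k - n))%nat). lra.
    - generalize (Hinc k (n - k)%nat) (Hpos n). replace (k + (n - k))%nat with n by lia. lra. }
  destruct (completeness (fun x => exists n, x = u n)) as [l [L1 L2]].
  - exists (u 0%nat + w / 2 ^ 0). intros x [n ->]. apply Hall.
  - exists (u 0%nat). now exists 0%nat.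
  - exists l. intros n. split.
    + apply L1. now exists n.
    + apply L2. intros x [k ->]. apply Hall.
Qed.

Definition in_rect (x0 x1 y0 y1 : R) (z : C) : Prop :=
  x0 <= Re z <= x1 /\ y0 <= Im z <= y1.

Lemma rect_int_quarters (f : C -> C) (x y w h : R) :
  0 <= w -> 0 <= h ->
  (forall z, in_rect x (x + w) y (y + h) z -> cdiffable f z) ->
  rect_int f x (x + w) y (y + h) =
  (rect_int f x (x + w / 2) y (y + h / 2)
   + rect_int f x (x + w / 2) (y + h / 2) (y + h / 2 + h / 2)
   + (rect_int f (x + w / 2) (x + w / 2 + w / 2) y (y + h / 2)
   + rect_int f (x + w / 2) (x + w / 2 + w / 2) (y + h / 2) (y + h / 2 + h / 2)))%C.
Proof.
  intros Hw Hh H.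
  replace (x + w / 2 + w / 2) with (x + w) by field.
  replace (y + h / 2 + h / 2) with (y + h) by field.
  rewrite (rect_int_split_v x (x + w) y (y + h) f (x + w / 2));
    [|lra|lra|unfold on_frame; intros; apply H; unfold in_rect; lra|lra].
  rewrite (rect_int_split_h x (x + w / 2) y (y + h) f (y + h / 2));
    [|lra|lra|unfold on_frame; intros; apply H; unfold in_rect; lra|lra].
  rewrite (rect_int_split_h (x + w / 2) (x + w) y (y + h) f (y + h / 2));
    [|lra|lra|unfold on_frame; intros; apply H; unfold in_rect; lra|lra].
  reflexivity.
Qed.

(** Subtracting the tangent of f at p leaves the integral unchanged. On the frame the difference is
    at most e|z - p| <= e(w + h), and the side lengths supply the second factor w + h. *)
Lemma rect_int_small (f : C -> C) (p d : C) (e r : R) :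
  0 < e -> (forall h, Cmod h < r -> Cmod (f (p + h)%C - f p - h * d) <= e * Cmod h) ->
  forall x y w h, 0 <= w -> 0 <= h -> w + h < r ->
  (forall z, in_rect x (x + w) y (y + h) z -> cdiffable f z) ->
  in_rect x (x + w) y (y + h) p ->
  Cmod (rect_int f x (x + w) y (y + h)) <= 4 * e * (w + h) ^ 2.
Proof.
  intros He Hd x y w h Hw Hh Hr Hf Hp.
  set (A := (f p - d * p)%C).
  set (g := fun z => (f z + (- A + - d * z))%C).
  assert (Hg : forall z, in_rect x (x + w) y (y + h) z -> cdiffable g z).
  { intros z Hz. apply cdiffable_plus; [now apply Hf|].
    apply cdiffable_plus; [apply cdiffable_const|].
    apply cdiffable_mult; [apply cdiffable_const|apply cdiffable_id]. }
  assert (Hsub : forall z, on_frame x (x + w) y (y + h) z -> in_rect x (x + w) y (y + h) z).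
  { unfold on_frame, in_rect. tauto. }
  assert (E : rect_int g x (x + w) y (y + h) = rect_int f x (x + w) y (y + h)).
  { unfold g. rewrite rect_int_plus; [|lra|lra|auto|].
    - rewrite rect_int_affine. ring.
    - intros z _. apply cdiffable_plus; [apply cdiffable_const|].
      apply cdiffable_mult; [apply cdiffable_const|apply cdiffable_id]. }
  rewrite <- E.
  eapply Rle_trans.
  - apply Cmod_rect_int_le with (M := e * (w + h)); [lra|lra| |].
    + auto.
    + intros z Hz. apply Hsub in Hz.
      assert (Hzp : Cmod (z - p) <= w + h).
      { eapply Rle_trans; [apply Cmod_le_Re_Im|].
        unfold Cminus. rewrite re_plus, im_plus, re_opp, im_opp.
        unfold in_rect in Hz, Hp. apply Rplus_le_compat; apply Rabs_le; lra. }
      unfold g, A. replace (f z) with (f (p + (z - p))%C) by (f_equal; ring).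
      replace (f (p + (z - p)) + (- (f p - d * p) + - d * z))%C
        with (f (p + (z - p)) - f p - (z - p) * d)%C by ring.
      eapply Rle_trans; [apply Hd; lra|]. apply Rmult_le_compat_l; lra.
  - right. ring.
Qed.

Theorem Goursat (f : C -> C) (x0 x1 y0 y1 : R) :
  x0 <= x1 -> y0 <= y1 ->
  (forall z, in_rect x0 x1 y0 y1 z -> cdiffable f z) -> rect_int f x0 x1 y0 y1 = 0.
Proof.
  intros Hx Hy Hf. set (W := x1 - x0). set (H := y1 - y0).
  replace x1 with (x0 + W) by (unfold W; ring). replace y1 with (y0 + H) by (unfold H; ring).
  destruct (Rle_dec (Cmod (rect_int f x0 (x0 + W) y0 (y0 + H))) 0) as [Hle|Hgt].
  { apply Cmod_eq_0. apply Rle_antisym; [exact Hle|apply Cmod_ge_0]. }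
  exfalso. apply Rnot_le_lt in Hgt.
  set (I0 := Cmod (rect_int f x0 (x0 + W) y0 (y0 + H))) in *.
  (* The [+ 1] makes the initial inequality c(W + H)^2 < I0 strict and covers degenerate
     rectangles. *)
  set (c := I0 / ((W + H) ^ 2 + 1)).
  assert (Hsq : 0 <= (W + H) ^ 2) by apply pow2_ge_0.
  assert (Hc : 0 < c) by (apply Rdiv_lt_0_compat; lra).
  assert (Hp : forall n, 0 < 2 ^ n) by (intros; apply pow_lt; lra).
  assert (HW : 0 <= W) by (unfold W; lra). assert (HH : 0 <= H) by (unfold H; lra).
  assert (HWn : forall n, 0 <= W / 2 ^ n).
  { intros n. apply Rmult_le_pos; [exact HW|]. left. now apply Rinv_0_lt_compat. }
  assert (HHn : forall n, 0 <= H / 2 ^ n).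
  { intros n. apply Rmult_le_pos; [exact HH|]. left. now apply Rinv_0_lt_compat. }
  destruct (dependent_choice_nat
    (fun n (p : R * R) => x0 <= fst p /\ fst p + W / 2 ^ n <= x1 /\ y0 <= snd p /\ snd p + H / 2 ^ n <= y1 /\
       c * (W / 2 ^ n + H / 2 ^ n) ^ 2
         < Cmod (rect_int f (fst p) (fst p + W / 2 ^ n) (snd p) (snd p + H / 2 ^ n)))
    (fun n (p r : R * R) => fst p <= fst r <= fst p + W / 2 ^ S n /\ snd p <= snd r <= snd p + H / 2 ^ S n)
    (x0, y0)) as [u [_ Hu]].
  - simpl. rewrite !Rdiv_1_r. fold I0. unfold W, H. repeat split; try lra.
    fold W H. unfold c. apply Rle_lt_trans with (I0 * ((W + H) ^ 2 / ((W + H) ^ 2 + 1))).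
    + right. field. lra.
    + rewrite <- (Rmult_1_r I0) at 2. apply Rmult_lt_compat_l; [exact Hgt|].
      apply Rmult_lt_reg_r with ((W + H) ^ 2 + 1); [lra|].
      unfold Rdiv. rewrite Rmult_assoc, Rinv_l; lra.
  - intros n [x y]. simpl fst; simpl snd. intros [A1 [A2 [A3 [A4 A5]]]].
    set (w := W / 2 ^ n) in *. set (h := H / 2 ^ n) in *.
    assert (Ew : W / 2 ^ S n = w / 2) by (unfold w; simpl; field; apply Rgt_not_eq, Hp).
    assert (Eh : H / 2 ^ S n = h / 2) by (unfold h; simpl; field; apply Rgt_not_eq, Hp).
    rewrite Ew, Eh.
    assert (Hw : 0 <= w) by apply HWn. assert (Hh : 0 <= h) by apply HHn.
    rewrite (rect_int_quarters f x y w h) in A5; [|exact Hw|exact Hh|].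
    2:{ intros z Hz. apply Hf. unfold in_rect in *. lra. }
    (* [Q] is the threshold for a quarter and one fourth of the current threshold: if no quarter
       exceeded it, the whole integral would be at most 4 Q. *)
    set (Q := c * (w / 2 + h / 2) ^ 2).
    assert (EQ : c * (w + h) ^ 2 = 4 * Q) by (unfold Q; field).
    rewrite EQ in A5.
    destruct (Rlt_dec Q (Cmod (rect_int f x (x + w / 2) y (y + h / 2)))) as [B|B].
    { exists (x, y). simpl. fold Q. repeat split; lra. }
    destruct (Rlt_dec Q (Cmod (rect_int f x (x + w / 2) (y + h / 2) (y + h / 2 + h / 2)))) as [B2|B2].
    { exists (x, y + h / 2). simpl. fold Q. repeat split; lra. }
    destruct (Rlt_dec Q (Cmod (rect_int f (x + w / 2) (x + w / 2 + w / 2) y (y + h / 2)))) as [B3|B3].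
    { exists (x + w / 2, y). simpl. fold Q. repeat split; lra. }
    destruct (Rlt_dec Q (Cmod (rect_int f (x + w / 2) (x + w / 2 + w / 2) (y + h / 2) (y + h / 2 + h / 2)))) as [B4|B4].
    { exists (x + w / 2, y + h / 2). simpl. fold Q. repeat split; lra. }
    exfalso. eapply Rlt_irrefl, Rlt_le_trans; [exact A5|].
    eapply Rle_trans; [apply Cmod_triangle|].
    eapply Rle_trans; [apply Rplus_le_compat; apply Cmod_triangle|]. lra.
  - destruct (nested_halving (fun n => fst (u n)) W HW) as [px Hpx]; [intros n; apply Hu|].
    destruct (nested_halving (fun n => snd (u n)) H HH) as [py Hpy]; [intros n; apply Hu|].
    set (p := (px, py) : C).
    destruct (Hf p) as [d Hd].
    { unfold in_rect, p. simpl. generalize (Hpx 0%nat) (Hpy 0%nat) (proj1 (Hu 0%nat)). simpl. lra. }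
    (* With e = c/8 the local estimate becomes (c/2)(w + h)^2, against the lower bound c(w + h)^2
       satisfied by every nested rectangle. *)
    destruct (Hd (c / 8) ltac:(lra)) as [r [Hr Hloc]].
    assert (Hn : exists n, W / 2 ^ n + H / 2 ^ n < r).
    { destruct (pow_lt_1_zero (1 / 2) ltac:(rewrite Rabs_pos_eq; lra) (r / (W + H + 1)))
        as [n Hn]; [apply Rdiv_lt_0_compat; lra|].
      exists n. specialize (Hn n (le_n _)). rewrite Rabs_pos_eq in Hn by (apply pow_le; lra).
      replace (W / 2 ^ n + H / 2 ^ n) with ((W + H) * (1 / 2) ^ n).
      - apply Rle_lt_trans with ((W + H + 1) * (1 / 2) ^ n).
        + apply Rmult_le_compat_r; [apply pow_le; lra|lra].
        + apply Rlt_le_trans with ((W + H + 1) * (r / (W + H + 1))).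
          * apply Rmult_lt_compat_l; lra.
          * right; field; lra.
      - unfold Rdiv. rewrite Rmult_1_l, pow_inv. ring. }
    destruct Hn as [n Hn]. destruct (Hu n) as [[A1 [A2 [A3 [A4 A5]]]] _].
    apply (Rlt_irrefl (c * (W / 2 ^ n + H / 2 ^ n) ^ 2)).
    eapply Rlt_le_trans; [exact A5|].
    eapply Rle_trans.
    { apply (rect_int_small f p d (c / 8) r); try assumption; try lra; try apply HWn; try apply HHn.
      - intros z Hz. apply Hf. unfold in_rect in *. lra.
      - unfold in_rect, p. simpl. split; [apply Hpx|apply Hpy]. }
    generalize (pow2_ge_0 (W / 2 ^ n + H / 2 ^ n)). nra.
Qed.

(** Cutting along the sides of the inner rectangle leaves four outer rectangles that avoid w, and
    each integrates to 0 by [Goursat]. *)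
Lemma rect_int_deform (f : C -> C) (w : C) (x0 x1 y0 y1 u0 u1 v0 v1 : R) :
  x0 <= u0 -> u0 < Re w < u1 -> u1 <= x1 -> y0 <= v0 -> v0 < Im w < v1 -> v1 <= y1 ->
  (forall z, in_rect x0 x1 y0 y1 z -> z <> w -> cdiffable f z) ->
  rect_int f x0 x1 y0 y1 = rect_int f u0 u1 v0 v1.
Proof.
  intros H1 H2 H3 H4 H5 H6 Hf.
  assert (Hne : forall z, Re z <> Re w \/ Im z <> Im w -> z <> w) by (intros z [H|H] E; congruence).
  rewrite (rect_int_split_v x0 x1 y0 y1 f u0); try lra.
  2:{ intros z Hz. unfold on_frame in Hz. apply Hf; [unfold in_rect; lra|apply Hne; lra]. }
  rewrite (rect_int_split_v u0 x1 y0 y1 f u1); try lra.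
  2:{ intros z Hz. unfold on_frame in Hz. apply Hf; [unfold in_rect; lra|apply Hne; lra]. }
  rewrite (Goursat f x0 u0 y0 y1), (Goursat f u1 x1 y0 y1); try lra;
    try (intros z Hz; unfold in_rect in Hz; apply Hf; [unfold in_rect; lra|apply Hne; lra]).
  rewrite (rect_int_split_h u0 u1 y0 y1 f v0); try lra.
  2:{ intros z Hz. unfold on_frame in Hz. apply Hf; [unfold in_rect; lra|apply Hne; lra]. }
  rewrite (rect_int_split_h u0 u1 v0 y1 f v1); try lra.
  2:{ intros z Hz. unfold on_frame in Hz. apply Hf; [unfold in_rect; lra|apply Hne; lra]. }
  rewrite (Goursat f u0 u1 y0 v0), (Goursat f u0 u1 v1 y1); try lra;
    try (intros z Hz; unfold in_rect in Hz; apply Hf; [unfold in_rect; lra|apply Hne; lra]).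
  ring.
Qed.

Lemma ex_RInt_bump (c e : R) :
  0 < e -> ex_RInt (fun t => e / ((t - c) ^ 2 + e ^ 2)) (c - e) (c + e).
Proof.
  intros He. apply (ex_RInt_continuous (V := R_CompleteNormedModule)). intros t _.
  apply (ex_derive_continuous (V := R_NormedModule)). auto_derive.
  assert (0 < e * e) by nra. generalize (pow2_ge_0 (t - c)). intros. simpl in *. lra.
Qed.

(** On this interval (t - c)^2 <= e^2, so the integrand is at least 1/(2e) over a length 2e. The
    exact value is pi/2; the cruder bound avoids evaluating the integral. *)
Lemma RInt_bump_ge (c e : R) :
  0 < e -> 1 <= RInt (fun t => e / ((t - c) ^ 2 + e ^ 2)) (c - e) (c + e).
Proof.
  intros He.
  assert (E : RInt (fun _ => 1 / (2 * e)) (c - e) (c + e) = 1).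
  { rewrite RInt_const. unfold scal; simpl. unfold mult; simpl. field. lra. }
  rewrite <- E at 1. apply RInt_le; [lra|apply ex_RInt_const|now apply ex_RInt_bump|].
  intros t Ht. unfold Rdiv. rewrite Rmult_1_l.
  assert (0 < (t - c) ^ 2 + e ^ 2) by nra.
  apply Rmult_le_reg_r with (2 * e * ((t - c) ^ 2 + e ^ 2)); [nra|].
  field_simplify; [|lra|lra]. nra.
Qed.

(** The integral is 2 pi i. Its imaginary part is a sum of four copies of the bump integral, one for
    each side, each at least 1. *)
Lemma rect_int_inv_ge (w : C) (e : R) :
  0 < e ->
  4 <= Cmod (rect_int (fun z => (/ (z + - w))%C) (Re w - e) (Re w + e) (Im w - e) (Im w + e)).
Proof.
  intros He. eapply Rle_trans; [|apply im_le_Cmod].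
  eapply Rle_trans; [|apply Rle_abs].
  assert (Hpos : forall t c, (t - c) ^ 2 + e ^ 2 <> 0).
  { intros t c. generalize (pow2_ge_0 (t - c)). nra. }
  assert (Hopp : forall c, RInt (fun t => - (e / ((t - c) ^ 2 + e ^ 2))) (c - e) (c + e)
     = - RInt (fun t => e / ((t - c) ^ 2 + e ^ 2)) (c - e) (c + e)).
  { intros c. apply (RInt_opp (V := R_CompleteNormedModule) (fun t => e / ((t - c) ^ 2 + e ^ 2))).
    now apply ex_RInt_bump. }
  assert (Him : forall f x0 x1 y0 y1, Im (rect_int f x0 x1 y0 y1) =
    RInt (fun t => Im (f (t, y0))) x0 x1 - RInt (fun t => Im (f (t, y1))) x0 x1
    + (RInt (fun t => Re (f (x1, t))) y0 y1 - RInt (fun t => Re (f (x0, t))) y0 y1)).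
  { intros. unfold rect_int, cRInt. simpl. ring. }
  rewrite Him. destruct w as [a b]. simpl (Re (a, b)). simpl (Im (a, b)).
  match goal with |- _ <= RInt ?p1 _ _ - RInt ?p2 _ _ + (RInt ?p3 _ _ - RInt ?p4 _ _) =>
    rewrite (RInt_ext p1 (fun t => e / ((t - a) ^ 2 + e ^ 2)) (a - e) (a + e)),
      (RInt_ext p2 (fun t => - (e / ((t - a) ^ 2 + e ^ 2))) (a - e) (a + e)),
      (RInt_ext p3 (fun t => e / ((t - b) ^ 2 + e ^ 2)) (b - e) (b + e)),
      (RInt_ext p4 (fun t => - (e / ((t - b) ^ 2 + e ^ 2))) (b - e) (b + e))
  end.
  - rewrite !Hopp. generalize (RInt_bump_ge a e He) (RInt_bump_ge b e He). lra.
  - intros t _. simpl. replace (a - e + - a) with (- e) by ring. rewrite <- Rdiv_opp_l.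
    apply (f_equal2 Rdiv); ring.
  - intros t _. simpl. replace (a + e + - a) with e by ring. apply (f_equal2 Rdiv); ring.
  - intros t _. simpl. replace (b + e + - b) with e by ring. rewrite <- Rdiv_opp_l.
    apply (f_equal2 Rdiv); ring.
  - intros t _. simpl. replace (b - e + - b) with (- e) by ring. apply (f_equal2 Rdiv); ring.
Qed.

Lemma frame_dist (w : C) (e : R) (z : C) :
  0 < e -> on_frame (Re w - e) (Re w + e) (Im w - e) (Im w + e) z ->
  e <= Cmod (z + - w) <= 2 * e.
Proof.
  intros He [Hx [Hy Hz]].
  assert (H1 := re_le_Cmod (z + - w)). assert (H2 := im_le_Cmod (z + - w)).
  assert (H3 := Cmod_le_Re_Im (z + - w)).
  rewrite re_plus, re_opp in H1, H3. rewrite im_plus, im_opp in H2, H3.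
  split.
  - destruct Hz as [Hz|[Hz|[Hz|Hz]]]; rewrite Hz in *.
    + eapply Rle_trans; [|exact H1]. replace (Re w - e + - Re w) with (- e) by ring.
      rewrite Rabs_Ropp, Rabs_pos_eq; lra.
    + eapply Rle_trans; [|exact H1]. replace (Re w + e + - Re w) with e by ring.
      rewrite Rabs_pos_eq; lra.
    + eapply Rle_trans; [|exact H2]. replace (Im w - e + - Im w) with (- e) by ring.
      rewrite Rabs_Ropp, Rabs_pos_eq; lra.
    + eapply Rle_trans; [|exact H2]. replace (Im w + e + - Im w) with e by ring.
      rewrite Rabs_pos_eq; lra.
  - assert (Rabs (Re z + - Re w) <= e) by (apply Rabs_le; lra).
    assert (Rabs (Im z + - Im w) <= e) by (apply Rabs_le; lra). lra.
Qed.

(* A weak Cauchy integral formula: deform the contour to a small square around [w]. *)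
Lemma Cauchy_lower_bound (g : C -> C) (w : C) (x0 x1 y0 y1 : R) :
  x0 < Re w < x1 -> y0 < Im w < y1 ->
  (forall z, in_rect x0 x1 y0 y1 z -> cdiffable g z) ->
  4 * Cmod (g w) <= Cmod (rect_int (fun z => (g z * / (z + - w))%C) x0 x1 y0 y1).
Proof.
  intros Hx Hy Hg. apply Rnot_lt_le. intros Hlt.
  set (L := Cmod (rect_int (fun z => (g z * / (z + - w))%C) x0 x1 y0 y1)) in *.
  (* On the small frame the part with g(z) - g(w) contributes at most 4 (eta/e)(4 e) = 16 eta, half
     of the assumed gap 4|g(w)| - L. *)
  set (eta := (4 * Cmod (g w) - L) / 32).
  assert (Heta : 0 < eta) by (unfold eta; lra).
  assert (Hgw : cdiffable g w) by (apply Hg; unfold in_rect; lra).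
  destruct (cdiffable_continuous g w Hgw eta Heta) as [r [Hr Hc]].
  set (m := Rmin (Rmin (Re w - x0) (x1 - Re w)) (Rmin (Im w - y0) (y1 - Im w))).
  assert (Hm : 0 < m) by (unfold m; repeat apply Rmin_pos; lra).
  (* [m] keeps the square inside the rectangle; r/4 puts its frame, at distance at most 2e from w,
     inside the disc where g is within eta of g(w). *)
  set (e := Rmin m (r / 4)).
  assert (He : 0 < e) by (apply Rmin_pos; lra).
  assert (Hem : e <= m) by apply Rmin_l. assert (Her : e <= r / 4) by apply Rmin_r.
  assert (Hm4 : m <= Re w - x0 /\ m <= x1 - Re w /\ m <= Im w - y0 /\ m <= y1 - Im w).
  { unfold m. repeat split.
    - eapply Rle_trans; [apply Rmin_l|apply Rmin_l].
    - eapply Rle_trans; [apply Rmin_l|apply Rmin_r].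
    - eapply Rle_trans; [apply Rmin_r|apply Rmin_l].
    - eapply Rle_trans; [apply Rmin_r|apply Rmin_r]. }
  assert (Hinv : forall z, z <> w -> cdiffable (fun z => (/ (z + - w))%C) z).
  { intros z Hz. apply cdiffable_inv_shift. intros E. apply Hz.
    replace z with ((z + - w) + w)%C by ring. rewrite E. ring. }
  assert (Hfr : forall z, on_frame (Re w - e) (Re w + e) (Im w - e) (Im w + e) z ->
     in_rect x0 x1 y0 y1 z /\ z <> w).
  { intros z Hz. split.
    - destruct Hz as [Z1 [Z2 _]]. unfold in_rect. lra.
    - intros ->. apply frame_dist in Hz; [|exact He].
      replace (w + - w)%C with (RtoC 0) in Hz by ring. rewrite Cmod_0 in Hz. lra. }
  assert (E : rect_int (fun z => (g z * / (z + - w))%C) x0 x1 y0 y1 =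
    (g w * rect_int (fun z => (/ (z + - w))%C) (Re w - e) (Re w + e) (Im w - e) (Im w + e)
     + rect_int (fun z => ((g z + - g w) * / (z + - w))%C) (Re w - e) (Re w + e) (Im w - e) (Im w + e))%C).
  { rewrite (rect_int_deform _ w x0 x1 y0 y1 (Re w - e) (Re w + e) (Im w - e) (Im w + e)); try lra.
    2:{ intros z Hz Hzw. apply cdiffable_mult; [now apply Hg|now apply Hinv]. }
    rewrite <- rect_int_scal by (try lra; intros z Hz; apply Hinv; now apply Hfr).
    rewrite <- rect_int_plus; try lra.
    - apply rect_int_ext; try lra. intros z Hz. ring.
    - intros z Hz. apply cdiffable_mult; [apply cdiffable_const|apply Hinv; now apply Hfr].
    - intros z Hz. apply cdiffable_mult; [|apply Hinv; now apply Hfr].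
      apply cdiffable_plus; [apply Hg; now apply Hfr|apply cdiffable_const]. }
  assert (B : Cmod (rect_int (fun z => ((g z + - g w) * / (z + - w))%C)
     (Re w - e) (Re w + e) (Im w - e) (Im w + e)) <= 16 * eta).
  { eapply Rle_trans.
    - apply Cmod_rect_int_le with (M := eta / e); try lra.
      + intros z Hz. apply cdiffable_mult; [|apply Hinv; now apply Hfr].
        apply cdiffable_plus; [apply Hg; now apply Hfr|apply cdiffable_const].
      + intros z Hz. generalize (frame_dist w e z He Hz). intros [D1 D2].
        rewrite Cmod_mult, Cmod_inv by (apply Cmod_gt_0; lra).
        apply Rmult_le_compat; [apply Cmod_ge_0|left; apply Rinv_0_lt_compat; lra| |].
        * replace z with (w + (z + - w))%C at 1 by ring.
          left. apply Hc. lra.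
        * apply Rinv_le_contravar; lra.
    - right. field. lra. }
  assert (A := rect_int_inv_ge w e He).
  fold L in E. unfold L in Hlt. rewrite E in Hlt.
  match type of Hlt with Cmod (?u + ?v) < _ => generalize (Cmod_triangle_rev u v) end.
  rewrite Cmod_mult.
  assert (4 * Cmod (g w) <= Cmod (g w) * Cmod (rect_int (fun z => (/ (z + - w))%C)
     (Re w - e) (Re w + e) (Im w - e) (Im w + e))).
  { generalize (Cmod_ge_0 (g w)). nra. }
  unfold eta in B. unfold L in B. rewrite E in B. lra.
Qed.

Lemma Rgeom_le_0 (a K t : R) : 0 <= t < 1 -> (forall n, a <= K * t ^ n) -> a <= 0.
Proof.
  intros Ht H. apply Rnot_lt_le. intros Ha.
  destruct (pow_lt_1_zero t ltac:(rewrite Rabs_pos_eq; lra) (a / (Rabs K + 1))) as [n Hn].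
  { generalize (Rabs_pos K). intros. apply Rdiv_lt_0_compat; lra. }
  specialize (Hn n (le_n _)). specialize (H n).
  assert (Hp : 0 <= t ^ n) by (apply pow_le; lra).
  rewrite Rabs_pos_eq in Hn by exact Hp.
  assert (HK := Rabs_pos K). assert (HK' := Rle_abs K).
  assert (K * t ^ n < a).
  { apply Rle_lt_trans with ((Rabs K + 1) * t ^ n).
    - apply Rmult_le_compat_r; lra.
    - apply Rlt_le_trans with ((Rabs K + 1) * (a / (Rabs K + 1))).
      + apply Rmult_lt_compat_l; lra.
      + right; field; lra. }
  lra.
Qed.

(* Applying the Cauchy estimate to [f(z) / (z - a)^n] and letting n grow. *)
Lemma local_uniqueness (f : C -> C) (a : C) (rho r : R) :
  0 < rho -> 0 < r ->
  (forall z, in_rect (Re a - rho) (Re a + rho) (Im a - rho) (Im a + rho) z -> cdiffable f z) ->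
  (forall h, Cmod h < r -> f (a + h)%C = 0) ->
  forall w, Cmod (w - a) < rho -> f w = 0.
Proof.
  intros Hrho Hr Hf H0 w Hw.
  destruct (Ceq_dec w a) as [->|Hwa].
  { specialize (H0 0). rewrite Cplus_0_r in H0. apply H0. now rewrite Cmod_0. }
  assert (Hwre := re_le_Cmod (w - a)). assert (Hwim := im_le_Cmod (w - a)).
  unfold Cminus in Hwre, Hwim. rewrite re_plus, re_opp in Hwre. rewrite im_plus, im_opp in Hwim.
  fold (w - a)%C in Hwre, Hwim.
  assert (Hre : Rabs (Re w + - Re a) < rho) by lra. assert (Him : Rabs (Im w + - Im a) < rho) by lra.
  apply Rabs_lt_between in Hre, Him.
  set (x0 := Re a - rho) in *. set (x1 := Re a + rho) in *.
  set (y0 := Im a - rho) in *. set (y1 := Im a + rho) in *.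
  assert (Hsub : forall z, on_frame x0 x1 y0 y1 z -> in_rect x0 x1 y0 y1 z).
  { unfold on_frame, in_rect. tauto. }
  assert (Hx01 : x0 < Re w < x1) by (unfold x0, x1; lra).
  assert (Hy01 : y0 < Im w < y1) by (unfold y0, y1; lra).
  destruct (frame_bounded x0 x1 y0 y1) with (f := f) as [M [HM0 HM]]; [lra|lra|auto|].
  set (dw := rho - Cmod (w - a)). assert (Hdw : 0 < dw) by (unfold dw; lra).
  assert (Hnz : forall z, z <> a -> (z + - a)%C <> 0).
  { intros z Hz E. apply Hz. replace z with ((z + - a) + a)%C by ring. rewrite E. ring. }
  set (v := Cmod (w - a)) in *.
  assert (Hv : 0 < v) by (apply Cmod_gt_0; now apply Hnz).
  cut (Cmod (f w) <= 0).
  { intros Hle. apply Cmod_eq_0, Rle_antisym; [exact Hle|apply Cmod_ge_0]. }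
  (* On the frame |z - a| >= rho, while v = |w - a| < rho; comparing the n-th powers yields |f(w)|
     <= (4 M rho/dw)(v/rho)^n for all n. *)
  apply (Rgeom_le_0 _ (4 * M / dw * rho) (v / rho)).
  { split.
    - apply Rmult_le_pos; [lra|left; now apply Rinv_0_lt_compat].
    - apply Rmult_lt_reg_r with rho; [exact Hrho|].
      unfold Rdiv. rewrite Rmult_assoc, Rinv_l; lra. }
  intros n. set (g := fun z => (f z * (/ (z + - a)) ^ n)%C).
  assert (Hg : forall z, in_rect x0 x1 y0 y1 z -> cdiffable g z).
  { intros z Hz. destruct (Ceq_dec z a) as [->|Hza].
    (* Near a the function f vanishes, so g is identically 0 there, whatever value the inverse of 0
       is given. *)
    - apply cdiffable_ext with (fun _ => RtoC 0) r; [exact Hr| |apply cdiffable_const].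
      intros h Hh. unfold g. rewrite H0 by exact Hh. ring.
    - apply cdiffable_mult; [now apply Hf|]. apply cdiffable_pow, cdiffable_inv_shift. now apply Hnz. }
  assert (L := Cauchy_lower_bound g w x0 x1 y0 y1 Hx01 Hy01 Hg).
  assert (Hfr : forall z, on_frame x0 x1 y0 y1 z -> rho <= Cmod (z + - a)).
  { intros z Hz. now apply (frame_dist a rho z Hrho). }
  assert (Hfw : forall z, on_frame x0 x1 y0 y1 z -> dw <= Cmod (z + - w)).
  { intros z Hz. specialize (Hfr z Hz).
    generalize (Cmod_triangle (z + - w) (w - a)).
    replace (z + - w + (w - a))%C with (z + - a)%C by ring. fold v. unfold dw. lra. }
  assert (U : Cmod (rect_int (fun z => (g z * / (z + - w))%C) x0 x1 y0 y1)
     <= 4 * (M * (/ rho) ^ n * / dw) * ((x1 - x0) + (y1 - y0))).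
  { apply Cmod_rect_int_le; [unfold x0, x1; lra|unfold y0, y1; lra| |].
    - intros z Hz. apply cdiffable_mult; [now apply Hg, Hsub|].
      apply cdiffable_inv_shift. specialize (Hfw z Hz). apply Cmod_gt_0. lra.
    - intros z Hz. specialize (Hfw z Hz). specialize (Hfr z Hz). unfold g.
      rewrite !Cmod_mult, Cmod_pow, !Cmod_inv by (apply Cmod_gt_0; lra).
      assert (/ Cmod (z + - a) <= / rho) by (apply Rinv_le_contravar; lra).
      assert (0 < / Cmod (z + - a)) by (apply Rinv_0_lt_compat; lra).
      apply Rmult_le_compat.
      + apply Rmult_le_pos; [apply Cmod_ge_0|apply pow_le; lra].
      + left; apply Rinv_0_lt_compat; lra.
      + apply Rmult_le_compat; [apply Cmod_ge_0|apply pow_le; lra|now apply HM|].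
        apply pow_incr. lra.
      + apply Rinv_le_contravar; lra. }
  replace ((x1 - x0) + (y1 - y0)) with (4 * rho) in U by (unfold x0, x1, y0, y1; ring).
  assert (Egw : Cmod (g w) = Cmod (f w) * / v ^ n).
  { unfold g. rewrite Cmod_mult, Cmod_pow, Cmod_inv by now apply Hnz.
    fold (w - a)%C. fold v. now rewrite pow_inv. }
  rewrite Egw in L.
  assert (Hvn : 0 < v ^ n) by now apply pow_lt.
  assert (Hrn : 0 < rho ^ n) by now apply pow_lt.
  replace (Cmod (f w)) with (Cmod (f w) * / v ^ n * v ^ n) by (field; lra).
  replace (4 * M / dw * rho * (v / rho) ^ n) with (4 * M / dw * rho * / rho ^ n * v ^ n)
    by (unfold Rdiv; rewrite Rpow_mult_distr, pow_inv; ring).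
  apply Rmult_le_compat_r; [lra|].
  rewrite pow_inv in U. unfold Rdiv. lra.
Qed.

(** * The identity principle off a discrete closed set *)

Lemma list_pos_min {T : Type} (g : T -> R) (l : list T) :
  exists d, 0 < d /\ forall p, In p l -> 0 < g p -> d <= g p.
Proof.
  induction l as [|x l [d [Hd H]]].
  - exists 1. split; [lra|]. intros p [].
  - destruct (Rlt_dec 0 (g x)) as [Hx|Hx].
    + exists (Rmin d (g x)). split; [now apply Rmin_pos|].
      intros p [<-|Hp] Hg; [apply Rmin_r|].
      eapply Rle_trans; [apply Rmin_l|now apply H].
    + exists d. split; [exact Hd|]. intros p [<-|Hp] Hg; [contradiction|now apply H].
Qed.

(** Each w has a neighbourhood containing no point of [Q] except possibly w. Finitely many of them
    cover the box, so every point of [Q] in the box is one of their centres. *)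
Lemma discrete_closed_box_finite (Q : C -> Prop) (B : R) :
  discrete_closed Q ->
  exists l : list C, forall p, Q p -> Rabs (Re p) <= B -> Rabs (Im p) <= B -> In p l.
Proof.
  intros HQ.
  set (eps := fun w => proj1_sig (constructive_indefinite_description _ (HQ w))).
  assert (Heps : forall w, 0 < eps w /\ forall p, Q p -> p <> w -> eps w <= Cmod (p - w)).
  { intros w. exact (proj2_sig (constructive_indefinite_description _ (HQ w))). }
  set (pt := fun t : Compactness.Tn 2 R => (fst t, fst (snd t)) : C).
  assert (Hpos : forall t, 0 < eps (pt t) / 2).
  { intros t. generalize (proj1 (Heps (pt t))). lra. }
  (* Compactness yields the finite list of centres under a double negation. The gauge is half of
     [eps] because the two coordinate distances are added in the end. *)
  destruct (NNPP _ (compactness_list 2 (- B, (- B, tt)) (B, (B, tt))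
    (fun t => mkposreal _ (Hpos t)))) as [l Hl].
  exists (map pt l). intros p Hp H1 H2. destruct p as [x y]. simpl in H1, H2.
  apply Rabs_le_between in H1, H2.
  destruct (Hl (x, (y, tt))) as [[tx [ty []]] [Ht [_ [Hc1 [Hc2 _]]]]].
  { simpl. tauto. }
  simpl in Hc1, Hc2. unfold pt in Hc1, Hc2. simpl in Hc1, Hc2.
  apply in_map_iff. exists (tx, (ty, tt)). split; [|exact Ht].
  unfold pt; simpl.
  destruct (Ceq_dec (x, y) (tx, ty)) as [E|E]; [now symmetry|exfalso].
  destruct (Heps (tx, ty)) as [E1 E2]. specialize (E2 _ Hp E).
  generalize (Cmod_le_Re_Im ((x, y) - (tx, ty))). simpl. unfold Rminus in Hc1, Hc2. lra.
Qed.

Lemma discrete_closed_union (P Q : C -> Prop) :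
  discrete_closed P -> discrete_closed Q -> discrete_closed (fun s => P s \/ Q s).
Proof.
  intros HP HQ w. destruct (HP w) as [e1 [H1 K1]]. destruct (HQ w) as [e2 [H2 K2]].
  exists (Rmin e1 e2). split; [now apply Rmin_pos|].
  intros p [Hp|Hp] Hne.
  - eapply Rle_trans; [apply Rmin_l|now apply K1].
  - eapply Rle_trans; [apply Rmin_r|now apply K2].
Qed.

(* Among the lines of slope y through [s0] all but finitely many avoid the finitely
   many points of [Q] in a large box. *)
Lemma clear_segment (Q : C -> Prop) (s0 : C) (T : R) :
  discrete_closed Q -> ~ Q s0 -> 0 <= T ->
  exists y rho, 0 <= y <= 1 /\ 0 < rho <= 1 /\
    forall t p, 0 <= t <= T -> Q p -> rho <= Cmod (s0 + t * (1, y) - p).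
Proof.
  intros HQ Hs0 HT.
  (* The segment stays within |s0| + T in each coordinate, since the slope is at most 1; points of
     [Q] outside the box are therefore at distance at least 1. *)
  set (B := Cmod s0 + T + 1).
  destruct (discrete_closed_box_finite Q B HQ) as [l Hl].
  (* [y2] bounds from below all positive slopes from s0 to listed points, so a smaller positive
     slope misses them. Where Re p = Re s0 the quotient carries no information, and that case is
     treated apart below. *)
  destruct (list_pos_min (fun p => (Im p - Im s0) / (Re p - Re s0)) l) as [y2 [Hy2 Hsl]].
  set (y := Rmin 1 (y2 / 2)).
  assert (Hy : 0 < y <= 1) by (split; [apply Rmin_pos; lra|apply Rmin_l]).
  assert (Hyy : y < y2) by (unfold y; generalize (Rmin_r 1 (y2 / 2)); lra).
  (* For h = s0 + t(1, y) - p the quantity y Re h - Im h does not depend on t, and its modulus is at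
     most 2|h| because y <= 1; hence the division by 2. *)
  set (g := fun p : C => Rabs ((Im p - Im s0) - y * (Re p - Re s0)) / 2).
  destruct (list_pos_min g l) as [d [Hd Hg]].
  exists y, (Rmin 1 d). split; [lra|]. split.
  { split; [apply Rmin_pos; lra|apply Rmin_l]. }
  intros t p Ht Hp.
  assert (H1 := re_le_Cmod (s0 + t * (1, y) - p)). assert (H2 := im_le_Cmod (s0 + t * (1, y) - p)).
  destruct (Rle_dec (Rabs (Re p)) B) as [HR|HR].
  2:{ eapply Rle_trans; [apply Rmin_l|]. eapply Rle_trans; [|exact H1].
      generalize (re_le_Cmod s0). unfold B in HR. simpl in *. intros H3.
      assert (Rabs (Re p) <= Rabs (fst s0 + (t * 1 - 0 * y) + - fst p) + (Rabs (Re s0) + T)).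
      { replace (Re p) with (- (fst s0 + (t * 1 - 0 * y) + - fst p) + (Re s0 + t)) by (unfold Re; ring).
        eapply Rle_trans; [apply Rabs_triang|]. rewrite Rabs_Ropp.
        apply Rplus_le_compat_l. eapply Rle_trans; [apply Rabs_triang|].
        rewrite (Rabs_pos_eq t); lra. }
      unfold Re in *. lra. }
  destruct (Rle_dec (Rabs (Im p)) B) as [HI|HI].
  2:{ eapply Rle_trans; [apply Rmin_l|]. eapply Rle_trans; [|exact H2].
      generalize (im_le_Cmod s0). unfold B in HI. simpl in *. intros H3.
      assert (Rabs (Im p) <= Rabs (snd s0 + (t * y + 0 * 1) + - snd p) + (Rabs (Im s0) + T)).
      { replace (Im p) with (- (snd s0 + (t * y + 0 * 1) + - snd p) + (Im s0 + t * y)) by (unfold Im; ring).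
        eapply Rle_trans; [apply Rabs_triang|]. rewrite Rabs_Ropp.
        apply Rplus_le_compat_l. eapply Rle_trans; [apply Rabs_triang|].
        rewrite (Rabs_pos_eq (t * y)) by nra. nra. }
      unfold Im in *. lra. }
  assert (Hin : In p l) by now apply Hl.
  eapply Rle_trans; [apply Rmin_r|].
  assert (Hgp : 0 < g p).
  { unfold g. apply Rmult_lt_0_compat; [|lra]. apply Rabs_pos_lt. intros E.
    destruct (Req_dec (Re p) (Re s0)) as [Er|Er].
    - apply Hs0. replace s0 with p; [exact Hp|]. apply C_ext; [exact Er|].
      rewrite Er in E. lra.
    - assert (Ey : (Im p - Im s0) / (Re p - Re s0) = y).
      { replace (Im p - Im s0) with (y * (Re p - Re s0)) by lra. field. lra. }
      specialize (Hsl p Hin). simpl in Hsl. rewrite Ey in Hsl. lra. }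
  eapply Rle_trans; [exact (Hg p Hin Hgp)|].
  unfold g.
  replace (Im p - Im s0 - y * (Re p - Re s0))
    with (y * Re (s0 + t * (1, y) - p) - Im (s0 + t * (1, y) - p)).
  2:{ simpl. unfold Re, Im. ring. }
  set (h := (s0 + t * (1, y) - p)%C) in *.
  assert (Rabs (y * Re h - Im h) <= Cmod h + Cmod h).
  { unfold Rminus. eapply Rle_trans; [apply Rabs_triang|]. rewrite Rabs_Ropp, Rabs_mult.
    rewrite (Rabs_pos_eq y) by lra. apply Rplus_le_compat; [|exact H2].
    eapply Rle_trans; [|exact H1]. generalize (Rabs_pos (Re h)). nra. }
  lra.
Qed.

Theorem identity_principle (Q : C -> Prop) (f : C -> C) :
  discrete_closed Q -> (forall s, ~ Q s -> cdiffable f s) ->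
  (forall s, 0 < Re s -> ~ Q s -> f s = 0) -> forall s, ~ Q s -> f s = 0.
Proof.
  intros HQ Hf H0 s0 Hs0.
  (* The far end of the segment then has real part at least 1, so a small disc around it lies in the
     half-plane where f is known to vanish. *)
  set (T := Rabs (Re s0) + 1).
  assert (HT : 1 <= T) by (unfold T; generalize (Rabs_pos (Re s0)); lra).
  destruct (clear_segment Q s0 T HQ Hs0 ltac:(lra)) as [y [rho [Hy [Hrho Hclear]]]].
  set (gam := fun t : R => (s0 + t * (1, y))%C) in *.
  (* The square of half-side r around a point of the segment lies within 2r = rho/2, hence off
     [Q]. *)
  set (r := rho / 4). assert (Hr : 0 < r) by (unfold r; lra).
  assert (Hdiff : forall t z, 0 <= t <= T -> Cmod (z - gam t) < rho -> ~ Q z).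
  { intros t z Ht Hz HQz. specialize (Hclear t z Ht HQz). rewrite Cmod_minus_sym in Hz.
    unfold gam in Hz. lra. }
  destruct (INR_archimed (r / 4) T) as [N HN]; [lra|].
  assert (HN0 : 0 < INR N) by nra.
  set (eta := T / INR N).
  assert (Heta : 0 < eta < r / 4).
  { split; [apply Rdiv_lt_0_compat; lra|].
    apply Rmult_lt_reg_r with (INR N); [exact HN0|]. unfold eta, Rdiv at 1.
    rewrite Rmult_assoc, Rinv_l; lra. }
  (* A chain of overlapping discs of radius r, run backwards from [gam T] to [gam 0], which is
     s0. *)
  assert (Hstep : forall k, (k <= N)%nat ->
    forall w, Cmod (w - gam (T - INR k * eta)) < r -> f w = 0).
  { induction k; intros Hk w Hw.
    - simpl in Hw. rewrite Rmult_0_l, Rminus_0_r in Hw. apply H0.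
      + generalize (re_le_Cmod (w - gam T)). unfold Cminus, gam.
        rewrite re_plus, re_opp, re_plus, re_scal_l. simpl (Re (1, y)). intros H.
        unfold gam, Cminus in Hw.
        assert (H1 : Rabs (Re w + - (Re s0 + T * 1)) < 1 / 4) by (unfold r in *; lra).
        apply Rabs_lt_between in H1. unfold T in *. generalize (Rle_abs (- Re s0)).
        rewrite Rabs_Ropp. lra.
      + apply (Hdiff T w); [lra|]. unfold r in *. lra.
    - assert (Hk' : (k <= N)%nat) by lia. specialize (IHk Hk').
      assert (HkN : INR (S k) <= INR N) by now apply le_INR.
      assert (Ht : 0 <= T - INR (S k) * eta <= T).
      { assert (INR (S k) * eta <= INR N * eta) by (apply Rmult_le_compat_r; lra).
        assert (INR N * eta = T) by (unfold eta; field; lra).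
        generalize (pos_INR (S k)). nra. }
      (* Consecutive centres are at distance at most 2 eta < r/2, so the disc of radius r/2 around
         the new centre lies inside the previous disc of radius r. *)
      apply (local_uniqueness f (gam (T - INR (S k) * eta)) r (r / 2)); try lra.
      + intros z Hz. apply Hf. apply (Hdiff _ z Ht).
        eapply Rle_lt_trans; [apply Cmod_le_Re_Im|].
        unfold Cminus. rewrite re_plus, im_plus, re_opp, im_opp.
        destruct Hz as [Z1 Z2].
        apply Rle_lt_trans with (r + r); [|unfold r; lra].
        apply Rplus_le_compat; apply Rabs_le; lra.
      + intros h Hh. apply IHk.
        replace (gam (T - INR (S k) * eta)%R + h - gam (T - INR k * eta)%R)%C with (h - eta * (1, y))%C.
        2:{ unfold gam. rewrite S_INR, !RtoC_minus, !RtoC_mult, RtoC_plus. ring. }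
        eapply Rle_lt_trans; [apply Cmod_triangle_minus|].
        rewrite Cmod_mult, Cmod_R, (Rabs_pos_eq eta) by lra.
        assert (Cmod (1, y) <= 2).
        { eapply Rle_trans; [apply Cmod_le_Re_Im|]. simpl. rewrite !Rabs_pos_eq; lra. }
        nra.
      }
  apply (Hstep N (le_n _)).
  replace (T - INR N * eta) with 0 by (unfold eta; field; lra).
  unfold gam. replace (s0 - (s0 + 0 * (1, y)))%C with (RtoC 0) by ring. rewrite Cmod_0. exact Hr.
Qed.

(** * The hypergeometric functions F(a,b,b+1) and the sum over l *)

Lemma Cmod_INR (n : nat) : Cmod (RtoC (INR n)) = INR n.
Proof. rewrite Cmod_R. apply Rabs_pos_eq, pos_INR. Qed.

(** The m-th term of the binomial series of (1 - x)^(-a); [rcoef] is its real majorant. *)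
Definition poch_coef (a x : C) (m : nat) : C := (poch a m * (/ INR (fact m) * x ^ m))%C.

Definition rcoef (A r : R) (m : nat) : R := rpoch A m / INR (fact m) * r ^ m.

(* [b * hsum a x b] is F(a,b,b+1:x), since b (b+1)_m = (b)_m (b+m). *)
Definition hsum (a x b : C) : C := CSeries (fun m => (poch_coef a x m * / (b + INR m))%C).

Lemma Cmod_fact_inv (x : C) (m : nat) :
  Cmod (/ INR (fact m) * x ^ m) = / INR (fact m) * Cmod x ^ m.
Proof.
  rewrite Cmod_mult, Cmod_pow, Cmod_inv, Cmod_INR; [reflexivity|].
  apply Cmod_gt_0. rewrite Cmod_INR. apply INR_fact_lt_0.
Qed.

Lemma rcoef_pos (A r : R) (m : nat) : 0 < A -> 0 <= r -> 0 <= rcoef A r m.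
Proof.
  intros HA Hr. apply Rmult_le_pos; [|now apply pow_le].
  left. apply Rdiv_lt_0_compat; [now apply rpoch_pos|apply INR_fact_lt_0].
Qed.

Lemma Cmod_poch_coef_le (a x : C) (A : R) (m : nat) :
  0 < A -> Cmod a <= A -> Cmod (poch_coef a x m) <= rcoef A (Cmod x) m.
Proof.
  intros HA Ha. unfold poch_coef, rcoef. rewrite Cmod_mult, Cmod_fact_inv.
  unfold Rdiv. rewrite Rmult_assoc. apply Rmult_le_compat_r; [|now apply Cmod_poch_le].
  apply Rmult_le_pos; [left; apply Rinv_0_lt_compat, INR_fact_lt_0|apply pow_le, Cmod_ge_0].
Qed.

Lemma ex_series_rcoef (A r : R) : 0 < A -> 0 <= r < 1 -> ex_series (rcoef A r).
Proof. exact (ex_series_rpoch A r). Qed.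

Lemma hsum_correct (a x b : C) (X : R) :
  Cmod x < 1 -> 0 < X -> (forall m, X <= Cmod (b + INR m)) ->
  Cser (fun m => (poch_coef a x m * / (b + INR m))%C) (hsum a x b).
Proof.
  intros Hx HX Hb. apply Cser_dominated with (fun m => rcoef (Cmod a + 1) (Cmod x) m * / X).
  - intros m. specialize (Hb m). assert (Ha := Cmod_ge_0 a).
    rewrite Cmod_mult, Cmod_inv by (apply Cmod_gt_0; lra).
    apply Rmult_le_compat; [apply Cmod_ge_0|left; apply Rinv_0_lt_compat; lra| |].
    + apply Cmod_poch_coef_le; lra.
    + apply Rinv_le_contravar; lra.
  - apply ex_series_scal_r, ex_series_rcoef; [generalize (Cmod_ge_0 a)|generalize (Cmod_ge_0 x)]; lra.
Qed.

Lemma poch_shift (b : C) (m : nat) : (poch b m * (b + INR m) = b * poch (b + 1) m)%C.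
Proof.
  induction m.
  - simpl. ring.
  - change (poch b (S m)) with (poch b m * (b + INR m))%C.
    change (poch (b + 1) (S m)) with (poch (b + 1) m * (b + 1 + INR m))%C.
    rewrite IHm, S_INR, RtoC_plus. ring.
Qed.

Lemma poch_neq_0 (b : C) (m : nat) : (forall j, (b + INR j)%C <> 0) -> poch b m <> 0.
Proof.
  intros H. induction m; simpl; [apply C1_nz|]. apply Cmult_neq_0; [exact IHm|apply H].
Qed.

Lemma Cpown_pow (x : C) (m : nat) : Cpown x m = (x ^ m)%C.
Proof. induction m; simpl; [reflexivity|]. rewrite IHm. ring. Qed.

Lemma INR_fact_C (m : nat) : RtoC (INR (fact m)) <> 0.
Proof. apply Cmod_gt_0. rewrite Cmod_INR. apply INR_fact_lt_0. Qed.

Lemma hyp2F1_hsum (a b x : C) (X : R) :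
  Cmod x < 1 -> 0 < X -> (forall m, X <= Cmod (b + INR m)) ->
  hyp2F1 a b (b + 1) x = (b * hsum a x b)%C.
Proof.
  intros Hx HX Hb. apply CSeries_unique.
  apply Cser_ext with (fun m => (b * (poch_coef a x m * / (b + INR m)))%C).
  - intros m. unfold hyp2F1_term, poch_coef, Cdiv. rewrite Cpown_pow.
    assert (Hn : forall j, (b + INR j)%C <> 0).
    { intros j. apply Cmod_gt_0. specialize (Hb j). lra. }
    assert (Hn1 : forall j, (b + 1 + INR j)%C <> 0).
    { intros j. specialize (Hn (S j)). rewrite S_INR, RtoC_plus in Hn.
      intros E. apply Hn. rewrite <- E. ring. }
    assert (E : poch b m = (b * poch (b + 1) m * / (b + INR m))%C).
    { rewrite <- poch_shift. field. apply Hn. }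
    rewrite E. field. repeat split; first [apply INR_fact_C | now apply poch_neq_0 | apply Hn].
  - apply Cser_scal. now apply hsum_correct with X.
Qed.

Lemma choice_nat {T : Type} (P : nat -> T -> Prop) :
  (forall n, exists y, P n y) -> exists f, forall n, P n (f n).
Proof.
  intros H. exists (fun n => proj1_sig (constructive_indefinite_description _ (H n))).
  intros n. exact (proj2_sig (constructive_indefinite_description _ (H n))).
Qed.

(** One statement for both uses: a = c = 0 for F(s,s,s+1), and a = 1, c = delta l for the terms of
    the sum over l. The bound decays like 1/X, which is where the second factor 1/|l| will come
    from. *)
Lemma maj_hsum (s a x c : C) (rho X : R) :
  0 < rho -> Cmod x < 1 -> 2 * rho <= X -> (forall m, X <= Cmod (s + (c + INR m))) ->
  exists d, maj s rho (fun t => hsum (t + a) x (t + c)) d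
    (Series (rcoef (Cmod (s + a) + rho) (Cmod x)) * (2 / X)).
Proof.
  intros Hr Hx HX Hc. assert (Ha := Cmod_ge_0 (s + a)).
  assert (Hterm : forall m, exists d,
    maj s rho (fun t => (poch_coef (t + a) x m * / (t + (c + INR m)))%C) d
      (rcoef (Cmod (s + a) + rho) (Cmod x) m * (2 / X))).
  { intros m. eexists. eapply maj_weaken.
    2:{ apply maj_mult; [exact Hr| |].
        - apply (maj_mult s rho (fun t => poch (t + a) m)); [exact Hr|now apply maj_poch|apply maj_const].
        - apply maj_inv; [exact Hr|]. specialize (Hc m). lra. }
    rewrite Cmod_fact_inv. specialize (Hc m).
    replace (rpoch (Cmod (s + a) + rho) m * (/ INR (fact m) * Cmod x ^ m))
      with (rcoef (Cmod (s + a) + rho) (Cmod x) m) by (unfold rcoef, Rdiv; ring).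
    apply Rmult_le_compat_l; [apply rcoef_pos; [lra|apply Cmod_ge_0]|].
    unfold Rdiv. apply Rmult_le_compat_l; [lra|]. apply Rinv_le_contravar; lra. }
  destruct (choice_nat _ Hterm) as [d Hd].
  exists (CSeries d). rewrite <- Series_scal_r.
  apply maj_ext with (fun t => CSeries (fun m => (poch_coef (t + a) x m * / (t + (c + INR m)))%C));
    [exact Hr| |].
  - intros h _. unfold hsum. apply CSeries_ext. intros m. now rewrite Cplus_assoc.
  - apply maj_series; [exact Hr|exact Hd|].
    apply ex_series_scal_r, ex_series_rcoef; [lra|]. generalize (Cmod_ge_0 x). lra.
Qed.

(** * Distances from a point to the exceptional set *)

Lemma frac_gap (x : R) : exists e, 0 < e /\ forall n : Z, x + IZR n <> 0 -> e <= Rabs (x + IZR n).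
Proof.
  destruct (archimed (- x)) as [A1 A2]. set (k := up (- x)) in *.
  set (t := IZR k + x). assert (Ht : 0 < t <= 1) by (unfold t; lra).
  (* The translates of x nearest to 0 are t and t - 1 with 0 < t <= 1. If t = 1, then t - 1 is the
     excluded value 0 and the next ones have modulus 1. *)
  exists (if Rlt_dec t 1 then Rmin t (1 - t) else 1). split.
  { destruct (Rlt_dec t 1); [apply Rmin_pos|]; lra. }
  intros n Hn.
  assert (Hle : (if Rlt_dec t 1 then Rmin t (1 - t) else 1) <= t /\
                (t < 1 -> (if Rlt_dec t 1 then Rmin t (1 - t) else 1) <= 1 - t) /\
                (if Rlt_dec t 1 then Rmin t (1 - t) else 1) <= 1).
  { destruct (Rlt_dec t 1) as [H|H].
    - generalize (Rmin_l t (1 - t)) (Rmin_r t (1 - t)). lra.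
    - lra. }
  destruct Hle as [L1 [L2 L3]].
  destruct (Z_le_gt_dec k n) as [H|H].
  - apply IZR_le in H. rewrite Rabs_pos_eq by (unfold t in *; lra). unfold t in *; lra.
  - destruct (Z.eq_dec n (k - 1)) as [->|Hne].
    + rewrite minus_IZR in *. destruct (Rlt_dec t 1) as [Ht1|Ht1].
      * rewrite Rabs_left by (unfold t in *; lra). specialize (L2 Ht1). unfold t in *. lra.
      * exfalso. apply Hn. unfold t in *. lra.
    + assert (H' : (n <= k - 2)%Z) by lia. apply IZR_le in H'. rewrite minus_IZR in H'.
      rewrite Rabs_left by (unfold t in *; lra). unfold t in *. lra.
Qed.

Lemma ln_q_neg (q : R) : 0 < q < 1 -> ln q < 0.
Proof. intros Hq. rewrite <- ln_1. apply ln_increasing; lra. Qed.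

Lemma qdelta_eq (q : R) : 0 < q < 1 -> qdelta q = (0, 2 * PI / ln q).
Proof.
  intros Hq. generalize (ln_q_neg q Hq). intros H. unfold qdelta, Cdiv.
  rewrite <- RtoC_inv by lra. apply C_ext; simpl; field; lra.
Qed.

(* The translate s + delta l + r; the exceptional points are those where one of them vanishes. *)
Definition qnode (q : R) (s : C) (l : Z) (r : nat) : C := (s + qdelta q * IZR l + INR r)%C.

Lemma Re_qnode (q : R) (s : C) (l : Z) (r : nat) : 0 < q < 1 -> Re (qnode q s l r) = Re s + INR r.
Proof. intros Hq. unfold qnode. rewrite qdelta_eq by exact Hq. simpl. unfold Re. ring. Qed.

Lemma Im_qnode (q : R) (s : C) (l : Z) (r : nat) :
  0 < q < 1 -> Im (qnode q s l r) = Im s + 2 * PI / ln q * IZR l.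
Proof. intros Hq. unfold qnode. rewrite qdelta_eq by exact Hq. simpl. unfold Im. ring. Qed.

Lemma exceptional_node (q : R) (s : C) :
  exceptional q s <-> exists r l, qnode q s l r = 0.
Proof.
  split.
  - intros [r [l ->]]. exists r, (- l)%Z. unfold qnode. rewrite opp_IZR, !RtoC_opp. ring.
  - intros [r [l H]]. exists r, (- l)%Z. rewrite opp_IZR, !RtoC_opp.
    apply Ceq_minus. rewrite <- H. unfold qnode. ring.
Qed.

Lemma exceptional_nz_node (q : R) (s : C) :
  exceptional_nz q s <-> exists r l, l <> 0%Z /\ qnode q s l r = 0.
Proof.
  split.
  - intros [r [l [Hl ->]]]. exists r, (- l)%Z. split; [lia|].
    unfold qnode. rewrite opp_IZR, !RtoC_opp. ring.
  - intros [r [l [Hl H]]]. exists r, (- l)%Z. split; [lia|]. rewrite opp_IZR, !RtoC_opp.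
    apply Ceq_minus. rewrite <- H. unfold qnode. ring.
Qed.

(** The real parts run through Re s plus integers and the imaginary parts through multiples of 2
    pi/log q shifted by Im s. A nonzero node has a nonzero coordinate, and [frac_gap] bounds that
    coordinate below. *)
Lemma qnode_gap (q : R) (s : C) : 0 < q < 1 ->
  exists e, 0 < e /\ forall l r, qnode q s l r <> 0 -> e <= Cmod (qnode q s l r).
Proof.
  intros Hq. assert (Hln := ln_q_neg q Hq). assert (Hpi := PI_RGT_0).
  set (D := 2 * PI / ln q).
  assert (HD : D < 0).
  { unfold D, Rdiv. generalize (Rinv_lt_0_compat (ln q) Hln). nra. }
  destruct (frac_gap (Re s)) as [e1 [He1 H1]]. destruct (frac_gap (Im s / D)) as [e2 [He2 H2]].
  exists (Rmin e1 (- D * e2)). split; [apply Rmin_pos; nra|].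
  intros l r Hne.
  destruct (Req_dec (Re (qnode q s l r)) 0) as [HR|HR].
  - assert (HI : Im (qnode q s l r) <> 0) by (intros HI; apply Hne; now apply C_ext).
    eapply Rle_trans; [apply Rmin_r|]. eapply Rle_trans; [|apply im_le_Cmod].
    rewrite Im_qnode in HI |- * by exact Hq. fold D in HI |- *.
    assert (E : Im s + D * IZR l = D * (Im s / D + IZR l)) by (field; lra).
    rewrite E in HI |- *. rewrite Rabs_mult, (Rabs_left D) by lra.
    apply Rmult_le_compat_l; [lra|]. apply H2. intros E0. apply HI. rewrite E0. ring.
  - eapply Rle_trans; [apply Rmin_l|]. eapply Rle_trans; [|apply re_le_Cmod].
    rewrite Re_qnode in HR |- * by exact Hq. rewrite INR_IZR_INZ in HR |- *. now apply H1.
Qed.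

(** Up to sign, the difference between an exceptional point and w is a node of w, so [qnode_gap]
    applies. *)
Lemma exceptional_discrete_closed (q : R) : 0 < q < 1 -> discrete_closed (exceptional q).
Proof.
  intros Hq w. destruct (qnode_gap q w Hq) as [e [He H]]. exists e. split; [exact He|].
  intros p [r [l ->]] Hne.
  replace (Cmod ((- INR r)%R + qdelta q * IZR l - w)) with (Cmod (qnode q w (- l) r)).
  - apply H. intros E. apply Hne. apply Ceq_minus. rewrite <- Copp_0, <- E.
    unfold qnode. rewrite opp_IZR, !RtoC_opp. ring.
  - rewrite <- Cmod_opp. f_equal. unfold qnode. rewrite opp_IZR, !RtoC_opp. ring.
Qed.

(** Imaginary parts give |D||l| <= |node| + |Im s|, and the uniform gap e turns |Im s| into (|Im
    s|/e)|node|. Hence kap = |D|/(1 + |Im s|/e), valid for small l as well as large. *)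
Lemma qnode_linear_gap (q : R) (s : C) : 0 < q < 1 -> ~ exceptional_nz q s ->
  exists kap, 0 < kap /\ forall l r, l <> 0%Z -> kap * Rabs (IZR l) <= Cmod (qnode q s l r).
Proof.
  intros Hq Hs. assert (Hln := ln_q_neg q Hq). assert (Hpi := PI_RGT_0).
  destruct (qnode_gap q s Hq) as [e [He H]].
  set (D := 2 * PI / ln q).
  assert (HD : D < 0).
  { unfold D, Rdiv. generalize (Rinv_lt_0_compat (ln q) Hln). nra. }
  set (k := 1 + Rabs (Im s) / e).
  assert (Hk : 0 < k).
  { unfold k. assert (0 <= Rabs (Im s) / e); [|lra].
    apply Rmult_le_pos; [apply Rabs_pos|left; now apply Rinv_0_lt_compat]. }
  exists (- D / k). split; [apply Rdiv_lt_0_compat; lra|].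
  intros l r Hl.
  assert (Hne : qnode q s l r <> 0).
  { intros E. apply Hs, exceptional_nz_node. now exists r, l. }
  specialize (H l r Hne). set (Y := Cmod (qnode q s l r)) in *.
  assert (H1 : - D * Rabs (IZR l) <= Y + Rabs (Im s)).
  { generalize (im_le_Cmod (qnode q s l r)). fold Y. rewrite Im_qnode by exact Hq. fold D.
    intros H1. replace (- D * Rabs (IZR l)) with (Rabs ((Im s + D * IZR l) + - Im s)).
    - eapply Rle_trans; [apply Rabs_triang|]. rewrite Rabs_Ropp. lra.
    - replace (Im s + D * IZR l + - Im s) with (D * IZR l) by ring.
      now rewrite Rabs_mult, (Rabs_left D) by lra. }
  assert (H2 : Rabs (Im s) <= Rabs (Im s) / e * Y).
  { replace (Rabs (Im s)) with (Rabs (Im s) / e * e) at 1 by (field; lra).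
    apply Rmult_le_compat_l; [|exact H].
    apply Rmult_le_pos; [apply Rabs_pos|left; now apply Rinv_0_lt_compat]. }
  apply Rmult_le_reg_r with k; [exact Hk|].
  replace (- D / k * Rabs (IZR l) * k) with (- D * Rabs (IZR l)) by (field; lra).
  unfold k. lra.
Qed.

(** * The sum over l and the right-hand side as functions of s *)

Lemma Cmod_qpow_lt_1 (q : R) (z : C) : 0 < q < 1 -> 0 < Re z -> Cmod (qpow q z) < 1.
Proof.
  intros Hq Hz. unfold qpow. rewrite Cmod_Cexp, re_scal_r, <- exp_0.
  apply exp_increasing. generalize (ln_q_neg q Hq). nra.
Qed.

(** Comparison with the telescoping series 2(1/(n+1) - 1/(n+2)). *)
Lemma ex_series_inv_sq : ex_series (fun n => / (INR (S n)) ^ 2).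
Proof.
  apply (ex_series_le (V := R_CompleteNormedModule) _
    (fun n => 2 * (/ INR (S n) - / INR (S (S n))))).
  - intros n. change (Rabs (/ INR (S n) ^ 2) <= 2 * (/ INR (S n) - / INR (S (S n)))).
    rewrite !S_INR. assert (H := pos_INR n).
    rewrite Rabs_pos_eq by (left; apply Rinv_0_lt_compat; nra).
    apply Rmult_le_reg_r with ((INR n + 1) ^ 2 * (INR n + 1 + 1)); [nra|].
    field_simplify; [|lra|lra]. nra.
  - apply ex_series_scal_l with (c := 2) (a := fun n => / INR (S n) - / INR (S (S n))).
    exists 1. change (is_lim_seq (sum_n (fun n => / INR (S n) - / INR (S (S n)))) 1).
    apply is_lim_seq_ext with (fun n => 1 - / INR (S (S n))).
    + intros n. induction n; [rewrite sum_O; simpl; field|].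
      rewrite sum_Sn, <- IHn.
      change (1 - / INR (S (S (S n))) = 1 - / INR (S (S n)) + (/ INR (S (S n)) - / INR (S (S (S n))))).
      ring.
    + evar_last; [apply is_lim_seq_minus'; [apply is_lim_seq_const|]|].
      * apply (is_lim_seq_incr_1 (fun n => / INR (S n))), (is_lim_seq_incr_1 (fun n => / INR n)).
        evar_last; [apply is_lim_seq_inv; [apply is_lim_seq_INR|easy]|reflexivity].
      * simpl. apply f_equal. ring.
Qed.

(** The factor s + delta l produced by [hyp2F1_hsum] cancels the one in the denominator of the
    term. *)
Lemma lterm_eq (q : R) (s z : C) (l : Z) (X : R) :
  0 < q < 1 -> 0 < Re z -> l <> 0%Z -> 0 < X -> (forall r, X <= Cmod (qnode q s l r)) ->
  lterm q s z l = (/ IZR l * hsum (s + 1) (qpow q z) (s + qdelta q * IZR l))%C.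
Proof.
  intros Hq Hz Hl HX Hn. unfold lterm.
  assert (Hx := Cmod_qpow_lt_1 q z Hq Hz).
  rewrite (hyp2F1_hsum _ _ _ X Hx HX Hn).
  assert (H0 : (s + qdelta q * IZR l)%C <> 0).
  { apply Cmod_gt_0. specialize (Hn 0%nat). unfold qnode in Hn. simpl in Hn.
    rewrite Cplus_0_r in Hn. lra. }
  assert (Hl' : RtoC (IZR l) <> 0).
  { intros E. apply RtoC_inj in E. now apply eq_IZR_R0 in E. }
  field. split; assumption.
Qed.

Lemma maj_lterm (q : R) (s z : C) : 0 < q < 1 -> 0 < Re z -> ~ exceptional_nz q s ->
  exists rho K, 0 < rho /\ 0 <= K /\
    forall l, l <> 0%Z -> exists d, maj s rho (fun t => lterm q t z l) d (K * / (IZR l) ^ 2).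
Proof.
  intros Hq Hz Hs. destruct (qnode_linear_gap q s Hq Hs) as [kap [Hk H]].
  assert (Hx := Cmod_qpow_lt_1 q z Hq Hz). set (x := qpow q z) in *.
  (* Since |l| >= 1, this gives 2 rho <= kap|l| and keeps the nodes of s + h at distance at least
     kap/2 from 0 for |h| <= rho. *)
  set (rho := kap / 4). assert (Hr : 0 < rho) by (unfold rho; lra).
  set (A := Series (rcoef (Cmod (s + 1) + rho) (Cmod x))).
  assert (HA : 0 <= A).
  { assert (Ha := Cmod_ge_0 (s + 1)). assert (Hx0 := Cmod_ge_0 x).
    assert (Hp : forall k, 0 <= rcoef (Cmod (s + 1) + rho) (Cmod x) k) by (intros; apply rcoef_pos; lra).
    eapply Rle_trans; [apply (Hp 0%nat)|]. rewrite <- (sum_O (rcoef (Cmod (s + 1) + rho) (Cmod x))).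
    apply sum_n_le_Series; [exact Hp|]. apply ex_series_rcoef; lra. }
  exists rho, (A * (2 / kap)). split; [exact Hr|]. split.
  { apply Rmult_le_pos; [exact HA|]. left. apply Rdiv_lt_0_compat; lra. }
  intros l Hl.
  assert (Hl1 : 1 <= Rabs (IZR l)).
  { rewrite <- abs_IZR. apply IZR_le. lia. }
  assert (Hl0 : IZR l <> 0) by (intros E; now apply eq_IZR_R0 in E).
  assert (HlC : RtoC (IZR l) <> 0) by (intros E; now apply RtoC_inj in E).
  destruct (maj_hsum s 1 x (qdelta q * IZR l) rho (kap * Rabs (IZR l)) Hr Hx) as [d Hd].
  - unfold rho. nra.
  - intros m. rewrite Cplus_assoc. now apply H.
  - eexists. eapply maj_weaken; [|eapply maj_ext; [exact Hr| |]].
    3:{ apply maj_mult; [exact Hr|apply (maj_const s rho (/ IZR l))|exact Hd]. }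
    + rewrite Cmod_inv, Cmod_R by exact HlC. fold A. right.
      rewrite <- (pow2_abs (IZR l)). field. lra.
    + intros h Hh. symmetry. apply lterm_eq with (kap / 2); try assumption; [lra|].
      intros r. replace (qnode q (s + h) l r) with (qnode q s l r + h)%C by (unfold qnode; ring).
      generalize (Cmod_triangle_rev (qnode q s l r) h) (H l r Hl). unfold rho in Hh. nra.
Qed.

Lemma Z_of_S_neq (n : nat) : Z.of_nat (S n) <> 0%Z /\ (- Z.of_nat (S n))%Z <> 0%Z.
Proof. lia. Qed.

Lemma IZR_S_sq (n : nat) : IZR (Z.of_nat (S n)) ^ 2 = INR (S n) ^ 2 /\ IZR (- Z.of_nat (S n)) ^ 2 = INR (S n) ^ 2.
Proof. rewrite opp_IZR, <- INR_IZR_INZ. split; ring. Qed.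

Lemma ex_series_Cmod_lterm (q : R) (s z : C) : 0 < q < 1 -> 0 < Re z -> ~ exceptional_nz q s ->
  ex_series (fun n : nat => Cmod (lterm q s z (Z.of_nat (S n))) + Cmod (lterm q s z (- Z.of_nat (S n)))).
Proof.
  intros Hq Hz Hs. destruct (maj_lterm q s z Hq Hz Hs) as [rho [K [Hr [HK H]]]].
  apply (ex_series_le (V := R_CompleteNormedModule) _ (fun n => 2 * K * / (INR (S n)) ^ 2)).
  - intros n. destruct (Z_of_S_neq n) as [N1 N2]. destruct (IZR_S_sq n) as [E1 E2].
    destruct (H _ N1) as [d1 H1]. destruct (H _ N2) as [d2 H2].
    apply maj_bound0 in H1; [|exact Hr]. apply maj_bound0 in H2; [|exact Hr].
    rewrite E1 in H1. rewrite E2 in H2.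
    match goal with |- norm ?a <= _ => change (Rabs a <= 2 * K * / (INR (S n)) ^ 2) end.
    rewrite Rabs_pos_eq; [lra|]. apply Rplus_le_le_0_compat; apply Cmod_ge_0.
  - apply ex_series_scal_l with (c := 2 * K) (a := fun n => / (INR (S n)) ^ 2). apply ex_series_inv_sq.
Qed.

Lemma lsum_cdiffable (q : R) (s z : C) : 0 < q < 1 -> 0 < Re z -> ~ exceptional_nz q s ->
  cdiffable (fun t => lsum q t z) s.
Proof.
  intros Hq Hz Hs. destruct (maj_lterm q s z Hq Hz Hs) as [rho [K [Hr [HK H]]]].
  assert (Hp : forall n, exists d, maj s rho (fun t => lpair q t z n) d (2 * K * / (INR (S n)) ^ 2)).
  { intros n. destruct (Z_of_S_neq n) as [N1 N2]. destruct (IZR_S_sq n) as [E1 E2].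
    destruct (H _ N1) as [d1 H1]. destruct (H _ N2) as [d2 H2].
    rewrite E1 in H1. rewrite E2 in H2.
    exists (d1 + d2)%C. replace (2 * K * / INR (S n) ^ 2) with (K * / INR (S n) ^ 2 + K * / INR (S n) ^ 2) by ring.
    now apply maj_plus. }
  destruct (choice_nat _ Hp) as [d Hd].
  exists (CSeries d). eapply maj_cdiff; [exact Hr|].
  apply (maj_series s rho (fun n t => lpair q t z n) d _ Hr Hd).
  apply ex_series_scal_l with (c := 2 * K) (a := fun n => / (INR (S n)) ^ 2). apply ex_series_inv_sq.
Qed.

(** F(s,s,s+1) = s [hsum] cancels the factor 1/s. What remains is built from exponentials, [hsum]
    and [lsum], to which the differentiability lemmas apply directly. *)
Lemma qzeta_rhs_eq (q : R) (s z : C) : 0 < q < 1 -> 0 < Re z -> ~ exceptional q s ->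
  qzeta_rhs q s z =
    (- (/ ln q) * (Cexp (s * Clog (q - q ^ 2)%R) * hsum s (qpow q z) s)
     + (1 / 2)%R * Cexp (s * Clog ((q - q ^ 2)%R / (1 - qpow q z)))
     + / (0%R, (2 * PI)%R) * (s * Cexp (s * Clog (q - q ^ 2)%R)) * lsum q s z)%C.
Proof.
  intros Hq Hz Hs. destruct (qnode_gap q s Hq) as [e [He H]].
  assert (H0 : forall m, (s + INR m)%C = qnode q s 0 m) by (intros; unfold qnode; ring).
  assert (Hne : forall m, (s + INR m)%C <> 0).
  { intros m E. apply Hs, exceptional_node. exists m, 0%Z. now rewrite <- H0. }
  unfold qzeta_rhs. rewrite (hyp2F1_hsum s s (qpow q z) e).
  - unfold Defs.Cpow.
    set (c := Cexp (s * Clog (q - q ^ 2)%R)). set (w := Cexp (s * Clog (Cdiv _ _))).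
    assert (Hs0 : s <> 0).
    { intros E. apply (Hne 0%nat). rewrite E. simpl. ring. }
    assert (Hln : RtoC (ln q) <> 0).
    { intros E. apply RtoC_inj in E. generalize (ln_q_neg q Hq). lra. }
    assert (Hpi : ((0%R, (2 * PI)%R) : C) <> 0).
    { intros E. apply (f_equal Im) in E. simpl in E. generalize PI_RGT_0. lra. }
    field. repeat split; try assumption.
  - now apply Cmod_qpow_lt_1.
  - exact He.
  - intros m. rewrite H0. apply H. rewrite <- H0. apply Hne.
Qed.

Lemma qzeta_rhs_cdiffable (q : R) (s z : C) : 0 < q < 1 -> 0 < Re z -> ~ exceptional q s ->
  cdiffable (fun t => qzeta_rhs q t z) s.
Proof.
  intros Hq Hz Hs.
  destruct (exceptional_discrete_closed q Hq s) as [e [He H]].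
  (* [qzeta_rhs_eq] holds only off the exceptional set, so carrying a derivative across it takes a
     whole disc avoiding that set. *)
  assert (Hnear : forall h, Cmod h < e -> ~ exceptional q (s + h)%C).
  { intros h Hh Hx. apply (Rlt_irrefl e). eapply Rle_lt_trans; [|exact Hh].
    replace h with (s + h - s)%C at 1 by ring. apply H; [exact Hx|].
    intros E. apply Hs. now rewrite <- E. }
  apply cdiffable_ext with (r := e) (f := fun t =>
    (- (/ ln q) * (Cexp (t * Clog (q - q ^ 2)%R) * hsum t (qpow q z) t)
     + (1 / 2)%R * Cexp (t * Clog ((q - q ^ 2)%R / (1 - qpow q z)))
     + / (0%R, (2 * PI)%R) * (t * Cexp (t * Clog (q - q ^ 2)%R)) * lsum q t z)%C);
    [exact He|intros h Hh; symmetry; now apply qzeta_rhs_eq, Hnear|].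
  assert (Hexp : forall c, cdiffable (fun t => Cexp (t * c)) s) by (intros c; eexists; apply cdiff_Cexp).
  assert (Hnz : ~ exceptional_nz q s).
  { intros [r [l [_ E]]]. apply Hs. now exists r, l. }
  apply cdiffable_plus; [apply cdiffable_plus|].
  - apply cdiffable_mult; [apply cdiffable_const|]. apply cdiffable_mult; [apply Hexp|].
    destruct (qnode_gap q s Hq) as [e1 [He1 H1]].
    destruct (maj_hsum s 0 (qpow q z) 0 (e1 / 2) e1) as [d Hd].
    + lra.
    + now apply Cmod_qpow_lt_1.
    + lra.
    + intros m. replace (s + (0 + INR m))%C with (qnode q s 0 m) by (unfold qnode; ring).
      apply H1. intros E. apply Hs, exceptional_node. now exists m, 0%Z.
    + exists d. apply cdiff_ext with (fun t => hsum (t + 0) (qpow q z) (t + 0)) 1; [lra| |].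
      * intros h _. now rewrite !Cplus_0_r.
      * eapply maj_cdiff; [|exact Hd]. lra.
  - apply cdiffable_mult; [apply cdiffable_const|apply Hexp].
  - apply cdiffable_mult; [|now apply lsum_cdiffable].
    apply cdiffable_mult; [apply cdiffable_const|].
    apply cdiffable_mult; [apply cdiffable_id|apply Hexp].
Qed.

(** * The binomial series *)

(** The coefficientwise form of the differential equation y' = w(s y + t y') for y(t) = (1 - t
    w)^(-s). *)
Lemma poch_coef_S (s w : C) (m : nat) :
  (INR (S m) * poch_coef s w (S m) = w * ((s + INR m) * poch_coef s w m))%C.
Proof.
  unfold poch_coef. rewrite fact_simpl, mult_INR, RtoC_mult.
  change (poch s (S m)) with (poch s m * (s + INR m))%C.
  rewrite Cpow_S. field. split; [apply INR_fact_C|].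
  apply Cmod_gt_0. rewrite Cmod_INR. apply lt_0_INR. lia.
Qed.

Lemma Clog_pos (z : C) : 0 < Re z -> Clog z = (ln (Cmod z), atan (Im z / Re z)).
Proof. intros H. unfold Clog, Carg. destruct (Rlt_dec 0 (Re z)); [reflexivity|contradiction]. Qed.

(** With w = u + iv, this and [is_derive_atan_quot] are the real and imaginary parts of the
    derivative of log(1 - t w), namely -w/(1 - t w) = -w(1 - t conj(w))/|1 - t w|^2. *)
Lemma is_derive_ln_norm (u v t : R) : 0 < 1 - t * u ->
  is_derive (fun t => ln (sqrt ((1 - t * u) ^ 2 + (t * v) ^ 2))) t
    (- (u - t * (u ^ 2 + v ^ 2)) / ((1 - t * u) ^ 2 + (t * v) ^ 2)).
Proof.
  intros H. assert (HN : 0 < (1 - t * u) ^ 2 + (t * v) ^ 2) by nra.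
  assert (Hs := sqrt_lt_R0 _ HN). auto_derive.
  - simpl in *. repeat split; assumption.
  - replace ((1 + - (t * u)) * ((1 + - (t * u)) * 1) + t * v * (t * v * 1))
      with ((1 - t * u) ^ 2 + (t * v) ^ 2) by ring.
    set (N := (1 - t * u) ^ 2 + (t * v) ^ 2) in *.
    replace N with (sqrt N * sqrt N) at 3 by (apply sqrt_sqrt; lra).
    field. lra.
Qed.

Lemma is_derive_atan_quot (u v t : R) : 0 < 1 - t * u ->
  is_derive (fun t => atan (- (t * v) / (1 - t * u))) t
    (- v / ((1 - t * u) ^ 2 + (t * v) ^ 2)).
Proof.
  intros H. assert (HN : 0 < (1 - t * u) ^ 2 + (t * v) ^ 2) by nra.
  auto_derive; [lra|]. field. split; [nra|lra].
Qed.

Lemma term_le_Series (b : nat -> R) (n : nat) :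
  (forall k, 0 <= b k) -> ex_series b -> b n <= Series b.
Proof.
  intros H Hb. apply Rle_trans with (sum_n b n); [|now apply sum_n_le_Series].
  assert (Hs : forall k, 0 <= sum_n b k).
  { induction k; [rewrite sum_O; apply H|].
    rewrite sum_Sn. apply Rplus_le_le_0_compat; [exact IHk|apply H]. }
  destruct n; [rewrite sum_O; apply Rle_refl|].
  rewrite sum_Sn. change (b (S n) <= sum_n b n + b (S n)). generalize (Hs n). lra.
Qed.

(** [p] stands for Re or Im: the complex series is handled as two real power series in t along the
    ray t w. *)
Lemma binomial_coef_disk (s w : C) (r : R) (p : C -> R) :
  (forall c, Rabs (p c) <= Cmod c) -> 0 <= r -> r * Cmod w < 1 ->
  Rbar_le r (CV_radius (fun m => p (poch_coef s w m))).
Proof.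
  intros Hp Hr Hw. assert (Hs := Cmod_ge_0 s). assert (Hw0 := Cmod_ge_0 w).
  apply CV_radius_bounded. exists (Series (rcoef (Cmod s + 1) (r * Cmod w))). intros m.
  apply Rle_trans with (rcoef (Cmod s + 1) (r * Cmod w) m).
  - rewrite Rabs_mult, (Rabs_pos_eq (r ^ m)) by now apply pow_le.
    unfold rcoef. rewrite Rpow_mult_distr.
    replace (rpoch (Cmod s + 1) m / INR (fact m) * (r ^ m * Cmod w ^ m))
      with (rcoef (Cmod s + 1) (Cmod w) m * r ^ m) by (unfold rcoef; ring).
    apply Rmult_le_compat_r; [now apply pow_le|].
    eapply Rle_trans; [apply Hp|]. apply Cmod_poch_coef_le; lra.
  - apply term_le_Series.
    + intros k. apply rcoef_pos; [lra|nra].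
    + apply ex_series_rcoef; [lra|]. split; [nra|exact Hw].
Qed.

Lemma Cser_shift (a : nat -> C) (t l : C) :
  Cser (fun m => (INR (S m) * a (S m) * t ^ m)%C) l ->
  Cser (fun m => (INR m * a m * t ^ m)%C) (t * l)%C.
Proof.
  intros H. apply (is_series_decr_1 (V := C_NormedModule)).
  apply (Cser_scal t) in H.
  match goal with |- is_series _ ?x => replace x with (t * l)%C end.
  - eapply Cser_ext; [|exact H]. intros m. cbv beta. rewrite Cpow_S. ring.
  - change (t * l = t * l + - (INR 0 * a 0%nat * t ^ 0))%C. simpl. ring.
Qed.

Lemma Cser_of_PSeries (a : nat -> C) (t : R) :
  Rbar_lt (Rabs t) (CV_radius (fun m => Re (a m))) ->
  Rbar_lt (Rabs t) (CV_radius (fun m => Im (a m))) ->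
  Cser (fun m => (a m * t ^ m)%C) (PSeries (fun m => Re (a m)) t, PSeries (fun m => Im (a m)) t).
Proof.
  intros H1 H2. apply Cser_iff. simpl.
  apply CV_radius_inside in H1, H2. apply PSeries_correct in H1, H2.
  apply (is_pseries_R (fun m => Re (a m))) in H1.
  apply (is_pseries_R (fun m => Im (a m))) in H2.
  split; (eapply is_series_ext; [|eassumption]); intros m; simpl; rewrite <- RtoC_pow; simpl; unfold Re, Im; simpl; ring.
Qed.

(* Along the ray [t w], the series and the exponential satisfy the same linear
   differential equation [(1 - t w) y' = s w y]. *)
Lemma binomial_series (s w : C) : Cmod w < 1 -> Cser (poch_coef s w) (Cexp (- (s * Clog (1 - w)))).
Proof.
  intros Hw. assert (Hw0 := Cmod_ge_0 w).
  (* A radius r > 1 with r|w| < 1, so that t = 1 is interior to the disc of convergence. *)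
  set (r := 2 / (1 + Cmod w)).
  assert (Hr1 : 1 < r).
  { unfold r. apply Rmult_lt_reg_r with (1 + Cmod w); [lra|].
    unfold Rdiv. rewrite Rmult_assoc, Rinv_l; lra. }
  assert (Hrw : r * Cmod w < 1).
  { unfold r. apply Rmult_lt_reg_r with (1 + Cmod w); [lra|].
    replace (2 / (1 + Cmod w) * Cmod w * (1 + Cmod w)) with (2 * Cmod w) by (field; lra). lra. }
  set (a := poch_coef s w).
  assert (R1 : forall t, 0 <= t <= 1 -> Rbar_lt (Rabs t) (CV_radius (fun m => Re (a m)))).
  { intros t Ht. apply Rbar_lt_le_trans with r; [simpl; rewrite Rabs_pos_eq; lra|].
    apply (binomial_coef_disk s w r Re re_le_Cmod); lra. }
  assert (R2 : forall t, 0 <= t <= 1 -> Rbar_lt (Rabs t) (CV_radius (fun m => Im (a m)))).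
  { intros t Ht. apply Rbar_lt_le_trans with r; [simpl; rewrite Rabs_pos_eq; lra|].
    apply (binomial_coef_disk s w r Im im_le_Cmod); lra. }
  set (A := PSeries (fun m => Re (a m))). set (B := PSeries (fun m => Im (a m))).
  set (A' := PSeries (PS_derive (fun m => Re (a m)))). set (B' := PSeries (PS_derive (fun m => Im (a m)))).
  assert (DA : forall t, 0 <= t <= 1 -> is_derive A t (A' t)) by (intros; now apply is_derive_PSeries, R1).
  assert (DB : forall t, 0 <= t <= 1 -> is_derive B t (B' t)) by (intros; now apply is_derive_PSeries, R2).
  assert (ODE : forall t, 0 <= t <= 1 ->
     ((A' t, B' t) = w * (s * (A t, B t) + t * (A' t, B' t)))%C).
  { intros t Ht.
    assert (S0 : Cser (fun m => (a m * t ^ m)%C) (A t, B t)) by (apply Cser_of_PSeries; auto).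
    assert (S1 : Cser (fun m => (INR (S m) * a (S m) * t ^ m)%C) (A' t, B' t)).
    { assert (Hre : forall m, PS_derive (fun m => Re (a m)) m = Re (INR (S m) * a (S m))%C).
      { intros m. unfold PS_derive. now rewrite re_scal_l. }
      assert (Him : forall m, PS_derive (fun m => Im (a m)) m = Im (INR (S m) * a (S m))%C).
      { intros m. unfold PS_derive. now rewrite im_scal_l. }
      unfold A', B'. rewrite (PSeries_ext _ _ t Hre), (PSeries_ext _ _ t Him).
      apply (Cser_of_PSeries (fun m => INR (S m) * a (S m))%C).
      - rewrite <- (CV_radius_ext _ _ Hre), CV_radius_derive. now apply R1.
      - rewrite <- (CV_radius_ext _ _ Him), CV_radius_derive. now apply R2. }
    apply (Cser_unique _ _ _ S1).
    eapply Cser_ext; [|apply Cser_scal, Cser_plus; [apply (Cser_scal s), S0|apply (Cser_shift a), S1]].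
    intros m. cbv beta. unfold a. rewrite poch_coef_S. ring. }
  destruct w as [u v]. set (w := (u, v) : C) in *.
  assert (Hu : Rabs u < 1) by (eapply Rle_lt_trans; [apply (re_le_Cmod w)|exact Hw]).
  apply Rabs_lt_between in Hu.
  (* X + iY is s log(1 - t w), written with real functions whose derivatives are known. *)
  set (X := fun t => Re s * ln (sqrt ((1 - t * u) ^ 2 + (t * v) ^ 2)) - Im s * atan (- (t * v) / (1 - t * u))).
  set (Y := fun t => Re s * atan (- (t * v) / (1 - t * u)) + Im s * ln (sqrt ((1 - t * u) ^ 2 + (t * v) ^ 2))).
  assert (EXY : forall t, 0 <= t <= 1 -> (s * Clog (1 - t * w) = (X t, Y t))%C).
  { intros t Ht. rewrite Clog_pos by (simpl; nra).
    unfold X, Y, Cmod. apply C_ext; simpl;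
    replace ((1 + - (t * u - 0 * v)) * ((1 + - (t * u - 0 * v)) * 1) + (0 + - (t * v + 0 * u)) * ((0 + - (t * v + 0 * u)) * 1))
      with ((1 - t * u) * ((1 - t * u) * 1) + t * v * (t * v * 1)) by ring;
    replace (0 + - (t * v + 0 * u)) with (- (t * v)) by ring;
    replace (1 + - (t * u - 0 * v)) with (1 - t * u) by ring; reflexivity. }
  set (Nf := fun t => (1 - t * u) ^ 2 + (t * v) ^ 2).
  assert (Hpos : forall t, 0 <= t <= 1 -> 0 < 1 - t * u) by (intros; nra).
  assert (HN : forall t, 0 <= t <= 1 -> 0 < Nf t).
  { intros t Ht. specialize (Hpos t Ht). unfold Nf. generalize (pow2_ge_0 (t * v)). nra. }
  set (l1 := fun t => - (u - t * (u ^ 2 + v ^ 2)) / Nf t). set (l2 := fun t => - v / Nf t).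
  assert (DX : forall t, 0 <= t <= 1 -> is_derive X t (Re s * l1 t - Im s * l2 t)).
  { intros t Ht. unfold X. apply (is_derive_minus (V := R_NormedModule)).
    - apply is_derive_scal. now apply is_derive_ln_norm, Hpos.
    - apply is_derive_scal. now apply is_derive_atan_quot, Hpos. }
  assert (DY : forall t, 0 <= t <= 1 -> is_derive Y t (Re s * l2 t + Im s * l1 t)).
  { intros t Ht. unfold Y. apply (is_derive_plus (V := R_NormedModule)).
    - apply is_derive_scal. now apply is_derive_atan_quot, Hpos.
    - apply is_derive_scal. now apply is_derive_ln_norm, Hpos. }
  (* The equation divided by 1 - t w: y' + y (X + iY)' = 0 in real coordinates, with y = A + iB. *)
  assert (K : forall t, 0 <= t <= 1 ->
    A' t + A t * (Re s * l1 t - Im s * l2 t) - B t * (Re s * l2 t + Im s * l1 t) = 0 /\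
    B' t + A t * (Re s * l2 t + Im s * l1 t) + B t * (Re s * l1 t - Im s * l2 t) = 0).
  { intros t Ht. specialize (ODE t Ht). specialize (HN t Ht). specialize (Hpos t Ht).
    destruct s as [s1 s2].
    assert (O1 := f_equal Re ODE). assert (O2 := f_equal Im ODE). simpl in O1, O2.
    unfold l1, l2. simpl (Re (s1, s2)); simpl (Im (s1, s2)).
    set (at' := A' t) in *. set (bt' := B' t) in *. set (at0 := A t) in *. set (bt := B t) in *.
    set (P1 := u * (s1 * at0 - s2 * bt) - v * (s1 * bt + s2 * at0)).
    set (P2 := u * (s1 * bt + s2 * at0) + v * (s1 * at0 - s2 * bt)).
    assert (Q1 : (1 - t * u) * at' + t * v * bt' = P1) by (unfold P1; lra).
    assert (Q2 : (1 - t * u) * bt' - t * v * at' = P2) by (unfold P2; lra).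
    assert (Na : at' = ((1 - t * u) * P1 - t * v * P2) / Nf t).
    { rewrite <- Q1, <- Q2. unfold Nf in *. field. lra. }
    assert (Nb : bt' = ((1 - t * u) * P2 + t * v * P1) / Nf t).
    { rewrite <- Q1, <- Q2. unfold Nf in *. field. lra. }
    rewrite Na, Nb. unfold P1, P2. split; field; lra. }
  (* F1 + i F2 = y(t)(1 - t w)^s. Its derivative vanishes by [K] and its value at t = 0 is 1. *)
  set (F1 := fun t => A t * (exp (X t) * cos (Y t)) - B t * (exp (X t) * sin (Y t))).
  set (F2 := fun t => A t * (exp (X t) * sin (Y t)) + B t * (exp (X t) * cos (Y t))).
  assert (DF1 : forall t, 0 <= t <= 1 -> is_derive F1 t 0).
  { intros t Ht. unfold F1. generalize (DA t Ht) (DB t Ht) (DX t Ht) (DY t Ht) (K t Ht).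
    intros dA dB dX dY [K1 K2]. auto_derive.
    - repeat split; eexists; eassumption.
    - replace (Derive (fun x => A x) t) with (A' t) by (symmetry; now apply is_derive_unique).
      replace (Derive (fun x => B x) t) with (B' t) by (symmetry; now apply is_derive_unique).
      replace (Derive (fun x => X x) t) with (Re s * l1 t - Im s * l2 t) by (symmetry; now apply is_derive_unique).
      replace (Derive (fun x => Y x) t) with (Re s * l2 t + Im s * l1 t) by (symmetry; now apply is_derive_unique).
      set (x' := Re s * l1 t - Im s * l2 t) in *. set (y' := Re s * l2 t + Im s * l1 t) in *.
      replace (A' t) with (B t * y' - A t * x') by lra.
      replace (B' t) with (- (A t * y') - B t * x') by lra. ring. }
  assert (DF2 : forall t, 0 <= t <= 1 -> is_derive F2 t 0).
  { intros t Ht. unfold F2. generalize (DA t Ht) (DB t Ht) (DX t Ht) (DY t Ht) (K t Ht).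
    intros dA dB dX dY [K1 K2]. auto_derive.
    - repeat split; eexists; eassumption.
    - replace (Derive (fun x => A x) t) with (A' t) by (symmetry; now apply is_derive_unique).
      replace (Derive (fun x => B x) t) with (B' t) by (symmetry; now apply is_derive_unique).
      replace (Derive (fun x => X x) t) with (Re s * l1 t - Im s * l2 t) by (symmetry; now apply is_derive_unique).
      replace (Derive (fun x => Y x) t) with (Re s * l2 t + Im s * l1 t) by (symmetry; now apply is_derive_unique).
      set (x' := Re s * l1 t - Im s * l2 t) in *. set (y' := Re s * l2 t + Im s * l1 t) in *.
      replace (A' t) with (B t * y' - A t * x') by lra.
      replace (B' t) with (- (A t * y') - B t * x') by lra. ring. }
  assert (EF : forall t, ((A t, B t) * Cexp (X t, Y t) = (F1 t, F2 t))%C).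
  { intros t. unfold F1, F2, Cexp. apply C_ext; simpl; ring. }
  assert (E1 : F1 0 = F1 1) by (apply (eq_is_derive (V := R_NormedModule) F1 0 1 DF1); lra).
  assert (E2 : F2 0 = F2 1) by (apply (eq_is_derive (V := R_NormedModule) F2 0 1 DF2); lra).
  assert (I0 : ((A 0, B 0) * Cexp (s * Clog (1 - 0 * w)) = 1)%C).
  { replace (Clog (1 - 0 * w)) with (RtoC 0).
    - rewrite Cmult_0_r, Cexp_0. unfold A, B. rewrite !PSeries_0. unfold a, poch_coef. simpl.
      apply C_ext; simpl; field.
    - rewrite Clog_pos by (simpl; lra). replace (1 - 0 * w)%C with (RtoC 1) by ring.
      rewrite Cmod_1, ln_1. simpl. unfold Rdiv. rewrite Rmult_0_l, atan_0. reflexivity. }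
  assert (I1 : ((A 1, B 1) * Cexp (s * Clog (1 - 1 * w)) = 1)%C).
  { etransitivity; [|exact I0]. rewrite (EXY 0), (EXY 1) by lra. now rewrite !EF, E1, E2. }
  rewrite Cmult_1_l in I1.
  replace (Cexp (- (s * Clog (1 - w)))) with ((A 1, B 1) : C).
  - eapply Cser_ext; [|apply (Cser_of_PSeries a 1); [apply R1|apply R2]; lra].
    intros m. simpl. rewrite Cpow_1_l. ring.
  - rewrite Cexp_opp. set (E := Cexp (s * Clog (1 - w))) in *. assert (E <> 0) by apply Cexp_neq_0.
    set (ph := (A 1, B 1) : C) in *. change (@eq C ph (/ E)%C).
    replace (/ E)%C with (ph * E * / E)%C by (rewrite I1; ring). field. assumption.
Qed.

(** * Partial fractions of the cotangent *)

(** Unlike [Csum] it has an empty case, which occurs below when there are m - 1 = 0 pairs. *)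
Fixpoint psum (f : nat -> C) (n : nat) : C :=
  match n with O => RtoC 0 | S m => (psum f m + f m)%C end.

Lemma psum_ext (f g : nat -> C) (n : nat) : (forall k, (k < n)%nat -> f k = g k) -> psum f n = psum g n.
Proof.
  induction n; intros H; simpl; [reflexivity|].
  rewrite IHn by (intros; apply H; lia). rewrite H by lia. reflexivity.
Qed.

Lemma psum_plus (f g : nat -> C) (n : nat) : psum (fun k => (f k + g k)%C) n = (psum f n + psum g n)%C.
Proof. induction n; simpl; [ring|]. rewrite IHn. ring. Qed.

Lemma psum_scal (c : C) (f : nat -> C) (n : nat) : psum (fun k => (c * f k)%C) n = (c * psum f n)%C.
Proof. induction n; simpl; [ring|]. rewrite IHn. ring. Qed.

Lemma psum_split (f : nat -> C) (a b : nat) : psum f (a + b) = (psum f a + psum (fun k => f (a + k)%nat) b)%C.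
Proof.
  induction b; simpl; [rewrite Nat.add_0_r; ring|].
  rewrite Nat.add_succ_r. simpl. rewrite IHb. ring.
Qed.

Lemma psum_rev (f : nat -> C) (a : nat) : psum (fun k => f (a - 1 - k)%nat) a = psum f a.
Proof.
  induction a; [reflexivity|].
  change (S a) with (1 + a)%nat at 2. rewrite psum_split.
  rewrite (psum_ext (fun k => f (S a - 1 - (1 + k))%nat) (fun k => f (a - 1 - k)%nat)).
  - rewrite IHa. simpl. rewrite Nat.sub_0_r, Nat.sub_0_r. ring.
  - intros k _. f_equal. lia.
Qed.

Lemma Csum_psum (f : nat -> C) (n : nat) : Csum f n = psum f (S n).
Proof. induction n; [rewrite Csum_O; simpl; ring|]. rewrite Csum_S, IHn. reflexivity. Qed.

Lemma Cser_finite (f : nat -> C) (n : nat) : (forall k, (n <= k)%nat -> f k = 0) -> Cser f (psum f n).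
Proof.
  intros H. apply Cser_eps. intros e He. exists n. intros k Hk.
  rewrite Csum_psum. replace (S k) with (n + (S k - n))%nat by lia. rewrite psum_split.
  assert (Hz : forall b, psum (fun i => f (n + i)%nat) b = 0).
  { induction b; simpl; [reflexivity|]. rewrite IHb, H by lia. ring. }
  rewrite Hz. replace (psum f n + 0 - psum f n)%C with (RtoC 0) by ring. rewrite Cmod_0. lra.
Qed.

(** Dominated convergence for series: the head converges term by term as j grows, and the tail of
    every [a j] is at most the tail of [M], uniformly in j. *)
Lemma Cser_Tannery (a : nat -> nat -> C) (L : nat -> C) (M : nat -> R) (S' : nat -> C) (V : C) :
  ex_series M -> (forall j k, Cmod (a j k) <= M k) -> (forall j, Cser (a j) (S' j)) ->
  (forall k e, 0 < e -> exists J, forall j, (J <= j)%nat -> Cmod (a j k - L k) <= e) ->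
  (forall e, 0 < e -> exists J, forall j, (J <= j)%nat -> Cmod (S' j - V) <= e) ->
  Cser L V.
Proof.
  intros HM Ha HS HL HV. apply Cser_eps. intros e He.
  destruct (Series_tail_small M (e / 3) HM ltac:(lra)) as [N HN].
  exists N. intros n Hn. specialize (HN n Hn).
  assert (Hfin : forall e', 0 < e' -> exists J, forall j, (J <= j)%nat -> Cmod (Csum L n - Csum (a j) n) <= e').
  { clear Hn HN. induction n; intros e' He'.
    - destruct (HL 0%nat e' He') as [J HJ]. exists J. intros j Hj. rewrite !Csum_O, Cmod_minus_sym. now apply HJ.
    - destruct (HL (S n) (e' / 2) ltac:(lra)) as [J1 HJ1]. destruct (IHn (e' / 2) ltac:(lra)) as [J2 HJ2].
      exists (max J1 J2). intros j Hj. rewrite !Csum_S.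
      replace (Csum L n + L (S n) - (Csum (a j) n + a j (S n)))%C
        with ((Csum L n - Csum (a j) n) - (a j (S n) - L (S n)))%C by ring.
      eapply Rle_trans; [apply Cmod_triangle_minus|].
      specialize (HJ1 j ltac:(lia)). specialize (HJ2 j ltac:(lia)). lra. }
  destruct (Hfin (e / 3) ltac:(lra)) as [J1 HJ1]. destruct (HV (e / 3) ltac:(lra)) as [J2 HJ2].
  set (j := max J1 J2). specialize (HJ1 j ltac:(lia)). specialize (HJ2 j ltac:(lia)).
  assert (HT := Cmod_tail_le (a j) (S' j) M n (HS j) (Ha j) HM).
  apply Rabs_le_between in HN.
  replace (Csum L n - V)%C with ((Csum L n - Csum (a j) n) + (Csum (a j) n - S' j) + (S' j - V))%C by ring.
  eapply Rle_trans; [apply Cmod_triangle|].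
  eapply Rle_trans; [apply Rplus_le_compat_r, Cmod_triangle|]. lra.
Qed.

(** This is -coth(v/2), and 1/(1 - e^v) = (1 + [Kcoth v])/2. *)
Definition Kcoth (v : C) : C := ((1 + Cexp v) / (1 - Cexp v))%C.

(* Iterating K(v) = (K(v/2) + K(v/2 +- i pi))/2 gives n K(u) = sum K((u + 2 pi i k)/n)
   over -n/2 < k <= n/2 for n a power of 2; [Knode u n k] is the k-th summand. *)
Definition Knode (u : C) (N k : R) : C := Kcoth ((u + Ci * (2 * PI * k)%R) / N).

Lemma Cexp_Cipi (v : C) : (Cexp (v + Ci * PI) = - Cexp v)%C /\ (Cexp (v - Ci * PI) = - Cexp v)%C.
Proof.
  assert (H : Cexp (Ci * PI) = (- (1))%C).
  { unfold Cexp. simpl. replace (0 * PI - 1 * 0) with 0 by ring. replace (0 * 0 + 1 * PI) with PI by ring.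
    rewrite exp_0, cos_PI, sin_PI. apply C_ext; simpl; ring. }
  split.
  - rewrite Cexp_plus, H. ring.
  - unfold Cminus. rewrite Cexp_plus, Cexp_opp, H. field.
Qed.

(** With e = e^(v/2) the second node has exponential -e, and the mean of (1+e)/(1-e) and (1-e)/(1+e)
    is (1+e^2)/(1-e^2). Both shifts are kept so that nodes of either sign can be moved to the side
    that leaves the index range symmetric. *)
Lemma Kcoth_double (v : C) : Re v < 0 ->
  Kcoth v = ((1 / 2)%R * (Kcoth (v / 2) + Kcoth (v / 2 + Ci * PI)))%C /\
  Kcoth v = ((1 / 2)%R * (Kcoth (v / 2) + Kcoth (v / 2 - Ci * PI)))%C.
Proof.
  intros Hv. unfold Kcoth. destruct (Cexp_Cipi (v / 2)) as [-> ->].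
  assert (E : Cexp v = (Cexp (v / 2) * Cexp (v / 2))%C).
  { rewrite <- Cexp_plus. f_equal. field. }
  assert (Hm : Cmod (Cexp (v / 2)) < 1).
  { rewrite Cmod_Cexp, <- exp_0. apply exp_increasing.
    replace (v / 2)%C with (RtoC (1 / 2) * v)%C by (rewrite RtoC_div by lra; field).
    rewrite re_scal_l. lra. }
  set (e := Cexp (v / 2)) in *. rewrite E.
  assert (H1 : (1 - e)%C <> 0).
  { intros H. apply (Rlt_irrefl 1). rewrite <- Cmod_1 at 1.
    replace (RtoC 1) with e; [exact Hm|]. symmetry. now apply Ceq_minus. }
  assert (H2 : (1 + e)%C <> 0).
  { intros H. apply (Rlt_irrefl 1). rewrite <- Cmod_1 at 1.
    rewrite <- Cmod_opp. replace (- (1))%C with e; [exact Hm|].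
    replace e with ((1 + e) - 1)%C by ring. rewrite H. ring. }
  assert (H3 : (1 - e * e)%C <> 0).
  { replace (1 - e * e)%C with ((1 - e) * (1 + e))%C by ring. now apply Cmult_neq_0. }
  rewrite RtoC_div by lra.
  assert (H4 : (1 - - e)%C <> 0) by (replace (1 - - e)%C with (1 + e)%C by ring; exact H2).
  split; field; repeat split; try assumption; intros H; apply (f_equal Re) in H; simpl in H; lra.
Qed.

Lemma Re_div_pos (v : C) (N : R) : 0 < N -> Re (v / N)%C = Re v / N.
Proof. intros H. unfold Cdiv. rewrite <- RtoC_inv by lra. now rewrite re_scal_r. Qed.

Lemma Knode_double (u : C) (N k : R) : Re u < 0 -> 0 < N ->
  Knode u N k = ((1 / 2)%R * (Knode u (2 * N) k + Knode u (2 * N) (k + N)))%C /\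
  Knode u N k = ((1 / 2)%R * (Knode u (2 * N) k + Knode u (2 * N) (k - N)))%C.
Proof.
  intros Hu HN. unfold Knode. set (v := ((u + Ci * (2 * PI * k)%R) / N)%C).
  assert (HNC : RtoC N <> 0) by (intros E; apply RtoC_inj in E; lra).
  assert (H2C : RtoC 2 <> 0) by (intros E; apply RtoC_inj in E; lra).
  assert (Hv : Re v < 0).
  { unfold v. rewrite Re_div_pos by exact HN. rewrite re_plus. simpl (Re (Ci * _)).
    apply Rmult_lt_reg_r with N; [exact HN|]. unfold Rdiv. rewrite Rmult_assoc, Rinv_l by lra.
    simpl. lra. }
  destruct (Kcoth_double v Hv) as [D1 D2].
  assert (E0 : ((u + Ci * (2 * PI * k)%R) / (2 * N)%R = v / 2)%C).
  { unfold v. rewrite (RtoC_mult 2 N). field; repeat split; assumption. }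
  split.
  - rewrite D1, E0. do 3 f_equal. unfold v.
    rewrite (RtoC_mult 2 N), !RtoC_mult, RtoC_plus. field; repeat split; assumption.
  - rewrite D2, E0. do 3 f_equal. unfold v.
    rewrite (RtoC_mult 2 N), !RtoC_mult, RtoC_minus. field; repeat split; assumption.
Qed.

Definition Kpair (u : C) (N : R) (k : nat) : C := (Knode u N (INR (S k)) + Knode u N (- INR (S k)))%C.

Lemma Kcoth_sum (u : C) (j : nat) : Re u < 0 ->
  let m := (2 ^ j)%nat in
  ((2 * INR m)%R * Kcoth u = Knode u (2 * INR m) 0 + Knode u (2 * INR m) (INR m)
     + psum (Kpair u (2 * INR m)) (m - 1))%C.
Proof.
  intros Hu. induction j.
  - simpl. assert (H : Kcoth u = Knode u 1 0).
    { unfold Knode. f_equal. rewrite Rmult_0_r. field. }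
    rewrite H at 1. destruct (Knode_double u 1 0 Hu ltac:(lra)) as [-> _].
    rewrite Rplus_0_l, Cmult_assoc, <- RtoC_mult.
    replace (2 * 1 * (1 / 2)) with 1 by field. ring.
  - simpl Nat.pow. rewrite Nat.add_0_r. set (m := (2 ^ j)%nat) in *. cbv zeta in *.
    assert (Hm : (1 <= m)%nat) by (unfold m; generalize (Nat.pow_nonzero 2 j); lia).
    assert (HmR : 1 <= INR m) by (apply (le_INR 1); exact Hm).
    rewrite plus_INR. replace (2 * (INR m + INR m)) with (2 * (2 * INR m)) by ring.
    replace (INR m + INR m) with (2 * INR m) by ring.
    set (N := 2 * INR m) in *. assert (HN : 0 < N) by (unfold N; lra).
    rewrite (RtoC_mult 2 N), <- Cmult_assoc, IHj.
    assert (E1 : Knode u N 0 = ((1 / 2)%R * (Knode u (2 * N) 0 + Knode u (2 * N) N))%C).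
    { destruct (Knode_double u N 0 Hu HN) as [-> _]. now rewrite Rplus_0_l. }
    (* The unpaired node m splits into m and m - N = -m, which is a pair at level 2N. An index i of
       [Kpair] stands for the nodes i + 1 and -(i + 1), hence m - 1. *)
    assert (E2 : Knode u N (INR m) = ((1 / 2)%R * Kpair u (2 * N) (m - 1))%C).
    { destruct (Knode_double u N (INR m) Hu HN) as [_ ->]. unfold Kpair.
      replace (S (m - 1)) with m by lia. do 3 f_equal. unfold N. ring. }
    (* A pair +-k splits into +-k and +-(N - k). The new pairs fill the range above m in decreasing
       order, which [psum_rev] straightens out below. *)
    assert (E3 : forall k, (k < m - 1)%nat ->
       Kpair u N k = ((1 / 2)%R * (Kpair u (2 * N) k + Kpair u (2 * N) (m + (m - 1 - 1 - k))))%C).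
    { intros k Hk. unfold Kpair.
      destruct (Knode_double u N (INR (S k)) Hu HN) as [_ ->].
      destruct (Knode_double u N (- INR (S k)) Hu HN) as [-> _].
      replace (INR (S (m + (m - 1 - 1 - k)))) with (N - INR (S k)).
      2:{ unfold N. replace (S (m + (m - 1 - 1 - k))) with (m + m - S k)%nat by lia.
          rewrite minus_INR, plus_INR by lia. ring. }
      replace (- (N - INR (S k))) with (INR (S k) - N) by ring.
      replace (N - INR (S k)) with (- INR (S k) + N) by ring. ring. }
    rewrite (psum_ext _ _ _ E3), psum_scal, psum_plus.
    replace (m + m - 1)%nat with ((m - 1) + (1 + (m - 1)))%nat by lia.
    rewrite !psum_split.
    rewrite (psum_rev (fun k => Kpair u (2 * N) (m + k)) (m - 1)).
    rewrite (psum_ext (fun k => Kpair u (2 * N) (m - 1 + (1 + k))) (fun k => Kpair u (2 * N) (m + k))).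
    2:{ intros k _. f_equal. lia. }
    simpl (psum _ 1). rewrite Nat.add_0_r. rewrite E1, E2.
    rewrite RtoC_div by lra. field.
Qed.

(** * Limits and uniform bounds for the nodes *)

Lemma Kcoth_small (w : C) (N : R) : w <> 0 -> 0 < N -> 16 * Cmod w <= N ->
  Cmod (/ N * Kcoth (w / N) + 2 / w) <= 36 / N.
Proof.
  intros Hw HN Hb. set (a := (w / N)%C). set (W := Cmod w) in *.
  assert (HW : 0 < W) by now apply Cmod_gt_0.
  assert (HNC : RtoC N <> 0) by (intros E; apply RtoC_inj in E; lra).
  assert (Ha : Cmod a = W / N).
  { unfold a. rewrite Cmod_div by exact HNC. rewrite Cmod_R, Rabs_pos_eq by lra. reflexivity. }
  assert (Ha1 : Cmod a <= 1 / 16).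
  { rewrite Ha. apply Rmult_le_reg_r with N; [exact HN|]. unfold Rdiv at 1.
    rewrite Rmult_assoc, Rinv_l; lra. }
  assert (Ha0 := Cmod_ge_0 a).
  set (r := (Cexp a - 1 - a)%C).
  assert (Hr : Cmod r <= 8 * Cmod a ^ 2) by (apply Cexp_taylor1; lra).
  assert (Er : Cexp a = (1 + a + r)%C) by (unfold r; ring).
  assert (Ew : w = (N * a)%C) by (unfold a; field; exact HNC).
  assert (HWN : W = N * Cmod a) by (rewrite Ha; field; lra).
  set (b := Cmod a) in *.
  assert (Hd : b / 2 <= Cmod (1 - Cexp a)).
  { rewrite Er. replace (1 - (1 + a + r))%C with (- (a + r))%C by ring. rewrite Cmod_opp.
    generalize (Cmod_triangle_rev a r). fold b. nra. }
  assert (Hb0 : 0 < b) by nra.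
  assert (Hdn : (1 - Cexp a)%C <> 0) by (apply Cmod_gt_0; lra).
  assert (Han : a <> 0) by now apply Cmod_gt_0.
  (* With e^a = 1 + a + r the linear terms of a(1 + e^a) + 2(1 - e^a) cancel. The rest is at most
     18|a|^2 over a denominator of at least |a|^2/2, whence 36. *)
  replace (/ N * Kcoth a + 2 / w)%C
    with ((a * a + r * a - 2 * r) * / (1 - Cexp a) * / a * / N)%C.
  - rewrite !Cmod_mult, !Cmod_inv by assumption.
    rewrite Cmod_R, (Rabs_pos_eq N) by lra. fold b.
    unfold Rdiv. apply Rmult_le_compat_r; [left; now apply Rinv_0_lt_compat|].
    assert (H1 : Cmod (a * a + r * a - 2 * r) <= 18 * b ^ 2).
    { eapply Rle_trans; [apply Cmod_triangle_minus|].
      eapply Rle_trans; [apply Rplus_le_compat_r, Cmod_triangle|].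
      rewrite !Cmod_mult, Cmod_R, (Rabs_pos_eq 2) by lra. fold b.
      generalize (Cmod_ge_0 r). nra. }
    apply Rle_trans with (18 * b ^ 2 * / (b / 2) * / b).
    + apply Rmult_le_compat_r; [left; now apply Rinv_0_lt_compat|].
      apply Rmult_le_compat; [apply Cmod_ge_0|left; apply Rinv_0_lt_compat; lra|exact H1|].
      apply Rinv_le_contravar; lra.
    + right. field. lra.
  - unfold Kcoth. rewrite Ew. set (E := Cexp a) in *.
    replace r with (E - 1 - a)%C by reflexivity. field. repeat split; assumption.
Qed.

Lemma Knode_limit (u : C) (k : R) : Re u < 0 ->
  forall N, 0 < N -> 16 * Cmod (u + Ci * (2 * PI * k)%R) <= N ->
  Cmod (/ N * Knode u N k + 2 / (u + Ci * (2 * PI * k)%R)) <= 36 / N.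
Proof.
  intros Hu N HN H. apply Kcoth_small; [|exact HN|exact H].
  intros E. apply (f_equal Re) in E. rewrite re_plus in E. simpl in E. lra.
Qed.

(** sin x >= x - x^3/6, and x <= 2 because pi <= 4. *)
Lemma sin_ge_third (x : R) : 0 <= x <= PI / 2 -> x / 3 <= sin x.
Proof.
  intros Hx. assert (Hpi := PI_4). assert (Hp := PI_RGT_0).
  destruct (sin_bound x 0) as [H _]; [lra|lra|].
  unfold sin_approx, sin_term in H. simpl in H.
  assert (x * x <= 4) by nra. assert (x * (x * x) <= x * 4) by (apply Rmult_le_compat_l; lra).
  eapply Rle_trans; [|exact H]. field_simplify. simpl. lra.
Qed.

Lemma one_minus_Cexp_ge (v : C) : -1 <= Re v <= 0 -> - Re v / 2 <= Cmod (1 - Cexp v).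
Proof.
  intros Hv. apply Rle_trans with (1 - exp (Re v)).
  - set (x := - Re v). replace (Re v) with (- x) by (unfold x; ring).
    rewrite exp_Ropp. generalize (exp_ineq1_le x). intros H.
    assert (0 <= x <= 1) by (unfold x; lra).
    assert (/ exp x <= / (1 + x)) by (apply Rinv_le_contravar; lra).
    assert (/ (1 + x) <= 1 - x / 2).
    { apply Rmult_le_reg_r with (1 + x); [lra|]. rewrite Rinv_l by lra. nra. }
    lra.
  - generalize (Cmod_triangle_rev 1 (- Cexp v)).
    rewrite Cmod_opp, Cmod_1, Cmod_Cexp. unfold Cminus. lra.
Qed.

Lemma one_minus_Cexp_le (v : C) : Cmod v <= 1 / 2 -> Cmod (1 - Cexp v) <= 5 * Cmod v.
Proof.
  intros Hv. replace (1 - Cexp v)%C with (- ((Cexp v - 1 - v) + v))%C by ring.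
  rewrite Cmod_opp. eapply Rle_trans; [apply Cmod_triangle|].
  generalize (Cexp_taylor1 v Hv) (Cmod_ge_0 v). nra.
Qed.

(** With a = u/N and b = 2 pi i k/N (k here being the node) the pair equals 2(1 - e^(2a))/D, where D
    = (1 - e^(a+b))(1 - e^(a-b)). The numerator is O(1/N), so what matters is |D| N^2 >= c2 k^2 with
    c2 independent of N. *)
Lemma Kpair_bound (u : C) : Re u < 0 -> exists c, 0 <= c /\
  forall N k, 4 * Cmod u + 4 <= N -> 2 * INR (S k) <= N ->
  Cmod (/ N * Kpair u N k) <= c * / (INR (S k)) ^ 2.
Proof.
  intros Hu. set (U := Cmod u). set (tau := - Re u).
  assert (Htau : 0 < tau) by (unfold tau; lra).
  assert (HU : tau <= U).
  { unfold tau, U. generalize (re_le_Cmod u). rewrite Rabs_left by lra. lra. }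
  (* Two bounds on Y = |D| N^2 are combined: Y >= tau^2/4 from real parts, and Y >= 2 k^2 - 25 U^2
     from D = (1 - e^a)^2 + 4 e^a sin^2(pi k/N). The first turns 25 U^2 into (100 U^2/tau^2) Y. *)
  set (c2 := 2 / (1 + 100 * U ^ 2 / tau ^ 2)).
  assert (Ht2 : 0 < tau ^ 2) by nra.
  assert (Hq : 0 <= 100 * U ^ 2 / tau ^ 2).
  { apply Rmult_le_pos; [nra|]. left; now apply Rinv_0_lt_compat. }
  assert (Hc2 : 0 < c2) by (apply Rdiv_lt_0_compat; lra).
  exists (20 * U / c2). split; [apply Rmult_le_pos; [lra|left; now apply Rinv_0_lt_compat]|].
  intros N k HN Hk. set (kk := INR (S k)) in *.
  assert (Hkk : 1 <= kk) by (apply (le_INR 1); lia).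
  assert (HN0 : 0 < N) by lra.
  assert (HNC : RtoC N <> 0) by (intros E; apply RtoC_inj in E; lra).
  set (a := (u / N)%C). set (b := (Ci * (2 * PI * kk / N)%R)%C).
  assert (Ha : Cmod a = U / N).
  { unfold a. rewrite Cmod_div by exact HNC. rewrite Cmod_R, Rabs_pos_eq by lra. reflexivity. }
  assert (HUN : U / N <= 1 / 4).
  { apply Rmult_le_reg_r with N; [exact HN0|]. unfold Rdiv at 1.
    rewrite Rmult_assoc, Rinv_l; lra. }
  assert (HtN : 0 < tau / N <= 1 / 4).
  { split; [now apply Rdiv_lt_0_compat|]. eapply Rle_trans; [|exact HUN].
    apply Rmult_le_compat_r; [left; now apply Rinv_0_lt_compat|exact HU]. }
  assert (ReA : Re a = - (tau / N)).
  { unfold a. rewrite Re_div_pos by exact HN0. unfold tau. field. lra. }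
  assert (ReB : Re b = 0) by (unfold b; simpl; ring).
  set (D := ((1 - Cexp (a + b)) * (1 - Cexp (a - b)))%C).
  assert (D1 : tau ^ 2 / 4 <= Cmod D * N ^ 2).
  { unfold D. rewrite Cmod_mult.
    assert (P1 : tau / N / 2 <= Cmod (1 - Cexp (a + b))).
    { replace (tau / N) with (- Re (a + b)) by (rewrite re_plus, ReA, ReB; ring).
      apply one_minus_Cexp_ge. rewrite re_plus, ReA, ReB. lra. }
    assert (P2 : tau / N / 2 <= Cmod (1 - Cexp (a - b))).
    { replace (tau / N) with (- Re (a - b)) by (unfold Cminus; rewrite re_plus, re_opp, ReA, ReB; ring).
      apply one_minus_Cexp_ge. unfold Cminus. rewrite re_plus, re_opp, ReA, ReB. lra. }
    apply Rle_trans with ((tau / N / 2) * (tau / N / 2) * N ^ 2); [right; field; lra|].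
    apply Rmult_le_compat_r; [apply pow2_ge_0|]. apply Rmult_le_compat; lra. }
  assert (D2 : 2 * kk ^ 2 - 25 * U ^ 2 <= Cmod D * N ^ 2).
  { set (s := sin (PI * kk / N)).
    assert (Eb : (Cexp b + Cexp (- b) = 2 - 4 * (s ^ 2)%R)%C).
    { unfold b, Cexp. simpl.
      replace (0 * (2 * PI * kk / N) - 1 * 0) with 0 by ring.
      replace (0 * 0 + 1 * (2 * PI * kk / N)) with (2 * (PI * kk / N)) by (field; lra).
      rewrite Ropp_0, exp_0, cos_neg, sin_neg, cos_2a_sin. fold s.
      apply C_ext; simpl; ring. }
    assert (ED : D = ((1 - Cexp a) * (1 - Cexp a) + Cexp a * (4 * (s ^ 2)%R))%C).
    { unfold D, Cminus at 1 2 3 4. rewrite !Cexp_plus.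
      replace (Cexp (- b)) with (2 - 4 * (s ^ 2)%R - Cexp b)%C by (rewrite <- Eb; ring).
      assert (Ebb : (Cexp b * (2 - 4 * (s ^ 2)%R - Cexp b) = 1)%C).
      { rewrite <- Eb. replace (Cexp b + Cexp (- b) - Cexp b)%C with (Cexp (- b)) by ring.
        rewrite <- Cexp_plus. replace (b + - b)%C with (RtoC 0) by ring. apply Cexp_0. }
      set (y := (2 - 4 * (s ^ 2)%R - Cexp b)%C) in *.
      replace (4 * (s ^ 2)%R)%C with (2 - y - Cexp b)%C by (unfold y; ring).
      transitivity (1 - Cexp a * (Cexp b + y) + Cexp a * Cexp a * (Cexp b * y))%C; [ring|].
      rewrite Ebb. ring. }
    assert (Hs : kk / N <= s).
    { eapply Rle_trans; [|apply sin_ge_third].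
      - assert (H32 := PI2_3_2). apply Rmult_le_reg_r with (3 * N); [lra|].
        field_simplify; [|lra|lra]. nra.
      - split.
        + apply Rmult_le_pos; [generalize PI_RGT_0; nra|left; now apply Rinv_0_lt_compat].
        + apply Rmult_le_reg_r with (2 * N); [lra|]. field_simplify; [|lra]. generalize PI_RGT_0. nra. }
    assert (HkN : 0 < kk / N) by (apply Rdiv_lt_0_compat; lra).
    assert (He : 1 / 2 <= Cmod (Cexp a)).
    { rewrite Cmod_Cexp, ReA. generalize (exp_ineq1_le (- (tau / N))). lra. }
    assert (H1 : Cmod ((1 - Cexp a) * (1 - Cexp a)) <= 25 * (U / N) ^ 2).
    { rewrite Cmod_mult. assert (Hl := one_minus_Cexp_le a). rewrite Ha in Hl.
      specialize (Hl ltac:(lra)). generalize (Cmod_ge_0 (1 - Cexp a)). nra. }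
    assert (H2 : 2 * (kk / N) ^ 2 <= Cmod (Cexp a * (4 * (s ^ 2)%R))).
    { rewrite !Cmod_mult, !Cmod_R, !Rabs_pos_eq by (try apply pow2_ge_0; lra).
      assert ((kk / N) ^ 2 <= s ^ 2) by (apply pow_incr; lra).
      generalize (pow2_ge_0 (kk / N)). nra. }
    assert (H3 : 2 * (kk / N) ^ 2 - 25 * (U / N) ^ 2 <= Cmod D).
    { rewrite ED, Cplus_comm. eapply Rle_trans; [|apply Cmod_triangle_rev]. lra. }
    apply Rle_trans with ((2 * (kk / N) ^ 2 - 25 * (U / N) ^ 2) * N ^ 2); [right; field; lra|].
    apply Rmult_le_compat_r; [apply pow2_ge_0|exact H3]. }
  assert (D3 : c2 * kk ^ 2 <= Cmod D * N ^ 2).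
  { set (Y := Cmod D * N ^ 2) in *.
    assert (25 * U ^ 2 <= 100 * U ^ 2 / tau ^ 2 * Y).
    { replace (25 * U ^ 2) with (100 * U ^ 2 / tau ^ 2 * (tau ^ 2 / 4)) by (field; lra).
      apply Rmult_le_compat_l; assumption. }
    unfold c2. set (w := 100 * U ^ 2 / tau ^ 2) in *.
    apply Rmult_le_reg_r with (1 + w); [lra|].
    replace (2 / (1 + w) * kk ^ 2 * (1 + w)) with (2 * kk ^ 2) by (field; lra).
    lra. }
  assert (HN2 : 0 < N ^ 2) by nra.
  assert (Hk2 : 0 < kk ^ 2) by nra.
  assert (HD : 0 < Cmod D).
  { apply Rmult_lt_reg_r with (N ^ 2); [exact HN2|]. nra. }
  assert (HDn : D <> 0) by now apply Cmod_gt_0.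
  assert (HD1 : (1 - Cexp (a + b))%C <> 0).
  { intros E. apply HDn. unfold D. rewrite E. ring. }
  assert (HD2 : (1 - Cexp (a - b))%C <> 0).
  { intros E. apply HDn. unfold D. rewrite E. ring. }
  assert (EK : Kpair u N k = (2 * (1 - Cexp (2 * a)) / D)%C).
  { unfold Kpair, Knode. fold kk.
    replace ((u + Ci * (2 * PI * kk)%R) / N)%C with (a + b)%C.
    2:{ unfold a, b. rewrite RtoC_div by lra. field. exact HNC. }
    replace ((u + Ci * (2 * PI * - kk)%R) / N)%C with (a - b)%C.
    2:{ unfold a, b. replace (2 * PI * - kk) with (- (2 * PI * kk)) by ring.
        rewrite RtoC_div, RtoC_opp by lra. field. exact HNC. }
    replace (Cexp (2 * a)) with (Cexp (a + b) * Cexp (a - b))%C.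
    2:{ rewrite <- Cexp_plus. f_equal. ring. }
    unfold Kcoth, D. field. split; assumption. }
  rewrite EK. unfold Cdiv. rewrite !Cmod_mult, !Cmod_inv by assumption.
  rewrite !Cmod_R, (Rabs_pos_eq N), (Rabs_pos_eq 2) by lra.
  assert (H2a : Cmod (1 - Cexp (2 * a)) <= 10 * (U / N)).
  { assert (E2 : Cmod (2 * a) = 2 * (U / N)).
    { rewrite Cmod_mult, Ha, Cmod_R, Rabs_pos_eq by lra. reflexivity. }
    assert (Hl := one_minus_Cexp_le (2 * a)). rewrite E2 in Hl. specialize (Hl ltac:(lra)). lra. }
  assert (HDi : / Cmod D <= N ^ 2 / (c2 * kk ^ 2)).
  { apply Rmult_le_reg_r with (Cmod D); [exact HD|]. rewrite Rinv_l by lra.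
    apply Rmult_le_reg_r with (c2 * kk ^ 2); [nra|].
    replace (N ^ 2 / (c2 * kk ^ 2) * Cmod D * (c2 * kk ^ 2)) with (Cmod D * N ^ 2) by (field; split; lra).
    lra. }
  apply Rle_trans with (/ N * (2 * (10 * (U / N)) * (N ^ 2 / (c2 * kk ^ 2)))).
  - apply Rmult_le_compat_l; [left; now apply Rinv_0_lt_compat|].
    apply Rmult_le_compat; [|left; now apply Rinv_0_lt_compat| |exact HDi].
    + apply Rmult_le_pos; [lra|apply Cmod_ge_0].
    + apply Rmult_le_compat_l; [lra|exact H2a].
  - right. field. repeat split; lra.
Qed.

(** At k = N/2 the exponential is -e^(u/N), near -1, so [Kcoth] is (1 - e^(u/N))/(1 + e^(u/N)). A
    constant bound suffices, as this node gets divided by N. *)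
Lemma Knode_half_bound (u : C) (N : R) : 4 * Cmod u + 4 <= N -> Cmod (Knode u N (N / 2)) <= 5.
Proof.
  intros HN. assert (HU := Cmod_ge_0 u). assert (HN0 : 0 < N) by lra.
  assert (HNC : RtoC N <> 0) by (intros E; apply RtoC_inj in E; lra).
  unfold Knode. set (a := (u / N)%C).
  replace ((u + Ci * (2 * PI * (N / 2))%R) / N)%C with (a + Ci * PI)%C.
  2:{ unfold a. replace (2 * PI * (N / 2)) with (PI * N) by field. rewrite RtoC_mult. field. exact HNC. }
  assert (Ha : Cmod a <= 1 / 4).
  { unfold a. rewrite Cmod_div by exact HNC. rewrite Cmod_R, Rabs_pos_eq by lra.
    apply Rmult_le_reg_r with N; [exact HN0|]. unfold Rdiv at 1. rewrite Rmult_assoc, Rinv_l; lra. }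
  unfold Kcoth. rewrite (proj1 (Cexp_Cipi a)).
  assert (H1 : Cmod (1 - Cexp a) <= 5 / 4) by (generalize (one_minus_Cexp_le a); lra).
  assert (H2 : 3 / 4 <= Cmod (1 - - Cexp a)).
  { replace (1 - - Cexp a)%C with (2 + - (1 - Cexp a))%C by ring.
    generalize (Cmod_triangle_rev 2 (- (1 - Cexp a))). rewrite Cmod_opp, Cmod_R, Rabs_pos_eq; lra. }
  rewrite Cmod_div by (apply Cmod_gt_0; lra).
  replace (1 + - Cexp a)%C with (1 - Cexp a)%C by ring.
  apply Rmult_le_reg_r with (Cmod (1 - - Cexp a)); [lra|].
  unfold Rdiv. rewrite Rmult_assoc, Rinv_l by lra. lra.
Qed.

Lemma le_INR_pow2 (n j0 : nat) (B : R) :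
  B <= INR n -> forall j, (n <= j)%nat -> B <= 2 * INR (2 ^ (j + j0)).
Proof.
  intros HB j Hj. assert (H : (n <= 2 ^ (j + j0))%nat).
  { generalize (Nat.pow_gt_lin_r 2 (j + j0)). lia. }
  apply le_INR in H. generalize (pos_INR (2 ^ (j + j0))). lra.
Qed.

Lemma INR_above (B : R) : exists n, B <= INR n.
Proof. destruct (INR_archimed 1 B) as [n Hn]; [lra|]. exists n. lra. Qed.

(** [Kcoth_sum] divided by N, in the limit of large N: the node 0 tends to -2/u, each pair to its
    two polar terms, and the unpaired node N/2 is O(1/N). *)
Theorem coth_partial_fractions (u : C) : Re u < 0 ->
  Cser (fun k => (- (2 / (u + Ci * (2 * PI * INR (S k))%R))
                  - 2 / (u + Ci * (2 * PI * - INR (S k))%R))%C) (Kcoth u + 2 / u)%C.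
Proof.
  intros Hu. destruct (Kpair_bound u Hu) as [c [Hc Hb]].
  (* The offset j0 makes N >= 4|u| + 4 for every j, as the uniform bounds demand. *)
  destruct (INR_above (4 * Cmod u + 4)) as [j0 Hj0].
  set (m := fun j => (2 ^ (j + j0))%nat). set (N := fun j => 2 * INR (m j)).
  assert (HN : forall j, 4 * Cmod u + 4 <= N j).
  { intros j. unfold N, m. rewrite Nat.add_comm. now apply (le_INR_pow2 j0 j (4 * Cmod u + 4)). }
  assert (HU := Cmod_ge_0 u).
  assert (HN0 : forall j, 0 < N j) by (intros j; specialize (HN j); lra).
  assert (Hbig : forall B, exists J, forall j, (J <= j)%nat -> B <= N j).
  { intros B. destruct (INR_above B) as [J HJ]. exists J. now apply le_INR_pow2. }
  assert (Hsmall : forall B e, 0 < B -> 0 < e -> exists J, forall j, (J <= j)%nat -> B / N j <= e).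
  { intros B e HB He. destruct (Hbig (B / e)) as [J HJ]. exists J. intros j Hj. specialize (HJ j Hj).
    apply Rmult_le_reg_r with (N j); [apply HN0|]. unfold Rdiv at 1.
    rewrite Rmult_assoc, Rinv_l by (apply Rgt_not_eq, HN0).
    replace (B * 1) with (e * (B / e)) by (field; lra). apply Rmult_le_compat_l; lra. }
  set (a := fun j k => if (k <? m j - 1)%nat then (/ N j * Kpair u (N j) k)%C else RtoC 0).
  apply (Cser_Tannery a _ (fun k => c * / INR (S k) ^ 2)
    (fun j => psum (a j) (m j - 1))).
  - apply ex_series_scal_l with (c := c) (a := fun k => / INR (S k) ^ 2). apply ex_series_inv_sq.
  - intros j k. unfold a. destruct (Nat.ltb_spec k (m j - 1)) as [H|H].
    + apply Hb; [apply HN|]. unfold N. apply Rmult_le_compat_l; [lra|]. apply le_INR. lia.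
    + rewrite Cmod_0. apply Rmult_le_pos; [exact Hc|]. left. apply Rinv_0_lt_compat.
      apply pow_lt, lt_0_INR. lia.
  - intros j. apply Cser_finite. intros k Hk. unfold a.
    destruct (Nat.ltb_spec k (m j - 1)); [lia|reflexivity].
  - intros k e He.
    (* 72 = 36 + 36, one error for each node of the pair. *)
    destruct (Hsmall 72 e ltac:(lra) He) as [J1 HJ1].
    destruct (Hbig (16 * Cmod (u + Ci * (2 * PI * INR (S k))%R))) as [J2 HJ2].
    destruct (Hbig (16 * Cmod (u + Ci * (2 * PI * - INR (S k))%R))) as [J3 HJ3].
    exists (max (max J1 J2) (max J3 (k + 3))). intros j Hj.
    specialize (HJ1 j ltac:(lia)). specialize (HJ2 j ltac:(lia)). specialize (HJ3 j ltac:(lia)).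
    unfold a. destruct (Nat.ltb_spec k (m j - 1)) as [H|H].
    2:{ exfalso. unfold m in H. generalize (Nat.pow_gt_lin_r 2 (j + j0)). lia. }
    unfold Kpair.
    generalize (Knode_limit u (INR (S k)) Hu (N j) (HN0 j) HJ2).
    generalize (Knode_limit u (- INR (S k)) Hu (N j) (HN0 j) HJ3).
    intros H1 H2.
    match type of H2 with Cmod ?X <= _ => match type of H1 with Cmod ?Y <= _ =>
      match goal with |- Cmod ?G <= _ => replace G with (X + Y)%C by ring end end end.
    eapply Rle_trans; [apply Cmod_triangle|]. lra.
  - intros e He.
    (* 41 = 36 + 5: the error at the node 0 and the bound for the node N/2. *)
    destruct (Hsmall 41 e ltac:(lra) He) as [J1 HJ1].
    destruct (Hbig (16 * Cmod (u + Ci * (2 * PI * 0)%R))) as [J2 HJ2].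
    exists (max J1 J2). intros j Hj.
    specialize (HJ1 j ltac:(lia)). specialize (HJ2 j ltac:(lia)).
    assert (HNC : RtoC (N j) <> 0).
    { intros E; apply RtoC_inj in E. generalize (HN0 j). lra. }
    assert (E : (psum (a j) (m j - 1) = Kcoth u - / N j * Knode u (N j) 0 - / N j * Knode u (N j) (N j / 2))%C).
    { rewrite (psum_ext (a j) (fun k => (/ N j * Kpair u (N j) k)%C)).
      2:{ intros k Hk. unfold a. destruct (Nat.ltb_spec k (m j - 1)); [reflexivity|lia]. }
      rewrite psum_scal.
      assert (HK := Kcoth_sum u (j + j0) Hu). cbv zeta in HK. fold (m j) in HK. fold (N j) in HK.
      replace (N j / 2) with (INR (m j)) by (unfold N; field).
      replace (psum (Kpair u (N j)) (m j - 1))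
        with (N j * Kcoth u - Knode u (N j) 0 - Knode u (N j) (INR (m j)))%C by (rewrite HK; ring).
      field. exact HNC. }
    rewrite E.
    generalize (Knode_limit u 0 Hu (N j) (HN0 j) HJ2). rewrite Rmult_0_r, Cmult_0_r, Cplus_0_r. intros H1.
    assert (H2 := Knode_half_bound u (N j) (HN j)).
    match type of H1 with Cmod ?X <= _ => match goal with |- Cmod ?G <= _ =>
      replace G with (- X - / N j * Knode u (N j) (N j / 2)%R)%C by ring end end.
    eapply Rle_trans; [apply Cmod_triangle_minus|].
    rewrite Cmod_opp, Cmod_mult, Cmod_inv, Cmod_R, Rabs_pos_eq by (try exact HNC; left; apply HN0).
    assert (0 < / N j) by (apply Rinv_0_lt_compat, HN0).
    unfold Rdiv in *. nra.
Qed.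

(** * The formula in the half-plane of convergence *)

Lemma Cser_geom (g : C) : Cmod g < 1 -> Cser (fun k => (g ^ k)%C) (/ (1 - g))%C.
Proof.
  intros Hg. assert (Hg0 := Cmod_ge_0 g).
  assert (Hne : (1 - g)%C <> 0).
  { intros E. apply (Rlt_irrefl 1). rewrite <- Cmod_1 at 1.
    replace (RtoC 1) with g; [exact Hg|]. symmetry. now apply Ceq_minus. }
  assert (Hm : 0 < Cmod (1 - g)) by now apply Cmod_gt_0.
  assert (HS : forall n, (Csum (fun k => g ^ k) n = (1 - g ^ S n) / (1 - g))%C).
  { induction n; [rewrite Csum_O; simpl; field; exact Hne|].
    rewrite Csum_S, IHn. simpl. field. exact Hne. }
  apply Cser_eps. intros e He.
  destruct (pow_lt_1_zero (Cmod g) ltac:(rewrite Rabs_pos_eq; lra) (e * Cmod (1 - g))) as [n0 Hn0]; [nra|].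
  exists n0. intros n Hn. rewrite HS.
  replace ((1 - g ^ S n) / (1 - g) - / (1 - g))%C with (- (g ^ S n / (1 - g)))%C by (field; exact Hne).
  rewrite Cmod_opp, Cmod_div, Cmod_pow by exact Hne.
  specialize (Hn0 (S n) ltac:(lia)). rewrite Rabs_pos_eq in Hn0 by (apply pow_le; lra).
  apply Rmult_le_reg_r with (Cmod (1 - g)); [exact Hm|].
  unfold Rdiv. rewrite Rmult_assoc, Rinv_l by lra. lra.
Qed.

Lemma Clog_RtoC (c : R) : 0 < c -> Clog c = RtoC (ln c).
Proof.
  intros Hc. rewrite Clog_pos by exact Hc. rewrite Cmod_R, Rabs_pos_eq by lra. simpl.
  unfold Rdiv. rewrite Rmult_0_l, atan_0. reflexivity.
Qed.

Lemma Clog_div_r (y : C) (c : R) : 0 < c -> 0 < Re y -> (Clog (y / c) = Clog y - ln c)%C.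
Proof.
  intros Hc Hy. assert (HcC : RtoC c <> 0) by (intros E; apply RtoC_inj in E; lra).
  assert (Hm : 0 < Cmod y).
  { generalize (re_le_Cmod y) (Rle_abs (Re y)). lra. }
  assert (ER : Re (y / c)%C = Re y / c) by now apply Re_div_pos.
  assert (EI : Im (y / c)%C = Im y / c).
  { unfold Cdiv. rewrite <- RtoC_inv by lra. now rewrite im_scal_r. }
  rewrite (Clog_pos (y / c)), (Clog_pos y) by (try exact Hy; rewrite ER; now apply Rdiv_lt_0_compat).
  rewrite ER, EI, Cmod_div, Cmod_R, Rabs_pos_eq by (try exact HcC; lra).
  rewrite ln_div by assumption.
  replace (Im y / c / (Re y / c)) with (Im y / Re y) by (field; lra).
  apply C_ext; simpl; ring.
Qed.

(** Inversion preserves the right half-plane and negates the argument there, so no branch cut is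
    crossed. *)
Lemma Clog_div_l (y : C) (c : R) : 0 < c -> 0 < Re y -> (Clog (c / y) = ln c - Clog y)%C.
Proof.
  intros Hc Hy.
  assert (Hm : 0 < Cmod y).
  { generalize (re_le_Cmod y) (Rle_abs (Re y)). lra. }
  assert (Hy0 : y <> 0) by now apply Cmod_gt_0.
  assert (Hn : 0 < Re y ^ 2 + Im y ^ 2) by nra.
  assert (ER : Re (c / y)%C = c * Re y / (Re y ^ 2 + Im y ^ 2)).
  { destruct y as [a b]. simpl in *. field. lra. }
  assert (EI : Im (c / y)%C = - (c * Im y) / (Re y ^ 2 + Im y ^ 2)).
  { destruct y as [a b]. simpl in *. field. lra. }
  rewrite (Clog_pos (c / y)), (Clog_pos y)
    by (try exact Hy; rewrite ER; apply Rdiv_lt_0_compat; nra).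
  rewrite ER, EI, Cmod_div, Cmod_R, Rabs_pos_eq by (try exact Hy0; lra).
  rewrite ln_div by assumption.
  replace (- (c * Im y) / (Re y ^ 2 + Im y ^ 2) / (c * Re y / (Re y ^ 2 + Im y ^ 2)))
    with (- (Im y / Re y)) by (field; repeat split; lra).
  rewrite atan_opp. apply C_ext; simpl; ring.
Qed.

Lemma Re_one_minus_pos (x : C) : Cmod x < 1 -> 0 < Re (1 - x).
Proof.
  intros H. unfold Cminus. rewrite re_plus, re_opp. simpl (Re 1).
  generalize (re_le_Cmod x) (Rle_abs (Re x)). lra.
Qed.

(** q^(s(k+1)) (1 - q)^s = (q - q^2)^s q^(sk); the power of the quotient splits because 1 - q^(k+z)
    has positive real part. *)
Lemma qzeta_term_eq (q : R) (s z : C) (k : nat) : 0 < q < 1 -> 0 < Re z ->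
  (qzeta_term q s z k = Cexp (s * Clog (q - q ^ 2)%R) *
     (Cexp (s * ln q) ^ k * Cexp (- (s * Clog (1 - (q ^ k)%R * qpow q z)))))%C.
Proof.
  intros Hq Hz. assert (Hx := Cmod_qpow_lt_1 q z Hq Hz).
  assert (Hqk : 0 < q ^ k <= 1).
  { split; [apply pow_lt; lra|]. rewrite <- (pow1 k). apply pow_incr. lra. }
  assert (Eq : qpow q (INR k + z) = ((q ^ k)%R * qpow q z)%C).
  { unfold qpow. rewrite Cmult_plus_distr_r, Cexp_plus. f_equal.
    rewrite <- RtoC_mult. unfold Cexp. simpl. rewrite cos_0, sin_0.
    replace (exp (INR k * ln q)) with (q ^ k).
    - apply C_ext; simpl; ring.
    - rewrite <- Rpower_pow by lra. reflexivity. }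
  set (y := (1 - (q ^ k)%R * qpow q z)%C).
  assert (Hy : 0 < Re y).
  { apply Re_one_minus_pos. rewrite Cmod_mult, Cmod_R, Rabs_pos_eq by lra.
    generalize (Cmod_ge_0 (qpow q z)). nra. }
  unfold qzeta_term, qnum. rewrite Eq. fold y. unfold Defs.Cpow.
  rewrite (Clog_div_r y (1 - q)) by (try exact Hy; lra).
  rewrite Clog_RtoC by nra.
  replace (q - q ^ 2) with (q * (1 - q)) by ring. rewrite ln_mult by lra.
  unfold Cdiv. rewrite <- Cexp_opp, <- (Cexp_nat (s * ln q) k).
  unfold qpow. rewrite <- !Cexp_plus. f_equal.
  rewrite S_INR, !RtoC_plus. ring.
Qed.

Lemma poch_coef_mult (s x : C) (c : R) (m : nat) : poch_coef s (c * x) m = (poch_coef s x m * (c ^ m)%R)%C.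
Proof. unfold poch_coef. rewrite Cpow_mult_l, RtoC_pow. ring. Qed.

Lemma ex_series_Rgeom (t : R) : 0 <= t < 1 -> ex_series (fun k => t ^ k).
Proof. intros Ht. apply ex_series_geom. rewrite Rabs_pos_eq; lra. Qed.

(** This is q^(s+m), the ratio of the geometric series in k. *)
Definition qratio (q : R) (s : C) (m : nat) : C := Cexp ((s + INR m) * ln q).

Lemma Cmod_qratio_le (q : R) (s : C) (m : nat) : 0 < q < 1 -> Cmod (qratio q s m) <= exp (Re s * ln q).
Proof.
  intros Hq. unfold qratio. rewrite Cmod_Cexp, re_scal_r, re_plus. simpl (Re (INR m)).
  assert (H := pos_INR m). assert (Hl := ln_q_neg q Hq).
  destruct (Req_dec (INR m) 0) as [E|E].
  - rewrite E, Rplus_0_r. lra.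
  - left. apply exp_increasing. nra.
Qed.

Lemma qzeta_expansion (q : R) (s z : C) : 0 < q < 1 -> 0 < Re z -> 0 < Re s ->
  exists V, Cser (fun m => (poch_coef s (qpow q z) m * / (1 - qratio q s m))%C) V /\
    Cser (qzeta_term q s z) (Cexp (s * Clog (q - q ^ 2)%R) * V)%C.
Proof.
  intros Hq Hz Hs. assert (Hx := Cmod_qpow_lt_1 q z Hq Hz). set (x := qpow q z) in *.
  assert (Hx0 := Cmod_ge_0 x). assert (Hs0 := Cmod_ge_0 s).
  (* t = q^(Re s) bounds every ratio q^(s+m), and t < 1 is where Re s > 0 enters. *)
  set (t := exp (Re s * ln q)).
  assert (Ht : 0 < t < 1).
  { split; [apply exp_pos|]. unfold t. rewrite <- exp_0. apply exp_increasing.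
    generalize (ln_q_neg q Hq). nra. }
  set (A := rcoef (Cmod s + 1) (Cmod x)).
  assert (HA0 : forall m, 0 <= A m) by (intros; apply rcoef_pos; lra).
  assert (HA : ex_series A) by (apply ex_series_rcoef; lra).
  assert (Hc : forall m, Cmod (poch_coef s x m) <= A m) by (intros; apply Cmod_poch_coef_le; lra).
  assert (Hg : forall m, Cmod (qratio q s m) <= t) by (intros; now apply Cmod_qratio_le).
  set (f := fun m => (poch_coef s x m * / (1 - qratio q s m))%C).
  assert (Hf : Cser f (CSeries f)).
  { apply Cser_dominated with (fun m => A m * / (1 - t)); [|now apply ex_series_scal_r].
    intros m. assert (Hd : 1 - t <= Cmod (1 - qratio q s m)).
    { generalize (Cmod_triangle_rev 1 (- qratio q s m)). rewrite Cmod_opp, Cmod_1.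
      unfold Cminus. generalize (Hg m). lra. }
    unfold f. rewrite Cmod_mult, Cmod_inv by (apply Cmod_gt_0; lra).
    apply Rmult_le_compat; [apply Cmod_ge_0|left; apply Rinv_0_lt_compat; lra|apply Hc|].
    apply Rinv_le_contravar; lra. }
  exists (CSeries f). split; [exact Hf|].
  eapply Cser_ext; [intros k; symmetry; now apply qzeta_term_eq|]. fold x. apply Cser_scal.
  apply (Cser_Fubini (fun m k => (poch_coef s x m * qratio q s m ^ k)%C) A (fun k => t ^ k) f); try assumption.
  - intros m k. rewrite Cmod_mult, Cmod_pow. apply Rmult_le_compat; [apply Cmod_ge_0| |apply Hc|].
    + apply pow_le, Cmod_ge_0.
    + apply pow_incr. split; [apply Cmod_ge_0|apply Hg].
  - intros k. apply pow_le. lra.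
  - apply ex_series_Rgeom. lra.
  - intros m. apply Cser_scal, Cser_geom. eapply Rle_lt_trans; [apply Hg|]. lra.
  - intros k.
    (* For fixed k, q^((s+m)k) = q^(sk) (q^k)^m, so the sum over m is a binomial series at q^k x. *)
    eapply Cser_ext; [|apply (Cser_scal (Cexp (s * ln q) ^ k)%C), (binomial_series s ((q ^ k)%R * x))].
    + intros m. cbv beta. rewrite poch_coef_mult. unfold qratio.
      rewrite Cmult_plus_distr_r, Cexp_plus, Cpow_mult_l.
      replace (Cexp (INR m * ln q) ^ k)%C with (RtoC ((q ^ k) ^ m)); [ring|].
      rewrite <- (Cexp_nat (INR m * ln q) k), <- !RtoC_mult.
      unfold Cexp. simpl. rewrite cos_0, sin_0.
      replace (exp (INR m * ln q * INR k)) with ((q ^ k) ^ m); [apply C_ext; simpl; ring|].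
      rewrite <- pow_mult, <- Rpower_pow by lra. unfold Rpower. f_equal. rewrite mult_INR. ring.
    + assert (0 < q ^ k <= 1).
      { split; [apply pow_lt; lra|]. rewrite <- (pow1 k). apply pow_incr. lra. }
      rewrite Cmod_mult, Cmod_R, Rabs_pos_eq by lra. nra.
Qed.

Lemma Re_pos_not_exceptional (q : R) (s : C) : 0 < q < 1 -> 0 < Re s -> ~ exceptional q s.
Proof.
  intros Hq Hs He. apply exceptional_node in He. destruct He as [r [l E]].
  apply (f_equal Re) in E. rewrite Re_qnode in E by exact Hq. simpl in E.
  generalize (pos_INR r). lra.
Qed.

(** [coth_partial_fractions] at u = (s+m) log q, halved: since delta log q = 2 pi i, u + 2 pi i l is
    log q times the node s + m + delta l. *)
Lemma inv_one_minus_qratio (q : R) (s : C) (m : nat) : 0 < q < 1 -> 0 < Re s ->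
  Cser (fun n => (- (/ ln q) * (/ qnode q s (Z.of_nat (S n)) m + / qnode q s (- Z.of_nat (S n)) m))%C)
    (/ (1 - qratio q s m) - (1 / 2)%R + / ln q * / (s + INR m))%C.
Proof.
  intros Hq Hs. assert (Hl := ln_q_neg q Hq). assert (Hm := pos_INR m).
  assert (HlC : RtoC (ln q) <> 0) by (intros E; apply RtoC_inj in E; lra).
  set (u := ((s + INR m) * ln q)%C).
  assert (Hu : Re u < 0).
  { unfold u. rewrite re_scal_r, re_plus. simpl (Re (INR m)). nra. }
  assert (Hw : (s + INR m)%C <> 0).
  { intros E. apply (f_equal Re) in E. rewrite re_plus in E. simpl in E. unfold Re in *. lra. }
  assert (Hd : (1 - Cexp u)%C <> 0).
  { intros E. assert (Hc : Cmod (Cexp u) < 1) by (rewrite Cmod_Cexp, <- exp_0; now apply exp_increasing).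
    apply (Rlt_irrefl 1). rewrite <- Cmod_1 at 1. replace (RtoC 1) with (Cexp u); [exact Hc|].
    symmetry. now apply Ceq_minus. }
  assert (Hne : forall l, qnode q s l m <> 0).
  { intros l E. apply (Re_pos_not_exceptional q s Hq Hs), exceptional_node. now exists m, l. }
  assert (En : forall l : Z, (u + Ci * (2 * PI * IZR l)%R = ln q * qnode q s l m)%C).
  { intros l. unfold u, qnode. rewrite qdelta_eq by exact Hq. apply C_ext; simpl; field; lra. }
  replace (/ (1 - qratio q s m) - (1 / 2)%R + / ln q * / (s + INR m))%C
    with ((1 / 2)%R * (Kcoth u + 2 / u))%C.
  - eapply Cser_ext; [|apply Cser_scal, coth_partial_fractions, Hu].
    intros n. cbv beta.
    replace (INR (S n)) with (IZR (Z.of_nat (S n))) by (symmetry; apply INR_IZR_INZ).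
    rewrite <- opp_IZR, !En.
    assert (H1 := Hne (Z.of_nat (S n))). assert (H2 := Hne (- Z.of_nat (S n))%Z).
    rewrite RtoC_div by lra. field. repeat split; assumption.
  - unfold Kcoth, qratio. fold u. rewrite RtoC_div by lra.
    assert (Hu0 : u <> 0) by (unfold u; now apply Cmult_neq_0).
    replace (/ ln q * / (s + INR m))%C with (/ u)%C by (unfold u; field; split; assumption).
    field. repeat split; assumption.
Qed.

Lemma qzeta_rhs_series (q : R) (s z V : C) : 0 < q < 1 -> 0 < Re z -> 0 < Re s ->
  Cser (fun m => (poch_coef s (qpow q z) m * / (1 - qratio q s m))%C) V ->
  (Cexp (s * Clog (q - q ^ 2)%R) * V = qzeta_rhs q s z)%C.
Proof.
  intros Hq Hz Hs HV. assert (Hx := Cmod_qpow_lt_1 q z Hq Hz).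
  assert (Hex := Re_pos_not_exceptional q s Hq Hs).
  assert (Hnz : ~ exceptional_nz q s).
  { intros [r [l [_ E]]]. apply Hex. now exists r, l. }
  rewrite qzeta_rhs_eq by assumption. set (x := qpow q z) in *.
  assert (Hx0 := Cmod_ge_0 x). assert (Hs0 := Cmod_ge_0 s).
  assert (Hl := ln_q_neg q Hq).
  assert (HlC : RtoC (ln q) <> 0) by (intros E; apply RtoC_inj in E; lra).
  assert (Hpi : ((0%R, (2 * PI)%R) : C) <> 0).
  { intros E. apply (f_equal Im) in E. simpl in E. generalize PI_RGT_0. lra. }
  destruct (qnode_linear_gap q s Hq Hnz) as [kap [Hk Hgap]].
  assert (Hne : forall l m, qnode q s l m <> 0).
  { intros l m E. apply Hex, exceptional_node. now exists m, l. }
  assert (Hbin := binomial_series s x Hx).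
  assert (Hh : Cser (fun m => (poch_coef s x m * / (s + INR m))%C) (hsum s x s)).
  { apply hsum_correct with (Re s); [exact Hx|exact Hs|]. intros m.
    eapply Rle_trans; [|apply re_le_Cmod]. rewrite re_plus. simpl (Re (INR m)).
    generalize (pos_INR m). intros. rewrite Rabs_pos_eq; lra. }
  (* What remains of [V] once the constant 1/2, summed by the binomial series, and the pole at s + m
     = 0 are split off. *)
  set (W := (V - (1 / 2)%R * Cexp (- (s * Clog (1 - x))) + / ln q * hsum s x s)%C).
  assert (HW : Cser (fun m => (poch_coef s x m *
     (/ (1 - qratio q s m) - (1 / 2)%R + / ln q * / (s + INR m)))%C) W).
  { eapply Cser_ext; [|apply Cser_plus; [apply Cser_plus; [exact HV|
      apply Cser_opp, (Cser_scal (1 / 2)%R), Hbin]|apply (Cser_scal (/ ln q)), Hh]].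
    intros m. cbv beta. ring. }
  assert (Hlsum : Cser (lpair q s z) (lsum q s z)).
  { apply Cser_dominated with (fun n : nat => Cmod (lterm q s z (Z.of_nat (S n)))
        + Cmod (lterm q s z (- Z.of_nat (S n)))).
    - intros n. apply Cmod_triangle.
    - now apply ex_series_Cmod_lterm. }
  set (u := fun m n => (poch_coef s x m *
     (- (/ ln q) * (/ qnode q s (Z.of_nat (S n)) m + / qnode q s (- Z.of_nat (S n)) m)))%C).
  (* The sum of the two nodes is 2(s+m), and s+m is absorbed by (s)_m (s+m) = s (s+1)_m. In this
     form the term has a bound that is a function of m times a function of n. *)
  assert (Eu : forall m n, u m n = (- (2 * s / ln q) * poch_coef (s + 1) x m *
     / qnode q s (Z.of_nat (S n)) m * / qnode q s (- Z.of_nat (S n)) m)%C).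
  { intros m n. unfold u.
    assert (E1 : (poch_coef s x m * (s + INR m) = s * poch_coef (s + 1) x m)%C).
    { unfold poch_coef. transitivity (poch s m * (s + INR m) * (/ INR (fact m) * x ^ m))%C; [ring|].
      rewrite poch_shift. ring. }
    assert (E2 : (qnode q s (Z.of_nat (S n)) m + qnode q s (- Z.of_nat (S n)) m = 2 * (s + INR m))%C).
    { unfold qnode. rewrite opp_IZR, RtoC_opp. ring. }
    assert (H1 := Hne (Z.of_nat (S n)) m). assert (H2 := Hne (- Z.of_nat (S n))%Z m).
    set (n1 := qnode q s (Z.of_nat (S n)) m) in *. set (n2 := qnode q s (- Z.of_nat (S n)) m) in *.
    transitivity (- (/ ln q) * (poch_coef s x m * (n1 + n2)) * / n1 * / n2)%C.
    - field. repeat split; assumption.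
    - rewrite E2. replace (poch_coef s x m * (2 * (s + INR m)))%C
        with (2 * (poch_coef s x m * (s + INR m)))%C by ring.
      rewrite E1. field. repeat split; assumption. }
  assert (HF : Cser (fun n => (s / (0%R, (2 * PI)%R) * lpair q s z n)%C) W).
  { apply (Cser_Fubini u (fun m => 2 * Cmod s / - ln q * rcoef (Cmod (s + 1) + 1) (Cmod x) m)
      (fun n => / kap ^ 2 * / INR (S n) ^ 2)
      (fun m => (poch_coef s x m * (/ (1 - qratio q s m) - (1 / 2)%R + / ln q * / (s + INR m)))%C)).
    - intros m n. rewrite Eu.
      destruct (Z_of_S_neq n) as [N1 N2].
      assert (G1 := Hgap _ m N1). assert (G2 := Hgap _ m N2).
      assert (Hn1 : 1 <= INR (S n)) by (apply (le_INR 1); lia).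
      rewrite opp_IZR, Rabs_Ropp in G2. rewrite <- INR_IZR_INZ, Rabs_pos_eq in G1, G2 by lra.
      rewrite !Cmod_mult, Cmod_opp, !Cmod_inv by apply Hne.
      rewrite Cmod_div, Cmod_mult, !Cmod_R by exact HlC.
      rewrite (Rabs_pos_eq 2), (Rabs_left (ln q)) by lra.
      assert (Hkn : 0 < kap * INR (S n)) by nra.
      assert (Hfront : 0 <= 2 * Cmod s / - ln q).
      { apply Rmult_le_pos; [lra|]. left. apply Rinv_0_lt_compat. lra. }
      assert (HP : Cmod (poch_coef (s + 1) x m) <= rcoef (Cmod (s + 1) + 1) (Cmod x) m).
      { generalize (Cmod_ge_0 (s + 1)). intros. apply Cmod_poch_coef_le; lra. }
      replace (2 * Cmod s / - ln q * rcoef (Cmod (s + 1) + 1) (Cmod x) m * (/ kap ^ 2 * / INR (S n) ^ 2))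
        with (2 * Cmod s / - ln q * rcoef (Cmod (s + 1) + 1) (Cmod x) m
              * / (kap * INR (S n)) * / (kap * INR (S n))) by (field; repeat split; lra).
      assert (HP0 := Cmod_ge_0 (poch_coef (s + 1) x m)).
      assert (I1 : / Cmod (qnode q s (Z.of_nat (S n)) m) <= / (kap * INR (S n)))
        by (apply Rinv_le_contravar; lra).
      assert (I2 : / Cmod (qnode q s (- Z.of_nat (S n)) m) <= / (kap * INR (S n)))
        by (apply Rinv_le_contravar; lra).
      assert (J1 : 0 < / Cmod (qnode q s (Z.of_nat (S n)) m)) by (apply Rinv_0_lt_compat; lra).
      assert (J2 : 0 < / Cmod (qnode q s (- Z.of_nat (S n)) m)) by (apply Rinv_0_lt_compat; lra).
      apply Rmult_le_compat; [|lra| |exact I2].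
      + apply Rmult_le_pos; [|lra]. now apply Rmult_le_pos.
      + apply Rmult_le_compat; [now apply Rmult_le_pos|lra| |exact I1].
        now apply Rmult_le_compat_l.
    - intros m. apply Rmult_le_pos.
      + apply Rmult_le_pos; [lra|]. left. apply Rinv_0_lt_compat. lra.
      + apply rcoef_pos; [generalize (Cmod_ge_0 (s + 1)); lra|exact Hx0].
    - intros n. apply Rmult_le_pos; left; apply Rinv_0_lt_compat, pow_lt; [exact Hk|].
      apply lt_0_INR. lia.
    - apply ex_series_scal_l with (a := rcoef (Cmod (s + 1) + 1) (Cmod x)).
      apply ex_series_rcoef; [generalize (Cmod_ge_0 (s + 1)); lra|lra].
    - apply ex_series_scal_l with (a := fun n => / INR (S n) ^ 2). apply ex_series_inv_sq.
    - intros m. apply Cser_scal. now apply inv_one_minus_qratio.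
    - intros n. destruct (Z_of_S_neq n) as [N1 N2].
      assert (Hn1 : 1 <= INR (S n)) by (apply (le_INR 1); lia).
      assert (G : forall l, l <> 0%Z -> forall m, kap <= Cmod (qnode q s l m)).
      { intros l Hl0 m. eapply Rle_trans; [|apply (Hgap l m Hl0)].
        assert (1 <= Rabs (IZR l)) by (rewrite <- abs_IZR; apply IZR_le; lia). nra. }
      unfold lpair.
      rewrite (lterm_eq q s z (Z.of_nat (S n)) kap Hq Hz N1 Hk (G _ N1)).
      rewrite (lterm_eq q s z (- Z.of_nat (S n)) kap Hq Hz N2 Hk (G _ N2)). fold x.
      set (l := IZR (Z.of_nat (S n))).
      assert (Hl0 : l <> 0) by (intros E; now apply eq_IZR_R0 in E).
      assert (HlC0 : RtoC l <> 0) by (intros E; now apply RtoC_inj in E).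
      eapply Cser_ext; [|apply Cser_scal, Cser_plus; apply Cser_scal;
        apply (hsum_correct (s + 1) x _ kap Hx Hk); [apply (G _ N1)|apply (G _ N2)]].
      intros m. cbv beta. rewrite Eu.
      change (s + qdelta q * l + INR m)%C with (qnode q s (Z.of_nat (S n)) m).
      change (s + qdelta q * IZR (- Z.of_nat (S n)) + INR m)%C with (qnode q s (- Z.of_nat (S n)) m).
      (* In [lpair] the prefactors 1/l and -1/l turn the two inverses into a difference; its
         numerator is a multiple of 2 delta l, so l cancels and the expression of [Eu] reappears. *)
      assert (E2 : (qnode q s (Z.of_nat (S n)) m - qnode q s (- Z.of_nat (S n)) m
         = 2 * ((0%R, (2 * PI)%R) / ln q) * l)%C).
      { unfold qnode, qdelta. rewrite opp_IZR, RtoC_opp. fold l. ring. }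
      assert (H1 := Hne (Z.of_nat (S n)) m). assert (H2 := Hne (- Z.of_nat (S n))%Z m).
      rewrite opp_IZR, RtoC_opp. fold l.
      set (n1 := qnode q s (Z.of_nat (S n)) m) in *. set (n2 := qnode q s (- Z.of_nat (S n)) m) in *.
      set (tpi := ((0%R, (2 * PI)%R) : C)) in *. set (p := poch_coef (s + 1) x m).
      transitivity (- (s / tpi * p * / l * / n1 * / n2) * (n1 - n2))%C.
      + field. repeat split; assumption.
      + rewrite E2. field. repeat split; assumption.
    - exact HW. }
  assert (EW : W = (s / (0%R, (2 * PI)%R) * lsum q s z)%C).
  { apply (Cser_unique _ _ _ HF). now apply Cser_scal. }
  assert (Hy := Re_one_minus_pos x Hx).
  (* Identifies (q - q^2)^s (1 - x)^(-s) with the principal power of the quotient in the middle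
     term. *)
  rewrite (Clog_div_l (1 - x) (q - q ^ 2)) by (try exact Hy; nra).
  rewrite (Clog_RtoC (q - q ^ 2)) by nra.
  replace (s * (ln (q - q ^ 2) - Clog (1 - x)))%C
    with (s * ln (q - q ^ 2)%R + - (s * Clog (1 - x)))%C by ring.
  rewrite Cexp_plus.
  replace V with (W + (1 / 2)%R * Cexp (- (s * Clog (1 - x))) - / ln q * hsum s x s)%C by (unfold W; ring).
  rewrite EW. unfold Cdiv. ring.
Qed.

Theorem theorem1 (q : R) (z : C) (P : C -> Prop) (Zf : C -> C) :
  0 < q < 1 -> 0 < Re z ->
  is_qzeta_continuation q z P Zf ->
  (* the series over l <> 0 converges absolutely and is holomorphic off the exceptional set *)
  (forall s : C, ~ exceptional_nz q s ->
     ex_series (fun n : nat => Cmod (lterm q s z (Z.of_nat (S n)))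
                               + Cmod (lterm q s z (- Z.of_nat (S n))))) /\
  (forall s : C, ~ exceptional_nz q s ->
     @ex_derive C_AbsRing C_NormedModule (fun t => lsum q t z) s) /\
  (* the formula for zeta(s,z:q) *)
  (forall s : C, ~ exceptional q s -> ~ P s -> Zf s = qzeta_rhs q s z).
Proof.
  intros Hq Hz [HP [Hhol Hser]]. split; [|split].
  - intros s Hs. now apply ex_series_Cmod_lterm.
  - intros s Hs. destruct (lsum_cdiffable q s z Hq Hz Hs) as [d Hd].
    exists d. now apply cdiff_is_derive.
  - intros s Hs HPs. apply Ceq_minus.
    (* The difference of the two sides is differentiable only off both singular sets, and their
       union is again discrete and closed. *)
    apply (identity_principle (fun t => P t \/ exceptional q t) (fun t => (Zf t - qzeta_rhs q t z)%C));
      [now apply discrete_closed_union, exceptional_discrete_closed| | |tauto].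
    + intros t Ht. apply cdiffable_ext with (r := 1) (f := fun t => (Zf t + - (1) * qzeta_rhs q t z)%C);
        [lra|intros h _; ring|].
      apply cdiffable_plus.
      * destruct (Hhol t) as [d Hd]; [tauto|]. exists d. now apply cdiff_is_derive.
      * apply cdiffable_mult; [apply cdiffable_const|]. apply qzeta_rhs_cdiffable; tauto.
    (* For Re t > 0 both sides are the sum of one series, and sums are unique. *)
    + intros t Ht _. apply (proj1 (Ceq_minus _ _)).
      destruct (qzeta_expansion q t z Hq Hz Ht) as [V [HV1 HV2]].
      rewrite <- (qzeta_rhs_series q t z V Hq Hz Ht HV1).
      exact (Cser_unique _ _ _ (Hser t Ht) HV2).
Qed.
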